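(* Let $\mathcal{A}$ and $\mathcal{B}$ be C*-algebras. Then $\mathcal{A}$ and $\mathcal{B}$ are isomorphic as Jordan algebras if and only if there is a bounded bijective linear map $\theta:\mathcal{A}\to\mathcal{B}$ sending zero products in $\mathcal{A}_{sa}$ to zero products in $\mathcal{B}$, i.e. such that $\theta(a)\theta(b)=0$ for all $a,b\in\mathcal{A}_{sa}$ with $ab=0$. Moreover, if $\theta:\mathcal{A}\to\mathcal{B}$ is a bounded linear map sending zero products in $\mathcal{A}_{sa}$ to zero products in $\mathcal{B}$ which is just surjective (not necessarily injective), then $\mathcal{B}$ is isomorphic, as a Jordan algebra, to the C*-algebra $\mathcal{A}/\ker\theta$ (in particular, $\ker\theta$ is a closed two-sided ideal of $\mathcal{A}$).
   Context: C*-algebras are complex and are not assumed to have an identity. $\mathcal{A}_{sa}$ denotes the set of all self-adjoint elements of $\mathcal{A}$. A linear map $J$ between two algebras is a Jordan homomorphism if $J(xy+yx)=J(x)J(y)+J(y)J(x)$ for all $x,y$. Two C*-algebras are isomorphic as Jordan algebras if there is a bijective (complex-)linear Jordan homomorphism between them (it is not required to preserve the involution). The map $\theta$ is not assumed to preserve the involution. *)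

(* Defs.v *)
From HB Require Import structures.
From mathcomp Require Import all_boot all_order all_algebra.
From mathcomp Require Import ring lra generic_quotient ring_quotient complex.
From mathcomp Require Import all_classical all_reals all_analysis.

Set Implicit Arguments.
Unset Strict Implicit.
Unset Printing Implicit Defensive.

Import Order.TTheory GRing.Theory Num.Theory.
Import numFieldNormedType.Exports.

Local Open Scope classical_set_scope.
Local Open Scope ring_scope.
Local Open Scope complex_scope.
Local Open Scope quotient_scope.

(* MathComp rings are unital, so associative algebras without an identity are
   set up here on top of [lmodType]. *)
HB.mixin Record Lmodule_isNonUnitalAlgebra (K : pzRingType) V
    & GRing.Lmodule K V := {
  nmul : V -> V -> V;
  nmulA : associative nmul;
  nmulDl : left_distributive nmul +%R;
  nmulDr : right_distributive nmul +%R;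
  nscaleAl : forall (k : K) (x y : V), k *: nmul x y = nmul (k *: x) y;
  nscaleAr : forall (k : K) (x y : V), k *: nmul x y = nmul x (k *: y)
}.

#[short(type="nonUnitalAlgType")]
HB.structure Definition NonUnitalAlgebra (K : pzRingType) :=
  {V of GRing.Lmodule K V & Lmodule_isNonUnitalAlgebra K V}.

Notation "x ** y" := (nmul x y) (at level 40, left associativity) : ring_scope.

(* Norms of modules over [R[i]] take their values in [R[i]]; they are
   nonnegative, hence real. *)
HB.mixin Record isBanachStarAlgebra (R : realType) V
    & CompleteNormedModule R[i] V & NonUnitalAlgebra R[i] V := {
  star : V -> V;
  starK : involutive star;
  starD : {morph star : x y / x + y};
  starZ : forall (k : R[i]) (x : V), star (k *: x) = k^* *: star x;
  starM : forall x y : V, star (x ** y) = star y ** star x;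
  ler_norm_nmul : forall x y : V, `|x ** y| <= `|x| * `|y|
}.

#[short(type="banachStarAlgType")]
HB.structure Definition BanachStarAlgebra (R : realType) :=
  {V of CompleteNormedModule R[i] V & NonUnitalAlgebra R[i] V
   & isBanachStarAlgebra R V}.

Definition cstar_identity (R : realType) (V : banachStarAlgType R) : Prop :=
  forall x : V, `|star x ** x| = `|x| ^+ 2.

HB.mixin Record BanachStarAlgebra_isCStarAlgebra (R : realType) V
    & BanachStarAlgebra R V := {
  norm_star_nmul : cstar_identity V
}.

#[short(type="cstarAlgType")]
HB.structure Definition CStarAlgebra (R : realType) :=
  {V of BanachStarAlgebra R V & BanachStarAlgebra_isCStarAlgebra R V}.

Section Jordan.
Variable K : pzRingType.

Definition jordan_hom (A B : nonUnitalAlgType K) (J : A -> B) : Prop :=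
  forall x y : A, J (x ** y + y ** x) = J x ** J y + J y ** J x.

Definition jordan_isomorphic (A B : nonUnitalAlgType K) : Prop :=
  exists J : {linear A -> B}, bijective J /\ jordan_hom J.

End Jordan.

Definition bounded_op (R : realType) (V W : normedModType R[i])
    (f : V -> W) : Prop :=
  exists M : R, forall x : V, `|f x| <= M%:C * `|x|.

Definition self_adjoint (R : realType) (A : banachStarAlgType R) : set A :=
  [set a | star a = a].

Definition zero_product_preserving_sa (R : realType)
    (A B : banachStarAlgType R) (f : A -> B) : Prop :=
  forall a b : A, self_adjoint a -> self_adjoint b ->
    a ** b = 0 -> f a ** f b = 0.

(* Closed two-sided ideals. Stability under the involution is automatic in a
   C*-algebra but not in a Banach *-algebra, and it is what makes the
   involution of the quotient well defined. *)
Record closedIdeal (R : realType) (A : banachStarAlgType R) := ClosedIdeal {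
  ideal_set :> set A;
  cideal0 : ideal_set 0;
  cidealD : forall x y, ideal_set x -> ideal_set y -> ideal_set (x + y);
  cidealZ : forall (k : R[i]) x, ideal_set x -> ideal_set (k *: x);
  cidealMl : forall a x, ideal_set x -> ideal_set (a ** x);
  cidealMr : forall a x, ideal_set x -> ideal_set (x ** a);
  cideal_star : forall x, ideal_set x -> ideal_set (star x);
  cideal_closed : closed ideal_set
}.

(* The quotient A / I with the quotient operations and the quotient norm
   |a + I| = inf {|b| : b in a + I} is a Banach *-algebra. The C*-identity
   is not part of the construction. *)
Section QuotientAlgebra.
Variables (R : realType) (A : banachStarAlgType R) (I : closedIdeal A).

Definition ideal_pred : {pred A} := [pred x | `[< ideal_set I x >]].

Lemma ideal_predP x : x \in ideal_pred <-> ideal_set I x.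
Proof. exact: iff_sym (rwP (asboolP _)). Qed.

Lemma ideal_zmod_closed : zmod_closed ideal_pred.
Proof.
split; first by apply/ideal_predP; exact: cideal0.
move=> x y /ideal_predP Ix /ideal_predP Iy; apply/ideal_predP.
by apply: cidealD => //; rewrite -scaleN1r; exact: cidealZ.
Qed.

HB.instance Definition _ := GRing.isZmodClosed.Build A ideal_pred
  ideal_zmod_closed.

Definition quotientAlg := Quotient.quot ideal_pred.

HB.instance Definition _ := GRing.Zmodule.on quotientAlg.

Definition proj (a : A) : quotientAlg := \pi_(Quotient.quot ideal_pred) a.

Definition qrepr (q : quotientAlg) : A := repr q.

Lemma qreprK : cancel qrepr proj.
Proof. exact: reprK. Qed.

Lemma projP a b : proj a = proj b <-> ideal_set I (a - b).
Proof.
rewrite -ideal_predP (Quotient.idealrBE ideal_pred).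
exact: (rwP eqP).
Qed.

Lemma projD : {morph proj : a b / a + b}.
Proof. by move=> a b; rewrite /proj raddfD. Qed.

Lemma projB : {morph proj : a b / a - b}.
Proof. by move=> a b; rewrite /proj raddfB. Qed.

Lemma proj0 : proj 0 = 0.
Proof. by rewrite /proj raddf0. Qed.

Lemma qrepr_proj a : ideal_set I (qrepr (proj a) - a).
Proof. by apply/projP; rewrite qreprK. Qed.

Definition quot_scale (k : R[i]) (q : quotientAlg) : quotientAlg :=
  proj (k *: qrepr q).

Definition quot_mul (p q : quotientAlg) : quotientAlg :=
  proj (qrepr p ** qrepr q).

Definition quot_star (q : quotientAlg) : quotientAlg := proj (star (qrepr q)).

Lemma proj_scale k a : quot_scale k (proj a) = proj (k *: a).
Proof. by apply/projP; rewrite -scalerBr; apply: cidealZ; exact: qrepr_proj.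
Qed.

Lemma nmulBr (x y z : A) : x ** (y - z) = x ** y - x ** z.
Proof. by rewrite nmulDr -scaleN1r -nscaleAr scaleN1r. Qed.

Lemma nmulBl (x y z : A) : (y - z) ** x = y ** x - z ** x.
Proof. by rewrite nmulDl -scaleN1r -nscaleAl scaleN1r. Qed.

Lemma proj_mul a b : quot_mul (proj a) (proj b) = proj (a ** b).
Proof.
apply/projP; set a' := qrepr _; set b' := qrepr _.
rewrite -(subrKA (a' ** b)) -nmulBr -nmulBl.
by apply: cidealD; [apply: cidealMl|apply: cidealMr]; exact: qrepr_proj.
Qed.

Lemma proj_star a : quot_star (proj a) = proj (star a).
Proof.
apply/projP.
have -> : star (qrepr (proj a)) - star a = star (qrepr (proj a) - a).
  rewrite starD; congr (_ + _).
  by rewrite -[- a]scaleN1r starZ rmorphN rmorph1 scaleN1r.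
by apply: cideal_star; exact: qrepr_proj.
Qed.

Lemma quot_scaleA k l q : quot_scale k (quot_scale l q) = quot_scale (k * l) q.
Proof. by rewrite -(qreprK q) !proj_scale scalerA. Qed.

Lemma quot_scale1 : left_id 1 quot_scale.
Proof. by move=> q; rewrite -(qreprK q) proj_scale scale1r. Qed.

Lemma quot_scaleDr : right_distributive quot_scale +%R.
Proof.
move=> k p q; rewrite -(qreprK p) -(qreprK q) -projD !proj_scale.
by rewrite scalerDr projD.
Qed.

Lemma quot_scaleDl q : {morph quot_scale^~ q : k l / k + l}.
Proof. by move=> k l; rewrite -(qreprK q) !proj_scale scalerDl projD. Qed.

HB.instance Definition _ := GRing.Zmodule_isLmodule.Build R[i] quotientAlg
  quot_scaleA quot_scale1 quot_scaleDr quot_scaleDl.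

Lemma projZ k a : proj (k *: a) = k *: proj a.
Proof. exact/esym/proj_scale. Qed.

Lemma quot_mulA : associative quot_mul.
Proof.
by move=> p q r; rewrite -(qreprK p) -(qreprK q) -(qreprK r) !proj_mul nmulA.
Qed.

Lemma quot_mulDl : left_distributive quot_mul +%R.
Proof.
move=> p q r; rewrite -(qreprK p) -(qreprK q) -(qreprK r) -projD !proj_mul.
by rewrite nmulDl projD.
Qed.

Lemma quot_mulDr : right_distributive quot_mul +%R.
Proof.
move=> p q r; rewrite -(qreprK p) -(qreprK q) -(qreprK r) -projD !proj_mul.
by rewrite nmulDr projD.
Qed.

Lemma quot_scaleAl (k : R[i]) p q : k *: quot_mul p q = quot_mul (k *: p) q.
Proof.
rewrite -[_ *: _]/(quot_scale k _) -[k *: p]/(quot_scale k p).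
by rewrite -(qreprK p) -(qreprK q) !(proj_scale, proj_mul) nscaleAl.
Qed.

Lemma quot_scaleAr (k : R[i]) p q : k *: quot_mul p q = quot_mul p (k *: q).
Proof.
rewrite -[_ *: _]/(quot_scale k _) -[k *: q]/(quot_scale k q).
by rewrite -(qreprK p) -(qreprK q) !(proj_scale, proj_mul) nscaleAr.
Qed.

HB.instance Definition _ := Lmodule_isNonUnitalAlgebra.Build R[i] quotientAlg
  quot_mulA quot_mulDl quot_mulDr quot_scaleAl quot_scaleAr.

Lemma ReK (z : R[i]) : 0 <= z -> (complex.Re z)%:C = z.
Proof. by move=> z0; rewrite RRe_real// ger0_real. Qed.

Lemma real_complexM (x y : R) : (x * y)%:C = x%:C * y%:C.
Proof. exact: rmorphM. Qed.

Definition rnorm (a : A) : R := complex.Re `|a|.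

Lemma rnormE a : (rnorm a)%:C = `|a|.
Proof. by rewrite /rnorm ReK. Qed.

Lemma rnorm_ge0 a : 0 <= rnorm a.
Proof. by rewrite -(lecR 0) rnormE; exact: normr_ge0. Qed.

Definition coset_norms (q : quotientAlg) : set R :=
  [set rnorm a | a in [set a | proj a = q]].

Definition quot_rnorm (q : quotientAlg) : R := inf (coset_norms q).

Definition quot_norm (q : quotientAlg) : R[i] := (quot_rnorm q)%:C.

Lemma coset_norms_has_inf q : has_inf (coset_norms q).
Proof.
split; first by exists (rnorm (qrepr q)), (qrepr q) => //=; exact: qreprK.
by exists 0 => _ [a _ <-]; exact: rnorm_ge0.
Qed.

Lemma quot_rnorm_ge0 q : 0 <= quot_rnorm q.
Proof.
apply: lb_le_inf; first by have [] := coset_norms_has_inf q.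
by move=> _ [a _ <-]; exact: rnorm_ge0.
Qed.

Lemma quot_rnorm_le a : quot_rnorm (proj a) <= rnorm a.
Proof.
by apply: ge_inf; [have [] := coset_norms_has_inf (proj a) | exists a].
Qed.

Lemma quot_rnorm_lt q e :
  quot_rnorm q < e -> exists2 a, proj a = q & rnorm a < e.
Proof.
move=> qe; have [] := inf_lt (proj1 (coset_norms_has_inf q)) qe.
by move=> _ [a aq <-] ae; exists a.
Qed.

Lemma le_quot_rnorm q (r : R) :
  (forall e : R, 0 < e -> exists2 a, proj a = q & rnorm a <= r + e) ->
  quot_rnorm q <= r.
Proof.
move=> H; apply/ler_addgt0Pr => e /H[a <- ae].
exact: le_trans (quot_rnorm_le a) ae.
Qed.

Lemma quot_rnorm_adh q (e : R) : 0 < e ->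
  exists2 a, proj a = q & rnorm a < quot_rnorm q + e.
Proof. by move=> e0; apply: quot_rnorm_lt; rewrite ltrDl. Qed.

Lemma rnormD a b : rnorm (a + b) <= rnorm a + rnorm b.
Proof. by rewrite -lecR rmorphD /= !rnormE ler_normD. Qed.

Lemma quot_normD p q : quot_norm (p + q) <= quot_norm p + quot_norm q.
Proof.
rewrite /quot_norm -rmorphD /= lecR; apply: le_quot_rnorm => e e0.
have e2 : 0 < e / 2 by rewrite divr_gt0.
have [a <- ha] := quot_rnorm_adh p e2; have [b <- hb] := quot_rnorm_adh q e2.
exists (a + b); first exact: projD.
apply: le_trans (rnormD _ _) _.
by rewrite [e in leRHS]splitr addrACA lerD// ltW.
Qed.

Lemma rnormZ (k : R[i]) a : rnorm (k *: a) = complex.Re `|k| * rnorm a.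
Proof.
by apply: complexI; rewrite real_complexM !rnormE normrZ ReK.
Qed.

Lemma quot_rnormZ_le (k : R[i]) q :
  quot_rnorm (k *: q) <= complex.Re `|k| * quot_rnorm q.
Proof.
have k0 : 0 <= complex.Re `|k| by rewrite -(lecR 0) ReK //; exact: normr_ge0.
apply: le_quot_rnorm => e e0.
have d0 : 0 < e / (complex.Re `|k| + 1) by rewrite divr_gt0// ltr_wpDl.
have [a <- ha] := quot_rnorm_adh q d0.
exists (k *: a); first exact: projZ.
rewrite rnormZ (le_trans (ler_wpM2l k0 (ltW ha)))// mulrDr lerD2l.
by rewrite mulrCA ler_piMr ?ltW// ltr_pdivrMr ?mul1r ?ltrDl// ltr_wpDl.
Qed.

Lemma quot_normZ (k : R[i]) q : quot_norm (k *: q) = `|k| * quot_norm q.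
Proof.
have kE : `|k| = (complex.Re `|k|)%:C by rewrite ReK.
rewrite /quot_norm kE -real_complexM; congr (_%:C).
apply/eqP; rewrite eq_le quot_rnormZ_le andTb.
have [->|k0] := eqVneq k 0.
  by rewrite normr0 mul0r; exact: quot_rnorm_ge0.
have k1 : 0 < complex.Re `|k| by rewrite -(ltcR 0) -kE; rewrite normr_gt0.
rewrite -ler_pdivlMl//; have := quot_rnormZ_le k^-1 (k *: q).
rewrite scalerA mulVf// scale1r; congr (_ <= _ * _).
apply: complexI; rewrite ReK// normfV [in LHS]kE.
exact/esym/fmorphV.
Qed.

Lemma quot_norm0_eq0 q : quot_norm q = 0 -> q = 0.
Proof.
move=> /complexI q0; rewrite -(qreprK q) -proj0; apply/projP; rewrite subr0.
apply: (@cideal_closed _ _ I) => V /nbhs_normP[e /= e0 eV].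
have eE : (complex.Re e)%:C = e by rewrite ReK// ltW.
have /quot_rnorm_lt[a aq ha] : quot_rnorm q < complex.Re e.
  by rewrite q0 -(ltcR 0) eE.
exists (qrepr q - a); split; first by apply/projP; rewrite qreprK.
by apply: eV; rewrite /ball_/= opprB addrC subrK -rnormE -eE ltcR.
Qed.

HB.instance Definition _ := Lmodule_isNormed.Build R[i] quotientAlg
  quot_normD quot_normZ quot_norm0_eq0.

Lemma norm_proj_le a : `|proj a| <= `|a|.
Proof. by rewrite -(rnormE a) [leLHS]/(quot_norm _) lecR quot_rnorm_le. Qed.

Lemma proj_lift_near a q (e : R[i]) : `|q - proj a| < e ->
  exists2 b, proj b = q & `|b - a| < e.
Proof.
move=> qae; have e0 : 0 < e by exact: le_lt_trans qae.
have eE : (complex.Re e)%:C = e by rewrite ReK// ltW.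
move: qae; rewrite -eE [ltLHS]/(quot_norm _) ltcR => /quot_rnorm_lt[c cq ce].
exists (c + a); first by rewrite projD cq subrK.
by rewrite addrK -rnormE ltcR.
Qed.

Lemma ler_norm_quot_mul (p q : quotientAlg) : `|quot_mul p q| <= `|p| * `|q|.
Proof.
rewrite [leLHS]/(quot_norm _) [`|p|]/(quot_norm _) [`|q|]/(quot_norm _).
rewrite -real_complexM lecR; apply: le_quot_rnorm => e e0.
set r := quot_rnorm p; set s := quot_rnorm q.
have r0 : 0 <= r by exact: quot_rnorm_ge0.
have s0 : 0 <= s by exact: quot_rnorm_ge0.
pose d := Num.min 1 (e / (r + s + 1)).
have rs0 : 0 < r + s + 1 by rewrite ltr_wpDl// addr_ge0.
have d0 : 0 < d by rewrite lt_min ltr01 divr_gt0.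
have d1 : d <= 1 by rewrite ge_min lexx.
have de : d * (r + s + 1) <= e by rewrite -ler_pdivlMr// ge_min lexx orbT.
have [a aE ha] := quot_rnorm_adh p d0; have [b bE hb] := quot_rnorm_adh q d0.
exists (a ** b); first by rewrite -aE -bE proj_mul.
have : rnorm (a ** b) <= rnorm a * rnorm b.
  by rewrite -lecR real_complexM !rnormE ler_norm_nmul.
move=> /le_trans; apply.
apply: (le_trans (ler_pM (rnorm_ge0 a) (rnorm_ge0 b) (ltW ha) (ltW hb))).
have : d * d <= d * 1 by rewrite ler_wpM2l// ltW.
by rewrite -/r -/s; nra.
Qed.

Lemma quotientAlg_complete (F : set_system quotientAlg) :
  ProperFilter F -> cauchy F -> cvg F.
Proof.
move=> FF /cauchyP Fc.
pose e n : R[i] := 2^-1 ^+ n.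
have e_gt0 n : 0 < e n by rewrite exprn_gt0// invr_gt0.
have eS n : e n.+1 *+ 2 = e n.
  by rewrite /e exprS -mulrnAl -mulr_natr mulVf ?mul1r// pnatr_eq0.
have e_le n m : (n <= m)%N -> e m <= e n.
  by move=> nm; apply: ler_wiXn2l; rewrite // ?invr_ge0 ?invf_le1 ?ler1n.
have /choice[q Fq] : forall n, exists x, F (ball x (e n)).
  by move=> n; exact: Fc.
have qq n : `|q n.+1 - q n| < e n *+ 2.
  have [x []] := filter_ex (filterI (Fq n) (Fq n.+1)).
  rewrite -!ball_normE /ball_/= => x1 x2.
  rewrite -(subrKA x) (le_lt_trans (ler_normD _ _))// mulr2n ltrD//.
    by apply: (lt_le_trans x2); apply: e_le.
  by rewrite distrC.
have step : forall p : nat * A, exists b, proj p.2 = q p.1 ->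
    proj b = q p.1.+1 /\ `|b - p.2| < e p.1 *+ 2.
  move=> [n a] /=; have [aq|] := pselect (proj a = q n); last by exists 0.
  by have := qq n; rewrite -aq => /proj_lift_near[b bq ba]; exists b.
have {step}/choice[f fP] := step.
pose a := fix a n := if n is n'.+1 then f (n', a n') else qrepr (q 0%N).
have aq n : proj (a n) = q n.
  by elim: n => [|n IH]; [exact: qreprK|have [] := fP (n, a n) IH].
have aa n : `|a n.+1 - a n| < e n *+ 2 by have [] := fP (n, a n) (aq n).
have aam n m : `|a (n + m)%N - a n| <= e n *+ 4 - e (n + m)%N *+ 4.
  elim: m => [|m IH]; first by rewrite addn0 !subrr normr0.
  rewrite addnS -(subrKA (a (n + m)%N)) (le_trans (ler_normD _ _))//.
  rewrite addrC (le_trans (lerD IH (ltW (aa _))))//.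
  rewrite -addrA lerD2l -(eS (n + m)%N); move: (e _) => x.
  by rewrite le_eqVlt; apply/orP; left; apply/eqP; ring.
have e_small (eps : R[i]) : 0 < eps -> exists n, e n *+ 4 < eps.
  move=> eps0; have epsE := ReK (ltW eps0); set r := complex.Re eps in epsE.
  have r0 : 0 < r by rewrite -(ltcR 0) epsE.
  pose n := Num.bound (4 / r).
  have rn : 4 / r < n%:R by apply: archi_boundP; rewrite divr_ge0// ltW.
  exists n; rewrite [e n]exprVn -[_ *+ 4]mulr_natl ltr_pdivrMr ?exprn_gt0//.
  rewrite -epsE -natrX -(rmorph_nat (real_complex R)).
  rewrite -(rmorph_nat (real_complex R) (2 ^ n)) -real_complexM ltcR mulrC.
  rewrite -ltr_pdivrMr// (lt_le_trans rn)// ler_nat ltnW//.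
  exact: ltn_expl.
have ac : cvgn a.
  apply/cauchy_cvgP/cauchyP => eps /e_small[n en].
  exists (a n); exists n => // k /= nk.
  rewrite -ball_normE /ball_/= distrC (le_lt_trans _ en)//.
  have := aam n (k - n)%N; rewrite subnKC// => /le_trans; apply.
  by rewrite gerBl mulrn_wge0// ltW.
apply/cvg_ex; exists (proj (lim (a @ \oo))).
apply/cvgrPdist_lt => eps eps0.
have eps2 : 0 < eps / 2 by rewrite divr_gt0.
move/cvgrPdist_lt : ac => /(_ _ eps2)[N _ HN].
have [M HM] := e_small _ eps2.
pose n := maxn N M.
have en : e n < eps / 2.
  rewrite (le_lt_trans _ HM)// (le_trans (e_le M n (leq_maxr _ _)))//.
  by rewrite mulrS lerDl mulrn_wge0// ltW.
apply: filterS (Fq n) => x; rewrite -ball_normE /ball_/= => qx.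
rewrite -(subrKA (q n)) (le_lt_trans (ler_normD _ _))// [ltRHS]splitr ltrD//.
  rewrite -aq -projB (le_lt_trans (norm_proj_le _))//.
  by apply: HN; rewrite /= leq_maxl.
exact: lt_trans qx en.
Qed.

HB.instance Definition _ := Uniform_isComplete.Build quotientAlg
  quotientAlg_complete.

Lemma quot_starK : involutive quot_star.
Proof. by move=> q; rewrite -(qreprK q) !proj_star starK. Qed.

Lemma quot_starD : {morph quot_star : p q / p + q}.
Proof.
move=> p q; rewrite -(qreprK p) -(qreprK q) -projD !proj_star.
by rewrite starD projD.
Qed.

Lemma quot_starZ (k : R[i]) q : quot_star (k *: q) = k^* *: quot_star q.
Proof. by rewrite -(qreprK q) -projZ !proj_star starZ projZ. Qed.

Lemma quot_starM p q :
  quot_star (quot_mul p q) = quot_mul (quot_star q) (quot_star p).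
Proof.
rewrite -(qreprK p) -(qreprK q) !(proj_mul, proj_star).
by rewrite starM.
Qed.

HB.instance Definition _ := isBanachStarAlgebra.Build R quotientAlg
  quot_starK quot_starD quot_starZ quot_starM ler_norm_quot_mul.

End QuotientAlgebra.

(* Main.v *)
(** Commuting real elements [f(h)] and [g(h)] with disjoint supports have orthogonal images under
    [theta], and cutting the spectrum of a self-adjoint [h] by ramps turns this into
    [theta(h f(h)) theta(g(h)) = theta(f(h)) theta(h g(h))].  Linearizing the polynomial cases
    at [h = a + t e], with [e] running through approximate units, shows that
    [L b = lim b theta(e) = lim theta(e) b] exists, is a bijective centralizer of [B], and
    satisfies [L(theta(a^2)) = theta(a)^2]; hence [J = L^-1 theta] is a Jordan homomorphism with
    the kernel of [theta].  This kernel is a closed Jordan ideal, and closed Jordan ideals of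
    C*-algebras are two-sided and self-adjoint.

    Conversely, a Jordan isomorphism preserves commutation, hence zero products of self-adjoint
    elements, and it is continuous: otherwise its separating space is a nonzero closed ideal,
    which contains either an infinite orthogonal sequence, against which a gliding hump argument
    works, or a minimal projection, on whose one-dimensional corner [J] is visibly bounded. *)
Require Import Defs.
From HB Require Import structures.
From mathcomp Require Import all_boot all_order all_algebra cyclic separable cyclotomic complex.
From mathcomp Require Import ring lra zify.
From mathcomp Require Import all_classical all_reals all_analysis.

Set Implicit Arguments.
Unset Strict Implicit.
Unset Printing Implicit Defensive.

Import Order.TTheory GRing.Theory Num.Theory.
Import numFieldNormedType.Exports.

Local Open Scope classical_set_scope.
Local Open Scope ring_scope.
Local Open Scope complex_scope.

(** No spectrum is ever constructed. The functional calculus rests on the inequality |x p(h)| <= |x|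
    sup |p| over [-1, 1], for self-adjoint h with |h| <= 1/2, which is derived from the C*-identity.
    Since [A] may lack an identity, right multiplication operators give a meaning to constants, and
    functions of h must vanish at 0. The bound 1/2 lets an iteration produce the square root of 1 -
    h^2; the identities to be proved are homogeneous, so rescaling to reach it is harmless.

    The obstacle to moving t across theta(f(h)) theta(g(h)) is that a ramp is idempotent only where
    it does not climb. A staircase close to t can thus be moved only when f avoids its climbing
    intervals. Hence f is cut into two pieces, each with its own staircase, whose climbing intervals
    interleave.

    Cubes enter because theta(h^2) theta(h) = theta(h) theta(h^2) linearizes only to a statement
    about commutators with theta(e), whereas theta(h^3) theta(h) = theta(h^2)^2 isolates theta(a^3)
    theta(e). Self-adjoint cube roots then reach all elements. *)

Section NonUnitalIdentities.
Variables (K : pzRingType) (A : nonUnitalAlgType K).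
Implicit Types (x y z : A).

Lemma nmul0r x : 0 ** x = 0.
Proof. by have := nscaleAl 0 x x; rewrite !scale0r. Qed.

Lemma nmulr0 x : x ** 0 = 0.
Proof. by have := nscaleAr 0 x x; rewrite !scale0r. Qed.

Lemma nmulNr x y : (- x) ** y = - (x ** y).
Proof. by rewrite -scaleN1r -nscaleAl scaleN1r. Qed.

Lemma nmulrN x y : x ** (- y) = - (x ** y).
Proof. by rewrite -scaleN1r -nscaleAr scaleN1r. Qed.

Lemma nmul_suml (I : Type) (r : seq I) (P : pred I) (F : I -> A) y :
  (\sum_(i <- r | P i) F i) ** y = \sum_(i <- r | P i) F i ** y.
Proof.
by apply: (big_morph (fun x => x ** y)) => [a b|]; rewrite (nmulDl, nmul0r).
Qed.

Lemma nmul_sumr (I : Type) (r : seq I) (P : pred I) (F : I -> A) y :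
  y ** (\sum_(i <- r | P i) F i) = \sum_(i <- r | P i) y ** F i.
Proof.
by apply: (big_morph (fun x => y ** x)) => [a b|]; rewrite (nmulDr, nmulr0).
Qed.

(** Syntax for a proof by reflection. Scalars are left out and a scaled term counts as an atom,
    which is why scalars are pulled out of products before [nring] is called. Words are nonempty, as
    no identity is there to interpret the empty one. *)
Inductive nexpr :=
  | NVar of nat | NZero | NAdd of nexpr & nexpr | NOpp of nexpr
  | NMul of nexpr & nexpr.

Variable env : seq A.

Fixpoint neval e : A :=
  match e with
  | NVar n => env`_n
  | NZero => 0
  | NAdd a b => neval a + neval b
  | NOpp a => - neval a
  | NMul a b => neval a ** neval b
  end.

(* A signed monomial; the pair [(n, s)] stands for the word [n :: s]. *)
Definition nmono := (bool * (nat * seq nat))%type.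

Fixpoint nword n (s : seq nat) : A :=
  if s is m :: s' then env`_n ** nword m s' else env`_n.

Definition nsign (b : bool) x := if b then - x else x.

Definition nmono_eval (m : nmono) : A := nsign m.1 (nword m.2.1 m.2.2).

Definition npoly_eval (p : seq nmono) : A := foldr (fun m => +%R (nmono_eval m)) 0 p.

Definition nmono_opp (m : nmono) : nmono := (~~ m.1, m.2).

Definition nmono_mul (m1 m2 : nmono) : nmono :=
  (m1.1 (+) m2.1, (m1.2.1, m1.2.2 ++ m2.2.1 :: m2.2.2)).

Fixpoint nnorm e : seq nmono :=
  match e with
  | NVar n => [:: (false, (n, [::]))]
  | NZero => [::]
  | NAdd a b => nnorm a ++ nnorm b
  | NOpp a => map nmono_opp (nnorm a)
  | NMul a b => flatten [seq [seq nmono_mul m1 m2 | m2 <- nnorm b] | m1 <- nnorm a]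
  end.

(** Each monomial is matched with an opposite one, without sorting; [n] is fuel, and the length of
    the list is always enough. *)
Fixpoint ncancel (n : nat) (p : seq nmono) : bool :=
  match n, p with
  | _, [::] => true
  | n'.+1, m :: p' => (nmono_opp m \in p') && ncancel n' (rem (nmono_opp m) p')
  | _, _ => false
  end.

Lemma npoly_eval_cat p q : npoly_eval (p ++ q) = npoly_eval p + npoly_eval q.
Proof. by elim: p => [|m p IH] /=; rewrite ?add0r// IH addrA. Qed.

Lemma nmono_eval_opp m : nmono_eval (nmono_opp m) = - nmono_eval m.
Proof. by case: m => [[] m]; rewrite /nmono_eval /= ?opprK. Qed.

Lemma nword_cat n s m t : nword n (s ++ m :: t) = nword n s ** nword m t.
Proof. by elim: s n => [//|k s IH] n /=; rewrite IH nmulA. Qed.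

Lemma nmono_eval_mul m1 m2 :
  nmono_eval (nmono_mul m1 m2) = nmono_eval m1 ** nmono_eval m2.
Proof.
case: m1 m2 => [[] [n1 s1]] [[] [n2 s2]]; rewrite /nmono_eval /= nword_cat.
- by rewrite nmulNr nmulrN opprK.
- by rewrite nmulNr.
- by rewrite nmulrN.
- by [].
Qed.

Lemma npoly_eval_nnorm e : npoly_eval (nnorm e) = neval e.
Proof.
elim: e => [n||a IHa b IHb|a IHa|a IHa b IHb] /=; rewrite ?addr0//.
- by rewrite npoly_eval_cat IHa IHb.
- rewrite -IHa; elim: (nnorm a) => [|m p IH] /=; first by rewrite oppr0.
  by rewrite IH nmono_eval_opp opprD.
- rewrite -IHa -IHb; elim: (nnorm a) => [|m p IH] /=; first by rewrite nmul0r.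
  rewrite npoly_eval_cat IH nmulDl; congr (_ + _).
  elim: (nnorm b) => [|k q IHq] /=; first by rewrite nmulr0.
  by rewrite IHq nmono_eval_mul nmulDr.
Qed.

Lemma ncancelP n p : ncancel n p -> npoly_eval p = 0.
Proof.
elim: n p => [|n IH] [|m p]//= /andP[mp /IH p0].
have -> : npoly_eval p = nmono_eval (nmono_opp m) + npoly_eval (rem (nmono_opp m) p).
  elim: p mp {p0} => [//|k p IHp] /=; rewrite in_cons.
  have [->//|_] := eqVneq k (nmono_opp m).
  by rewrite orFb => /IHp ->; rewrite addrCA.
by rewrite p0 addr0 nmono_eval_opp subrr.
Qed.

Lemma nring_correct e1 e2 :
  (let p := nnorm (NAdd e1 (NOpp e2)) in ncancel (size p) p) = true ->
  neval e1 = neval e2.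
Proof.
by move=> /ncancelP; rewrite npoly_eval_nnorm /= => /eqP; rewrite subr_eq0 => /eqP.
Qed.

End NonUnitalIdentities.

Ltac nring_mem x l :=
  lazymatch l with
  | nil => constr:(false)
  | x :: _ => constr:(true)
  | _ :: ?l' => nring_mem x l'
  end.

Ltac nring_atoms l t :=
  lazymatch t with
  | ?a + ?b => let l1 := nring_atoms l a in nring_atoms l1 b
  | - ?a => nring_atoms l a
  | ?a ** ?b => let l1 := nring_atoms l a in nring_atoms l1 b
  | 0 => l
  | _ => let b := nring_mem t l in
         lazymatch b with true => l | false => constr:(t :: l) end
  end.

Ltac nring_index x l :=
  lazymatch l with
  | x :: _ => constr:(0%N)
  | _ :: ?l' => let n := nring_index x l' in constr:(S n)
  end.

Ltac nring_quote l t :=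
  lazymatch t with
  | ?a + ?b => let x := nring_quote l a in let y := nring_quote l b in
               constr:(NAdd x y)
  | - ?a => let x := nring_quote l a in constr:(NOpp x)
  | ?a ** ?b => let x := nring_quote l a in let y := nring_quote l b in
               constr:(NMul x y)
  | 0 => constr:(NZero)
  | _ => let n := nring_index t l in constr:(NVar n)
  end.

(* Decides identities of nonunital noncommutative rings. *)
Ltac nring :=
  rewrite ?mulr2n;
  lazymatch goal with
  | |- @eq ?T ?a ?b =>
    lazymatch goal with
    | |- context [@nmul ?K ?A _ _] =>
      let l0 := nring_atoms (@nil (NonUnitalAlgebra.sort A)) a in
      let l := nring_atoms l0 b in
      let x := nring_quote l a in
      let y := nring_quote l b in
      exact: (@nring_correct K A l x y (erefl true))
    | _ =>
      let l0 := nring_atoms (@nil T) a in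
      let l := nring_atoms l0 b in
      let x := nring_quote l a in
      let y := nring_quote l b in
      exact: (@nring_correct _ _ l x y (erefl true))
    end
  end.

(** * Real-valued norms, convergence and the involution *)

Section RealNorm.
Variables (R : realType) (A : banachStarAlgType R).
Implicit Types (x y : A) (r e : R).

Lemma rnorm_le x r : (rnorm x <= r) = (`|x| <= r%:C).
Proof. by rewrite -lecR rnormE. Qed.

Lemma rnorm_lt x r : (rnorm x < r) = (`|x| < r%:C).
Proof. by rewrite -ltcR rnormE. Qed.

Lemma rnorm0 : rnorm (0 : A) = 0.
Proof. by rewrite /rnorm normr0. Qed.

Lemma rnormN x : rnorm (- x) = rnorm x.
Proof. by rewrite /rnorm normrN. Qed.

Lemma rnorm_distC x y : rnorm (x - y) = rnorm (y - x).
Proof. by rewrite /rnorm distrC. Qed.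

Lemma rnorm_eq0 x : (rnorm x == 0) = (x == 0).
Proof.
apply/eqP/eqP => [x0|->]; last exact: rnorm0.
by apply/normr0_eq0; rewrite -rnormE x0.
Qed.

Lemma rnorm_gt0 x : (0 < rnorm x) = (x != 0).
Proof. by rewrite lt_def rnorm_eq0 rnorm_ge0 andbT. Qed.

Lemma rnorm_le0 x : (forall e, 0 < e -> rnorm x <= e) -> x = 0.
Proof.
move=> H; apply/eqP; rewrite -rnorm_eq0 eq_le rnorm_ge0 andbT.
by apply/ler_addgt0Pr => e e0; rewrite add0r H.
Qed.

Lemma rnormB x y : rnorm (x - y) <= rnorm x + rnorm y.
Proof. by rewrite -(rnormN y) rnormD. Qed.

Lemma rnorm_dist_triangle z x y : rnorm (x - y) <= rnorm (x - z) + rnorm (z - y).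
Proof. by rewrite -(subrKA z) rnormD. Qed.

Lemma rnormZr r x : rnorm (r%:C *: x) = `|r| * rnorm x.
Proof. by rewrite rnormZ normc_def /= expr0n /= addr0 sqrtr_sqr. Qed.

Lemma rnormM x y : rnorm (x ** y) <= rnorm x * rnorm y.
Proof. by rewrite -lecR real_complexM !rnormE ler_norm_nmul. Qed.

Lemma rnormM3 x y z : rnorm (x ** y ** z) <= rnorm x * rnorm y * rnorm z.
Proof.
by apply: le_trans (rnormM _ _) _; rewrite ler_wpM2r ?rnorm_ge0 ?rnormM.
Qed.

Lemma rnorm_sum (I : Type) (s : seq I) (P : pred I) (F : I -> A) :
  rnorm (\sum_(i <- s | P i) F i) <= \sum_(i <- s | P i) rnorm (F i).
Proof.
elim/big_rec2: _ => [|i y x _ IH]; first by rewrite rnorm0.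
by apply: le_trans (rnormD _ _) _; rewrite lerD2l.
Qed.

Lemma nbhs_rnorm x (P : set A) :
  nbhs x P <-> exists2 e, 0 < e & forall y, rnorm (x - y) < e -> P y.
Proof.
split=> [/nbhs_normP[e /= e0 eP]|[e e0 eP]].
  have eE : (complex.Re e)%:C = e by rewrite ReK// ltW.
  exists (complex.Re e); first by rewrite -(ltcR 0) eE.
  by move=> y xy; apply: eP; rewrite /ball_/= -eE -rnorm_lt.
apply/nbhs_normP; exists e%:C; first by rewrite /= (ltcR 0).
by move=> y; rewrite /ball_/= -rnorm_lt => /eP.
Qed.

Lemma closed_rnormP (S : set A) x : closed S ->
  (forall e, 0 < e -> exists2 y, S y & rnorm (x - y) <= e) -> S x.
Proof.
move=> Sc H; apply: Sc => P /nbhs_rnorm[e e0 eP].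
have [y Sy xy] := H (e / 2) (divr_gt0 e0 (ltr0n _ 2)).
by exists y; split=> //; apply: eP; rewrite (le_lt_trans xy)// ltr_pdivrMr// ltr_pMr// ltr1n.
Qed.

Lemma closed_rnorm (S : set A) :
  (forall x, (forall e, 0 < e -> exists2 y, S y & rnorm (x - y) <= e) -> S x) ->
  closed S.
Proof.
move=> H x xS; apply: H => e e0.
have [|y [Sy xy]] := xS [set y | rnorm (x - y) <= e]; last by exists y.
by apply/nbhs_rnorm; exists e => // y /ltW.
Qed.

Definition rcauchy (u : nat -> A) := forall e, 0 < e ->
  exists N, forall n m, (N <= n)%N -> (N <= m)%N -> rnorm (u n - u m) <= e.

Definition rcvg (u : nat -> A) (l : A) := forall e, 0 < e ->
  exists N, forall n, (N <= n)%N -> rnorm (u n - l) <= e.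

Lemma complete_rnorm u : rcauchy u -> exists l, rcvg u l.
Proof.
move=> uc; have : cvgn u.
  apply/cauchy_cvgP/cauchyP => e e0.
  have eE : (complex.Re e)%:C = e by rewrite ReK// ltW.
  have [|N HN] := uc (complex.Re e / 2); first by rewrite divr_gt0// -(ltcR 0) eE.
  exists (u N); exists N => // n /= Nn; rewrite -ball_normE /ball_/= -eE -rnorm_lt.
  apply: le_lt_trans (HN _ _ (leqnn _) Nn) _.
  by rewrite ltr_pdivrMr// ltr_pMr// ?ltr1n// -(ltcR 0) eE.
move=> /cvg_ex[l ul]; exists l => e e0.
move/cvgrPdist_le : ul => /(_ e%:C); rewrite (ltcR 0) => /(_ e0)[N _ HN].
by exists N => n Nn; rewrite rnorm_distC rnorm_le; exact: HN.
Qed.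

Lemma star0 : star (0 : A) = 0.
Proof. by have := starZ 0 (0 : A); rewrite scaler0 conjC0 scale0r. Qed.

Lemma starN x : star (- x) = - star x.
Proof. by rewrite -scaleN1r starZ rmorphN rmorph1 scaleN1r. Qed.

Lemma starB x y : star (x - y) = star x - star y.
Proof. by rewrite starD starN. Qed.

Lemma starZr r x : star (r%:C *: x) = r%:C *: star x.
Proof.
by rewrite starZ; congr (_ *: _); exact: conjc_real.
Qed.

Lemma self_adjointD x y : self_adjoint x -> self_adjoint y -> self_adjoint (x + y).
Proof. by rewrite /self_adjoint /= starD => -> ->. Qed.

Lemma self_adjointB x y : self_adjoint x -> self_adjoint y -> self_adjoint (x - y).
Proof. by rewrite /self_adjoint /= starB => -> ->. Qed.

Lemma self_adjointZr r x : self_adjoint x -> self_adjoint (r%:C *: x).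
Proof. by rewrite /self_adjoint /= starZr => ->. Qed.

Lemma self_adjoint_starM x : self_adjoint (star x ** x).
Proof. by rewrite /self_adjoint /= starM starK. Qed.

Lemma self_adjoint_comm x y : self_adjoint x -> self_adjoint y ->
  x ** y = y ** x -> self_adjoint (x ** y).
Proof. by rewrite /self_adjoint /= starM => -> -> ->. Qed.

Lemma cartesian_decomposition x :
  exists a b, [/\ self_adjoint a, self_adjoint b & x = a + 'i *: b].
Proof.
exists ((2^-1)%:C *: (x + star x)), ((2^-1)%:C *: ('i *: (star x - x))).
have h2 : (2^-1)%:C *+ 2 = 1 :> R[i].
  by rewrite -rmorphMn /= -mulr_natr mulVf// pnatr_eq0.
split.
- by apply: self_adjointZr; rewrite /self_adjoint /= starD starK addrC.
- apply: self_adjointZr; rewrite /self_adjoint /= starZ starB starK.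
  by rewrite conjCi scaleNr -scalerN opprB.
- rewrite !scalerA mulrAC -expr2 sqrCi mulN1r scaleNr -scalerN opprB -scalerDr.
  by rewrite addrACA subrr addr0 -mulr2n -scalerMnr scalerMnl h2 scale1r.
Qed.

End RealNorm.

Section CStarNorm.
Variables (R : realType) (A : cstarAlgType R).
Implicit Types (x y h : A).

Lemma rnorm_starM x : rnorm (star x ** x) = rnorm x ^+ 2.
Proof.
apply: complexI; rewrite rnormE norm_star_nmul -rnormE.
exact/esym/rmorphXn.
Qed.

Lemma rnorm_star x : rnorm (star x) = rnorm x.
Proof.
wlog suff H : x / rnorm x <= rnorm (star x).
  by apply/eqP; rewrite eq_le H andbT -{2}(starK x) H.
have [->|x0] := eqVneq x 0; first by rewrite star0.
by rewrite -(ler_pM2r (_ : 0 < rnorm x)) ?rnorm_gt0// -expr2 -rnorm_starM rnormM.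
Qed.

Lemma rnorm_sqr h : self_adjoint h -> rnorm (h ** h) = rnorm h ^+ 2.
Proof. by move=> hh; rewrite -{1}hh rnorm_starM. Qed.

Lemma nmul_eq0_star x : star x ** x = 0 -> x = 0.
Proof.
move=> x0; apply/eqP; rewrite -rnorm_eq0 -sqrf_eq0 -rnorm_starM x0 rnorm0.
exact: eqxx.
Qed.

End CStarNorm.

(** * Norm bound for polynomials in a self-adjoint element *)

Section FourierCoefficients.
Variable C : numClosedFieldType.

Lemma prim_root_exists n : (0 < n)%N -> exists z : C, n.-primitive_root z.
Proof.
move=> n_gt0; pose p : {poly C} := 'X^n - 1.
have [r Dp] := closed_field_poly_normal p.
move: Dp; rewrite (monicP (monicXnsubC 1 n_gt0)) scale1r => Dp.
have rn1 : all n.-unity_root r by apply/allP => z; rewrite -root_prod_XsubC -Dp.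
have sz_r : (n < (size r).+1)%N.
  by rewrite -(size_prod_XsubC r id) -Dp size_XnsubC.
have [|z] := hasP (has_prim_root n_gt0 rn1 _ sz_r); last by exists z.
by rewrite -separable_prod_XsubC -Dp separable_Xn_sub_1// pnatr_eq0 -lt0n.
Qed.

(** Cauchy's estimate with the integral replaced by an average over the roots of unity of order
    [size P]: the order exceeds the degree, so averaging P(z) z^-k isolates exactly one
    coefficient. *)
Lemma coef_le_circle (P : {poly C}) (M : C) k :
  (forall z, `|z| = 1 -> `|P.[z]| <= M) -> `|P`_k| <= M.
Proof.
move=> PM.
have M0 : 0 <= M by apply: le_trans (PM 1 (normr1 _)).
have [Pk|kP] := leqP (size P) k; first by rewrite nth_default// normr0.
have n0 : (0 < size P)%N by exact: leq_ltn_trans kP.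
have [w w_prim] := prim_root_exists n0; set n := size P in n0 w_prim kP *.
have w_n : w ^+ n = 1 by exact: prim_expr_order.
have w1 j : `|w ^+ j| = 1.
  rewrite normrX; suff -> : `|w| = 1 by rewrite expr1n.
  by apply/eqP; rewrite -(@pexpr_eq1 _ _ n)// -normrX w_n normr1.
have w0 : w != 0 by rewrite -normr_eq0 -(expr1 w) w1 oner_neq0.
have sumw l : (l < n)%N ->
    \sum_(j < n) (w ^+ l / w ^+ k) ^+ j = (if l == k then n%:R else 0).
  move=> ln; set z := _ / _; have [lk|lk] := eqVneq l k.
    rewrite /z lk mulfV ?expf_neq0//.
    by under eq_bigr do rewrite expr1n; rewrite sumr_const card_ord.
  have z1 : z - 1 != 0.
    rewrite subr_eq0; apply: contra lk => /eqP zE.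
    have /eqP : w ^+ l = w ^+ k by rewrite -(divfK (expf_neq0 k w0) (w ^+ l)) -/z zE mul1r.
    by rewrite (eq_prim_root_expr w_prim) !modn_small// => /eqP ->.
  apply: (mulfI z1); rewrite mulr0 -subrX1 /z expr_div_n -!exprM !(mulnC _ n).
  by rewrite !exprM w_n !expr1n divr1 subrr.
have key : n%:R * P`_k = \sum_(j < n) P.[w ^+ j] * (w ^+ j) ^- k.
  rewrite (eq_bigr (fun j : 'I_n => \sum_(l < n) P`_l * (w ^+ l / w ^+ k) ^+ j)).
    rewrite exchange_big /= (bigD1 (Ordinal kP))//= -mulr_sumr sumw// eqxx.
    rewrite mulrC big1 ?addr0// => l lk; rewrite -mulr_sumr sumw// ifN ?mulr0//.
  move=> j _; rewrite horner_coef mulr_suml; apply: eq_bigr => l _.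
  by rewrite expr_div_n -!exprM !(mulnC j) mulrA.
have nn0 : 0 < n%:R :> C by rewrite ltr0n.
rewrite -(ler_pM2l nn0) -{1}(ger0_norm (ltW nn0)) -normrM key.
apply: le_trans (ler_norm_sum _ _ _) _.
rewrite -[n in leRHS]card_ord mulr_natl -sumr_const; apply: ler_sum => j _.
by rewrite normrM normfV normrX w1 expr1n invr1 mulr1 PM.
Qed.

End FourierCoefficients.

Section OperatorPolynomials.
Variables (K : comNzRingType) (V : lmodType K) (T : {linear V -> V}).
Implicit Types (p q : {poly K}) (x y : V).

Definition pop p x : V := \sum_(i < size p) p`_i *: iter i T x.

Lemma pop_widen p n x : (size p <= n)%N -> pop p x = \sum_(i < n) p`_i *: iter i T x.
Proof.
move=> pn; rewrite /pop (big_ord_widen n (fun i => p`_i *: iter i T x))//.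
rewrite big_mkcond; apply: eq_bigr => i _; case: ltnP => // ip.
by rewrite nth_default// scale0r.
Qed.

Lemma popD p q x : pop (p + q) x = pop p x + pop q x.
Proof.
pose n := maxn (size p) (size q).
rewrite !(@pop_widen _ n) ?leq_maxl ?leq_maxr ?size_polyD//.
by rewrite -big_split; apply: eq_bigr => i _; rewrite coefD scalerDl.
Qed.

Lemma popZ c p x : pop (c *: p) x = c *: pop p x.
Proof.
rewrite (@pop_widen _ (size p)) ?size_scale_leq// scaler_sumr.
by apply: eq_bigr => i _; rewrite coefZ scalerA.
Qed.

Lemma popC c x : pop c%:P x = c *: x.
Proof.
rewrite (@pop_widen _ 1) ?size_polyC ?leq_b1// big_ord_recl big_ord0 addr0.
by rewrite coefC.
Qed.

Lemma pop1 x : pop 1 x = x.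
Proof. by rewrite -polyC1 popC scale1r. Qed.

Lemma pop0 x : pop 0 x = 0.
Proof. by rewrite -polyC0 popC scale0r. Qed.

Lemma popN p x : pop (- p) x = - pop p x.
Proof. by rewrite -[- p]scaleN1r popZ scaleN1r. Qed.

Lemma popB p q x : pop (p - q) x = pop p x - pop q x.
Proof. by rewrite popD popN. Qed.

Lemma pop_sum (I : Type) (s : seq I) (F : I -> {poly K}) x :
  pop (\sum_(i <- s) F i) x = \sum_(i <- s) pop (F i) x.
Proof. by elim/big_rec2: _ => [|i y z _ <-]; rewrite (pop0, popD). Qed.

Lemma iter_lin n : linear (iter n T).
Proof. by elim: n => [//|n IH] a x y /=; rewrite IH linearP. Qed.

Lemma iter_linear_sum n (I : Type) (s : seq I) (c : I -> K) (F : I -> V) :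
  iter n T (\sum_(i <- s) c i *: F i) = \sum_(i <- s) c i *: iter n T (F i).
Proof.
elim: n => [//|n IH] /=; rewrite IH linear_sum.
by apply: eq_bigr => i _; rewrite linearZ.
Qed.

Lemma pop_is_linear p : linear (pop p).
Proof.
move=> a x y; rewrite /pop scaler_sumr -big_split; apply: eq_bigr => i _ /=.
by rewrite iter_lin scalerDr !scalerA mulrC.
Qed.

Lemma pop_mulX p x : pop (p * 'X) x = T (pop p x).
Proof.
rewrite (@pop_widen _ (size p).+1); last first.
  by rewrite (leq_trans (size_polyMleq _ _))// size_polyX addn2.
rewrite big_ord_recl coefMX scale0r add0r linear_sum; apply: eq_bigr => i _.
by rewrite coefMX /= linearZ.
Qed.

Lemma popM p q x : pop (p * q) x = pop p (pop q x).
Proof.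
elim/poly_ind: p => [|p c IH]; first by rewrite mul0r !pop0.
rewrite mulrDl !popD mul_polyC popZ popC; congr (_ + _).
by rewrite mulrAC !pop_mulX IH.
Qed.

Lemma popX x : pop 'X x = T x.
Proof. by rewrite -['X]mul1r pop_mulX pop1. Qed.

Lemma popXn p n x : pop (p ^+ n) x = iter n (pop p) x.
Proof. by elim: n => [|n IH]; rewrite ?pop1// exprS popM IH. Qed.

Lemma pop_Xn n x : pop 'X^n x = iter n T x.
Proof. by rewrite popXn; elim: n => [//|n IH]; rewrite !iterS IH popX. Qed.

End OperatorPolynomials.

Section SquareRoot.
Variables (R : realType).

Lemma geometric_cauchy (A : banachStarAlgType R) (u : nat -> A) (c : R) :
  (forall n, rnorm (u n.+1 - u n) <= c * 2^-1 ^+ n) -> rcauchy u.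
Proof.
move=> uc; have c0 : 0 <= c.
  by have := uc 0%N; rewrite expr0 mulr1; apply: le_trans; exact: rnorm_ge0.
have H n m : rnorm (u (n + m)%N - u n) <= c * 2 * (2^-1 ^+ n - 2^-1 ^+ (n + m)).
  elim: m => [|m IH]; first by rewrite addn0 !subrr rnorm0 mulr0.
  rewrite addnS; apply: le_trans (rnorm_dist_triangle (u (n + m)%N) _ _) _.
  apply: le_trans (lerD (uc _) IH) _.
  by rewrite exprS le_eqVlt; apply/orP; left; apply/eqP; field.
have H' n m : (n <= m)%N -> rnorm (u m - u n) <= c * 2 * 2^-1 ^+ n.
  move=> nm; have := H n (m - n)%N; rewrite subnKC// => /le_trans; apply.
  rewrite ler_wpM2l ?mulr_ge0// gerBl exprn_ge0// invr_ge0.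
move=> e e0.
pose N := Num.bound (c * 4 / e).
have NP : c * 4 / e < N%:R by apply: archi_boundP; rewrite divr_ge0 ?mulr_ge0// ltW.
exists N => n m Nn Nm.
apply: le_trans (rnorm_dist_triangle (u N) _ _) _.
apply: le_trans (lerD (H' _ _ Nn) (_ : _ <= c * 2 * 2^-1 ^+ N)) _.
  by rewrite rnorm_distC H'.
have -> : c * 2 * 2^-1 ^+ N + c * 2 * 2^-1 ^+ N = c * 4 * 2^-1 ^+ N :> R by ring.
rewrite exprVn ler_pdivrMr ?exprn_gt0// [e * _]mulrC -ler_pdivrMr//.
apply: le_trans (ltW NP) _.
by rewrite -natrX ler_nat ltnW// ltn_expl.
Qed.

Variables (A : cstarAlgType R) (h : A).
Hypotheses (h_sa : self_adjoint h) (h_small : rnorm h <= 2^-1).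

(** A fixed point satisfies 2 s + s^2 + h^2 = 0, that is, (1 + s)^2 = 1 - h^2. For |h| <= 1/2 the
    ball of radius 1/4 is preserved, and on it the map is a contraction. *)
Let step (s : A) : A := (- 2^-1)%:C *: (h ** h + s ** s).
Let u n := iter n step 0.

Let u_sa n : self_adjoint (u n).
Proof.
elim: n => [|n IH]; first exact: star0.
rewrite /u /=; apply: self_adjointZr; apply: self_adjointD;
  by rewrite /self_adjoint /= starM ?h_sa ?IH.
Qed.

Let u_comm n : h ** u n = u n ** h.
Proof.
elim: n => [|n IH]; first by rewrite nmulr0 nmul0r.
rewrite /u /= /step -nscaleAr -nscaleAl nmulDr nmulDl !nmulA.
by rewrite -/(u n) IH -!nmulA IH.
Qed.

Let u_le n : rnorm (u n) <= 4^-1.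
Proof.
elim: n => [|n IH]; first by rewrite rnorm0 invr_ge0.
rewrite /u /= /step -/(u n) rnormZr normrN ger0_norm ?invr_ge0//.
have h1 := rnormM h h; have h2 := rnormM (u n) (u n).
have h3 := rnormD (h ** h) (u n ** u n).
have h0 := rnorm_ge0 h; have u0 := rnorm_ge0 (u n).
have h4 : rnorm h * rnorm h <= 2^-1 * 2^-1 by rewrite ler_pM.
have u4 : rnorm (u n) * rnorm (u n) <= 4^-1 * 4^-1 by rewrite ler_pM.
by lra.
Qed.

Let u_step n : rnorm (u n.+1 - u n) <= 1 * 2^-1 ^+ n.
Proof.
rewrite mul1r; elim: n => [|n IH].
  by rewrite expr0 subr0 (le_trans (u_le 1))// invf_le1// ler1n.
have -> : u n.+2 - u n.+1 =
    (- 2^-1)%:C *: (u n.+1 ** (u n.+1 - u n) + (u n.+1 - u n) ** u n).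
  have -> : u n.+1 ** (u n.+1 - u n) + (u n.+1 - u n) ** u n =
    (h ** h + u n.+1 ** u n.+1) - (h ** h + u n ** u n) by nring.
  by rewrite scalerBr.
rewrite rnormZr normrN ger0_norm ?invr_ge0// exprS ler_wpM2l ?invr_ge0//.
apply: le_trans (rnormD _ _) _.
have h1 := rnormM (u n.+1) (u n.+1 - u n); have h2 := rnormM (u n.+1 - u n) (u n).
have d0 := rnorm_ge0 (u n.+1 - u n).
have := u_le n; have := u_le n.+1; have := rnorm_ge0 (u n); have := rnorm_ge0 (u n.+1).
move: IH; set e := _ ^+ n => IH p1 p2 p3 p4.
have : rnorm (u n.+1) * rnorm (u n.+1 - u n) <= 4^-1 * rnorm (u n.+1 - u n).
  by rewrite ler_wpM2r.
have : rnorm (u n.+1 - u n) * rnorm (u n) <= 4^-1 * rnorm (u n.+1 - u n).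
  by rewrite mulrC ler_wpM2r.
by lra.
Qed.

(* [1 + s] is the square root of [1 - h^2]. *)
Lemma sqrt_one_sub_sqr : exists s : A,
  [/\ self_adjoint s, h ** s = s ** h & s + s + s ** s + h ** h = 0].
Proof.
have [s us] := complete_rnorm (geometric_cauchy u_step).
have s4 : rnorm s <= 4^-1.
  apply/ler_addgt0Pr => e e0; have [N HN] := us _ e0.
  have := rnorm_dist_triangle (u N) s 0; rewrite !subr0.
  by move=> /le_trans; apply; rewrite addrC lerD ?u_le// rnorm_distC HN.
exists s; split.
- apply/eqP; rewrite -subr_eq0; apply/eqP/rnorm_le0 => e e0.
  have e2 : 0 < e / 2 by rewrite divr_gt0.
  have [N HN] := us _ e2.
  apply: le_trans (rnorm_dist_triangle (u N) _ _) _.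
  rewrite (splitr e) lerD ?HN// -{1}u_sa -starB rnorm_star rnorm_distC HN//.
- apply/eqP; rewrite -subr_eq0; apply/eqP/rnorm_le0 => e e0.
  have [N HN] := us _ e0.
  have -> : h ** s - s ** h = (u N - s) ** h - h ** (u N - s).
    have -> : (u N - s) ** h - h ** (u N - s) =
      u N ** h - h ** u N + (h ** s - s ** h) by nring.
    by rewrite u_comm subrr add0r.
  apply: le_trans (rnormB _ _) _.
  have := rnormM (u N - s) h; have := rnormM h (u N - s).
  have := HN _ (leqnn N).
  have : rnorm h * rnorm (u N - s) <= 2^-1 * rnorm (u N - s).
    by rewrite ler_wpM2r ?rnorm_ge0.
  have : rnorm (u N - s) * rnorm h <= 2^-1 * rnorm (u N - s).
    by rewrite mulrC ler_wpM2r ?rnorm_ge0.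
  by lra.
- apply/rnorm_le0 => e e0.
  have [|N HN] := us (e / 8); first by rewrite divr_gt0.
  (* Subtracting the exact relation 2 u_(N+1) + h^2 + u_N^2 = 0 leaves only terms containing a small
     difference. *)
  have -> : s + s + s ** s + h ** h =
      (s - u N.+1) + (s - u N.+1) + (s ** (s - u N) + (s - u N) ** u N).
    have E : u N.+1 + u N.+1 + (h ** h + u N ** u N) = 0.
      rewrite -[u N.+1]/((- 2^-1)%:C *: (h ** h + u N ** u N)) -scalerDl -rmorphD /=.
      have -> : - 2^-1 + - 2^-1 = -1 :> R by field.
      by rewrite rmorphN scaleN1r addNr.
    have -> : s - u N.+1 + (s - u N.+1) + (s ** (s - u N) + (s - u N) ** u N) =
      s + s + s ** s + h ** h - (u N.+1 + u N.+1 + (h ** h + u N ** u N)) by nring.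
    by rewrite E subr0.
  have h1 := HN _ (leqnn N); have h2 := HN _ (leqnSn N).
  rewrite rnorm_distC in h1; rewrite rnorm_distC in h2.
  have h3 := rnormM s (s - u N); have h4 := rnormM (s - u N) (u N).
  have h5 := rnormD (s - u N.+1 + (s - u N.+1)) (s ** (s - u N) + (s - u N) ** u N).
  have h6 := rnormD (s - u N.+1) (s - u N.+1).
  have h7 := rnormD (s ** (s - u N)) ((s - u N) ** u N).
  have h8 := u_le N; have h9 := rnorm_ge0 (u N); have h10 := rnorm_ge0 s.
  have h11 := rnorm_ge0 (s - u N).
  have h12 : rnorm s * rnorm (s - u N) <= 4^-1 * rnorm (s - u N) by rewrite ler_wpM2r.
  have h13 : rnorm (s - u N) * rnorm (u N) <= 4^-1 * rnorm (s - u N).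
    by rewrite mulrC ler_wpM2r.
  by lra.
Qed.

End SquareRoot.

Section UnitaryDilation.
Variables (K : numClosedFieldType) (V : lmodType K).
Variables (T U W : {linear V -> V}).
Hypotheses (TU : forall x, T (U x) = U (T x))
  (UW : forall x, U (W x) = x) (UWT : forall x, U x + W x = T x + T x).

(** [W] is a right inverse of [U], so U + W = 2 T turns into U^2 + 1 = 2 U T: [T] plays the cosine
    and [U] the exponential. *)
Let U2 x : pop U ('X^2 + 1) x = U (T x + T x).
Proof. by rewrite popD pop1 popXn /= !popX -UWT linearD UW. Qed.

Let iterTU n x : T (iter n U x) = iter n U (T x).
Proof. by elim: n => [//|n IH] /=; rewrite TU IH. Qed.

Let U2n k x : pop U (('X^2 + 1) ^+ k) x = 2 ^+ k *: iter k U (iter k T x).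
Proof.
elim: k => [|k IH]; first by rewrite pop1 scale1r.
rewrite exprS popM IH U2 !iterS -mulr2n -scaler_nat linearZ linearZ.
by rewrite linearZ /= scalerA -exprS iterTU.
Qed.

(* [P(z) = z^n p((z + 1/z)/2)] is a polynomial, and [z^n p] at [U] computes [p] at [T]. *)
Lemma pop_unitary n (p : {poly K}) (M : K) : (size p <= n.+1)%N ->
  (forall z, `|z| = 1 -> `|p.['Re z]| <= M) ->
  exists P : {poly K}, [/\ (size P <= n.*2.+1)%N,
    forall k, `|P`_k| <= M & forall x, pop U P x = iter n U (pop T p x)].
Proof.
move=> pn pM.
(* Since U^k T^k = ((U^2 + 1) / 2)^k, every term p_k U^n T^k is a polynomial in [U]. *)
pose P := \sum_(k < n.+1) (p`_k / 2 ^+ k) *: ('X^(n - k) * ('X^2 + 1) ^+ k).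
have s21 k : (size (('X^2 + 1 : {poly K}) ^+ k) <= k.*2.+1)%N.
  apply: leq_trans (size_poly_exp_leq _ _) _.
  by rewrite -[X in 'X^2 + X]polyC1 size_XnaddC//= mul2n ltnS.
exists P; split.
- apply: (leq_trans (size_sum _ _ _)); apply/bigmax_leqP => k _.
  apply: (leq_trans (size_scale_leq _ _)).
  apply: (leq_trans (size_polyMleq _ _)).
  have := s21 k; rewrite size_polyXn addSn /= => /(leq_add (leqnn (n - k))).
  move=> /leq_trans; apply.
  by have := ltn_ord k; lia.
(* On the unit circle |P(z)| = |p(Re z)|, so Cauchy's estimate applies with the bound for p on the
   real parts. *)
- move=> k; apply: coef_le_circle => z z1.
  have z0 : z != 0 by rewrite -normr_eq0 z1 oner_neq0.
  suff -> : P.[z] = z ^+ n * p.['Re z] by rewrite normrM normrX z1 expr1n mul1r pM.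
  rewrite (@horner_coef_wide _ n.+1 p)// mulr_sumr horner_sum.
  apply: eq_bigr => -[l ln] _ /=; rewrite !(hornerE, hornerXn, horner_exp).
  rewrite ltnS in ln.
  have -> : 'Re z = (z ^+ 2 + 1) / (2 * z).
    rewrite ReE; have zz : z * z^*%R = 1 by rewrite -normCK z1 expr1n.
    have -> : z^*%R = z^-1 by apply: (mulfI z0); rewrite zz mulfV.
    by field.
  rewrite /= expr_div_n exprMn -[in RHS](subnK ln) exprD.
  by field; rewrite ?z0 ?expf_neq0 ?pnatr_eq0.
- move=> x; rewrite pop_sum (pop_widen _ _ pn).
  rewrite iter_linear_sum; apply: eq_bigr => -[k kn] _ /=; rewrite ltnS in kn.
  have lin m c (y : V) : iter m U (c *: y) = c *: iter m U y.
    by elim: m => [//|m IH]; rewrite !iterS IH linearZ.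
  rewrite popZ popM U2n pop_Xn lin scalerA -iterD subnK// divfK//.
Qed.

End UnitaryDilation.

Section PolynomialAction.
Variables (R : realType) (A : cstarAlgType R).
Implicit Types (x y h : A) (p q : {poly R}).

Definition rmul h x : A := x ** h.

Lemma rmul_is_linear h : linear (rmul h).
Proof. by move=> a x y; rewrite /rmul nmulDl -nscaleAl. Qed.

HB.instance Definition _ h :=
  GRing.isLinear.Build R[i] A A *:%R (rmul h) (rmul_is_linear h).

(* [pact h p x] is [x p(h)]; the constant term of [p] makes sense although [A]
   need not have an identity. *)
Definition pact h p x : A := pop (rmul h) (map_poly (real_complex R) p) x.

Lemma pactD h p q x : pact h (p + q) x = pact h p x + pact h q x.
Proof. by rewrite /pact rmorphD popD. Qed.

Lemma pactB h p q x : pact h (p - q) x = pact h p x - pact h q x.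
Proof. by rewrite /pact rmorphB popB. Qed.

Lemma pactM h p q x : pact h (p * q) x = pact h p (pact h q x).
Proof. by rewrite /pact rmorphM popM. Qed.

Lemma pact_comm h p q x : pact h p (pact h q x) = pact h q (pact h p x).
Proof. by rewrite -!pactM mulrC. Qed.

Lemma pactX h x : pact h 'X x = x ** h.
Proof. by rewrite /pact map_polyX popX. Qed.

Lemma pactC h c x : pact h c%:P x = c%:C *: x.
Proof. by rewrite /pact map_polyC popC. Qed.

Lemma pact1 h x : pact h 1 x = x.
Proof. by rewrite -polyC1 pactC scale1r. Qed.

Lemma pact0 h x : pact h 0 x = 0.
Proof. by rewrite /pact rmorph0 pop0. Qed.

Lemma pactZ h c p x : pact h (c *: p) x = c%:C *: pact h p x.
Proof. by rewrite -mul_polyC pactM pactC. Qed.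

Lemma pact_mulX h p x : pact h (p * 'X) x = pact h p x ** h.
Proof. by rewrite mulrC pactM pactX. Qed.

Lemma pact_is_linear h p : linear (pact h p).
Proof. exact: pop_is_linear. Qed.

Lemma pactBr h p x y : pact h p (x - y) = pact h p x - pact h p y.
Proof. by have := pact_is_linear h p (-1) y x; rewrite !scaleN1r !(addrC (- _)). Qed.

Lemma pactr0 h p : pact h p 0 = 0.
Proof. by have := pactBr h p 0 0; rewrite subr0 subrr. Qed.

Lemma pactZr h p (c : R[i]) x : pact h p (c *: x) = c *: pact h p x.
Proof. by have := pact_is_linear h p c x 0; rewrite pactr0 !addr0. Qed.

Lemma nmul_pact h p x y : y ** pact h p x = pact h p (y ** x).
Proof.
elim/poly_ind: p => [|p c IH]; first by rewrite !pact0 nmulr0.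
by rewrite !pactD !pact_mulX !pactC nmulDr nmulA IH nscaleAr.
Qed.

(** Both sides are y p(h) [star x]; left multiplication by p(h) has no notation of its own. *)
Lemma nmul_star_pact h p x y : self_adjoint h ->
  y ** star (pact h p x) = pact h p y ** star x.
Proof.
move=> hh; elim/poly_ind: p y => [|p c IH] y; first by rewrite !pact0 star0 nmulr0 nmul0r.
rewrite !pactD !pact_mulX !pactC starD starM hh starZr nmulDr nmulDl nmulA IH.
by rewrite -nscaleAr nscaleAl -!pactX pact_comm.
Qed.

Lemma star_pact h p : self_adjoint h -> star (pact h p h) = pact h p h.
Proof.
move=> hh; elim/poly_ind: p => [|p c IH]; first by rewrite !pact0 star0.
rewrite !pactD !pact_mulX !pactC starD starM hh IH starZr hh; congr (_ + _).
by rewrite nmul_pact -!pactX pact_comm.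
Qed.

(** The C*-identity for x p(h). It replaces |p(h)|^2 = |p(h)^2|, which would need an identity in
    [A], and costs no constant. *)
Lemma rnorm_pact_sqr h p x : self_adjoint h ->
  rnorm (pact h p x) ^+ 2 <= rnorm (pact h (p * p) x) * rnorm x.
Proof.
move=> hh; rewrite -[rnorm (pact h p x)]rnorm_star -rnorm_starM starK nmul_star_pact//.
by rewrite -pactM (le_trans (rnormM _ _))// rnorm_star.
Qed.

End PolynomialAction.

Section PolynomialBound.
Variables (R : realType) (A : cstarAlgType R).

(** If r = 1 + d with d > 0, Bernoulli's inequality at exponent 2^m, squared, gives growth of order
    (2^m d)^2, which beats any multiple of 2^m. *)
Lemma le1_of_growth (r c : R) : 0 <= r -> (forall m, r ^+ (2 ^ m) <= c * 2 ^+ m) ->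
  r <= 1.
Proof.
move=> r0 H; rewrite leNgt; apply/negP => r1; pose d := r - 1.
have d0 : 0 < d by rewrite subr_gt0.
have bern n : 1 + n%:R * d <= r ^+ n.
  elim: n => [|n IH]; first by rewrite mul0r addr0 expr0.
  rewrite exprS -natr1; have -> : r = 1 + d by rewrite /d; ring.
  have := ler0n R n; have -> : 1 + d = r by rewrite /d; ring.
  have r0' : 0 <= r by []. rewrite -/d.
  have := ler_wpM2l r0' IH; have -> : r = 1 + d by rewrite /d; ring.
  by nra.
have c1 : 1 <= c * 2 by have := H 1%N; have := bern 2%N; nra.
have grow m : 2 ^+ m * (2 ^+ m * (d * d)) <= c * 2 * 2 ^+ m.
  have := H m.+1; rewrite expnS mulnC exprM expr2 [2 ^+ m.+1]exprS.
  have := bern (2 ^ m)%N; rewrite natrX; have : 0 <= 2 ^+ m :> R by rewrite exprn_ge0.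
  move: (r ^+ _) (2 ^+ m) => a b b0 ab aa.
  have : b * d * (b * d) <= a * a.
    have bd : 0 <= b * d by rewrite mulr_ge0// ltW.
    by rewrite ler_pM//; lra.
  by nra.
pose m := Num.bound (c * 2 / (d * d)).
have dd : 0 < d * d by rewrite mulr_gt0.
have mP : c * 2 / (d * d) < m%:R.
  by apply: archi_boundP; rewrite divr_ge0 ?(ltW dd)//; lra.
have := lt_le_trans mP (_ : m%:R <= 2 ^+ m); rewrite -natrX ler_nat => /(_ (ltnW (ltn_expl _ _))).
move=> /(_ erefl); rewrite ltr_pdivrMr// natrX => lt1.
have := grow m; rewrite mulrC ler_pM2r ?exprn_gt0//.
by rewrite leNgt lt1.
Qed.

Lemma normc_real (r : R) : `|r%:C| = `|r|%:C.
Proof. by rewrite normc_def /= expr0n /= addr0 sqrtr_sqr. Qed.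

Variables (h : A).
Hypotheses (h_sa : self_adjoint h) (h_small : rnorm h <= 2^-1).

(** Right multiplication by h + i sqrt(1 - h^2) is an isometry [U], and U^n p(h) = P(U) for a [P]
    with at most 2 n + 1 coefficients, all bounded by [M]. The factor depending on n is removed
    afterwards. *)
Let pact_pre n (p : {poly R}) (x : A) (M : R) : (size p <= n.+1)%N ->
  (forall t, -1 <= t <= 1 -> `|p.[t]| <= M) ->
  rnorm (pact h p x) <= n.*2.+1%:R * M * rnorm x.
Proof.
move=> pn pM.
have [s [ss hs s_eq]] := sqrt_one_sub_sqr h_sa h_small.
(* Right multiplication by 1 + s = sqrt(1 - h^2), which commutes with h. *)
pose c x := x + x ** s.
have cl : linear c.
  by move=> a u v; rewrite /c nmulDl -nscaleAl scalerDr addrACA.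
have Ul : linear (fun x => x ** h + 'i *: c x).
  move=> a u v; rewrite cl nmulDl -nscaleAl !scalerDr addrACA; congr (_ + _ + _).
  by rewrite !scalerA mulrC.
have Wl : linear (fun x => x ** h - 'i *: c x).
  move=> a u v; rewrite cl nmulDl -nscaleAl scalerBr scalerDr opprD addrACA.
  by rewrite !scalerA mulrC.
have [U UE] : exists U : {linear A -> A}, forall y, U y = y ** h + 'i *: c y.
  pose U0 : {linear A -> A} := HB.pack (fun x : A => x ** h + 'i *: c x)
    (GRing.isLinear.Build R[i] A A *:%R _ Ul).
  by exists U0.
have [W WE] : exists W : {linear A -> A}, forall y, W y = y ** h - 'i *: c y.
  pose W0 : {linear A -> A} := HB.pack (fun x : A => x ** h - 'i *: c x)
    (GRing.isLinear.Build R[i] A A *:%R _ Wl).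
  by exists W0.
have cZ (a : R[i]) y : c (a *: y) = a *: c y by rewrite /c scalerDr nscaleAl.
have cB y z : c (y - z) = c y - c z by rewrite /c nmulBl opprD addrACA.
have ch y : c y ** h = c (y ** h) by rewrite /c nmulDl -!nmulA -hs.
have cc y : c (c y) + y ** h ** h = y.
  have -> : c (c y) + y ** h ** h = y + y ** (s + s + s ** s + h ** h).
    by rewrite /c; nring.
  by rewrite s_eq nmulr0 addr0.
have UW y : U (W y) = y.
  rewrite -[RHS]cc UE WE cB cZ nmulBl -nscaleAl ch.
  rewrite scalerBr scalerA -expr2 sqrCi scaleN1r; set e := 'i *: c (y ** h); nring.
have TU y : rmul h (U y) = U (rmul h y).
  by rewrite !UE /rmul nmulDl -nscaleAl ch.
have UWT y : U y + W y = rmul h y + rmul h y.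
  by rewrite UE WE addrACA subrr addr0.
(* By the C*-identity it is enough to compare (U y) [star (U y)] with y [star y]; the cross terms
   cancel and c^2 + h^2 = 1. *)
have Un y : rnorm (U y) = rnorm y.
  apply/eqP; rewrite -(@eqrXn2 _ 2)// ?rnorm_ge0// -[rnorm (U y)]rnorm_star -[rnorm y]rnorm_star.
  rewrite -!rnorm_starM !starK; apply/eqP; congr rnorm.
  rewrite UE starD starM starZ conjCi h_sa starD starM ss scaleNr.
  rewrite !(nmulDl, nmulDr, nmulrN) -!nscaleAr -!nscaleAl.
  rewrite scalerA -expr2 sqrCi scaleN1r opprK.
  have -> : c y ** (star y + s ** star y) = y ** star y - y ** h ** (h ** star y).
    have {1}-> : y ** star y = (c (c y) + y ** h ** h) ** star y by rewrite cc.
    by rewrite /c; nring.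
  have -> : y ** h ** (star y + s ** star y) = c y ** (h ** star y).
    rewrite /c; have -> : y ** h ** (star y + s ** star y) =
      y ** (h ** star y) + y ** (h ** s) ** star y by nring.
    by rewrite hs; nring.
  set e := 'i *: _; nring.
have Unk k y : rnorm (iter k U y) = rnorm y.
  by elim: k => [//|k IH]; rewrite iterS Un.
have M0 : 0 <= M.
  by apply: le_trans (pM 0 _); rewrite ?normr_ge0// lerN10 ler01.
have [|z z1|P [Pn PM PE]] := pop_unitary TU UW UWT (p := map_poly (real_complex R) p)
    (n := n) (M := M%:C).
- by rewrite size_map_poly.
- have -> : 'Re z = (complex.Re z)%:C by rewrite ReE ReJ_add.
  rewrite horner_map normc_real lecR; apply: pM; rewrite -ler_norml -lecR -normc_real.
  have -> : (complex.Re z)%:C = 'Re z by rewrite ReE ReJ_add.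
  by rewrite -[leRHS]z1 leif_normC_Re_Creal.
rewrite -(Unk n) /pact -PE (pop_widen _ _ Pn).
apply: le_trans (rnorm_sum _ _ _) _.
rewrite -mulrA mulr_natl -[X in _ *+ X]card_ord -sumr_const; apply: ler_sum => k _.
rewrite rnormZ Unk ler_wpM2r ?rnorm_ge0// -lecR ReK//.
Qed.

(** Power trick: the preliminary bound is applied to p^(2^m). Squaring is free by the C*-identity,
    and the parasitic factor grows only linearly in 2^m, so it disappears when roots are
    extracted. *)
Lemma rnorm_pact_le (p : {poly R}) (x : A) (M : R) : (forall t, -1 <= t <= 1 -> `|p.[t]| <= M) ->
  rnorm (pact h p x) <= M * rnorm x.
Proof.
wlog M0 : M / 0 < M => [H pM|pM].
  apply/ler_addgt0Pr => e e0.
  have x1 : 0 < rnorm x + 1 by rewrite ltr_wpDl// rnorm_ge0.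
  have ex0 : 0 < e / (rnorm x + 1) by rewrite divr_gt0.
  apply: le_trans (H (M + e / (rnorm x + 1)) _ _) _.
  - rewrite ltr_wpDl//; apply: le_trans (pM 0 _); rewrite ?normr_ge0//.
    by rewrite lerN10 ler01.
  - by move=> t /pM /le_trans; apply; rewrite lerDl ltW.
  - rewrite mulrDl lerD2l -[leRHS](divfK (lt0r_neq0 x1)) ler_wpM2l ?lerDl//.
    exact: ltW.
have [->|x0] := eqVneq x 0.
  by rewrite pactr0 rnorm0 mulr0.
rewrite -rnorm_gt0 in x0.
set X := rnorm x in x0 *; set a := rnorm _.
have a0 : 0 <= a by exact: rnorm_ge0.
have MX0 : 0 < M * X by rewrite mulr_gt0.
(* [rnorm_pact_sqr] iterated m times; the powers of X = |x| pay for the missing identity. *)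
have step m : a ^+ (2 ^ m) * X <= rnorm (pact h (p ^+ (2 ^ m)) x) * X ^+ (2 ^ m).
  elim: m => [|m IH]; first by rewrite !expr1.
  have := rnorm_pact_sqr (p ^+ (2 ^ m)) x h_sa; rewrite -exprD addnn -mul2n -expnS -/X.
  rewrite expnS mulnC !exprM.
  move: IH; have := rnorm_ge0 (pact h (p ^+ (2 ^ m)) x).
  move: (rnorm (pact h (p ^+ (2 ^ m)) x)) => b b0.
  move: (rnorm (pact h _ x)) => b2.
  have : 0 <= a ^+ (2 ^ m) by rewrite exprn_ge0.
  have : 0 <= X ^+ (2 ^ m) by rewrite exprn_ge0// ltW.
  move: (a ^+ _) (X ^+ (2 ^ m)) => u v v0 u0 uX bb.
  have h1 : (u * X) * (u * X) <= (b * v) * (b * v).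
    by rewrite ler_pM// mulr_ge0// ltW.
  have h2 : b ^+ 2 * (v * v) <= b2 * X * (v * v) by rewrite ler_wpM2r// mulr_ge0.
  by rewrite -(ler_pM2r x0) !expr2; rewrite !expr2 in h2; lra.
rewrite -[leRHS]mul1r -ler_pdivrMr//.
apply: (@le1_of_growth _ (size p).*2.+1%:R); first by rewrite divr_ge0// ltW.
move=> m; rewrite expr_div_n ler_pdivrMr ?exprn_gt0//.
rewrite -(ler_pM2r x0); apply: le_trans (step m) _.
have sz : (size (p ^+ (2 ^ m)) <= (size p * 2 ^ m).+1)%N.
  apply: leq_trans (size_poly_exp_leq _ _) _.
  by rewrite ltnS leq_mul2r leq_pred orbT.
have /(pact_pre x sz) : forall t, -1 <= t <= 1 -> `|(p ^+ (2 ^ m)).[t]| <= M ^+ (2 ^ m).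
  by move=> t /pM pt; rewrite horner_exp normrX lerXn2r ?nnegrE// ltW.
have XN : 0 <= X ^+ (2 ^ m) by rewrite exprn_ge0// ltW.
move=> /(ler_wpM2r XN) /le_trans; apply.
rewrite exprMn -/X.
have -> : (size p * 2 ^ m).*2.+1%:R * M ^+ (2 ^ m) * X * X ^+ (2 ^ m) =
  (size p * 2 ^ m).*2.+1%:R * (M ^+ (2 ^ m) * X ^+ (2 ^ m) * X) by ring.
have -> : (size p).*2.+1%:R * 2 ^+ m * (M ^+ (2 ^ m) * X ^+ (2 ^ m)) * X =
  (size p).*2.+1%:R * 2 ^+ m * (M ^+ (2 ^ m) * X ^+ (2 ^ m) * X) :> R by ring.
rewrite ler_wpM2r//.
  by rewrite !mulr_ge0 ?exprn_ge0// ltW.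
rewrite -natrX -natrM ler_nat mulSn -doubleMl -addn1 addnC leq_add2r.
by rewrite expn_gt0.
Qed.

End PolynomialBound.

(** * Weierstrass approximation and the functional calculus *)

Section Weierstrass.
Variable R : realType.
Implicit Types (f g : R -> R) (e t x y : R).

(* Uniform continuity on [-1, 1], with the quadratic modulus that the variance
   of the binomial law turns directly into a rate for Bernstein polynomials. *)
Definition ucont f := forall e, 0 < e -> exists c : R,
  forall x y, `|x| <= 1 -> `|y| <= 1 -> `|f x - f y| <= e + c * (x - y) ^+ 2.

Lemma ucont_ge0 f e : ucont f -> 0 < e -> exists2 c : R, 0 <= c &
  forall x y, `|x| <= 1 -> `|y| <= 1 -> `|f x - f y| <= e + c * (x - y) ^+ 2.
Proof.
move=> fu /fu[c fc]; exists `|c| => // x y x1 y1; apply: le_trans (fc x y x1 y1) _.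
by rewrite lerD2l ler_wpM2r ?sqr_ge0// ler_norm.
Qed.

Lemma ucont_bounded f : ucont f ->
  exists2 M : R, 0 < M & forall t, `|t| <= 1 -> `|f t| <= M.
Proof.
move=> /ucont_ge0 /(_ ltr01)[c c0 fc]; exists (`|f 0| + 1 + c).
  by rewrite ltr_wpDr// ltr_wpDl.
move=> t t1; have t0 : `|0 : R| <= 1 by rewrite normr0.
have := fc t 0 t1 t0; rewrite subr0.
have : c * t ^+ 2 <= c by rewrite ler_piMr// -real_normK ?num_real// exprn_ile1.
have := ler_normD (f 0) (f t - f 0); rewrite addrCA subrr addr0.
by lra.
Qed.

Lemma ucont_lipschitz f (k : R) : (forall x y, `|f x - f y| <= k * `|x - y|) -> ucont f.
Proof.
(* With d = |x - y|, the bound k d <= e + k^2 d^2 / (4 e) is the inequality (k d - 2 e)^2 >= 0. *)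
move=> fk e e0; exists (k ^+ 2 / (4 * e)) => x y _ _.
apply: le_trans (fk x y) _.
rewrite -[(x - y) ^+ 2]real_normK ?num_real//; set d := `|x - y|.
have e4 : 0 < 4 * e by rewrite mulr_gt0.
rewrite mulrAC -lerBlDl ler_pdivlMr//.
have := sqr_ge0 (k * d - 2 * e); rewrite !expr2; nra.
Qed.

Lemma ucont_id : ucont id.
Proof. by apply: (@ucont_lipschitz _ 1) => x y; rewrite mul1r. Qed.

Lemma ucontD f g : ucont f -> ucont g -> ucont (fun t => f t + g t).
Proof.
move=> fu gu e e0; have e2 : 0 < e / 2 by rewrite divr_gt0.
have [c fc] := fu _ e2; have [d gd] := gu _ e2; exists (c + d) => x y x1 y1.
have -> : f x + g x - (f y + g y) = (f x - f y) + (g x - g y) by ring.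
apply: le_trans (ler_normD _ _) _; apply: le_trans (lerD (fc x y x1 y1) (gd x y x1 y1)) _.
by rewrite mulrDl addrACA -splitr.
Qed.

Lemma ucontM f g : ucont f -> ucont g -> ucont (fun t => f t * g t).
Proof.
move=> fu gu e e0.
have [M M0 fM] := ucont_bounded fu; have [N N0 gN] := ucont_bounded gu.
have [|c c0 fc] := @ucont_ge0 _ (e / 2 / N) fu; first by rewrite !divr_gt0.
have [|d d0 gd] := @ucont_ge0 _ (e / 2 / M) gu; first by rewrite !divr_gt0.
exists (N * c + M * d) => x y x1 y1.
have -> : f x * g x - f y * g y = (f x - f y) * g x + f y * (g x - g y) by ring.
apply: le_trans (ler_normD _ _) _; rewrite !normrM.
have h1 : `|f x - f y| * `|g x| <= (e / 2 / N + c * (x - y) ^+ 2) * N.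
  by rewrite ler_pM// ?fc ?gN.
have h2 : `|f y| * `|g x - g y| <= M * (e / 2 / M + d * (x - y) ^+ 2).
  by rewrite ler_pM// ?gd ?fM.
apply: le_trans (lerD h1 h2) _.
have -> : (e / 2 / N + c * (x - y) ^+ 2) * N + M * (e / 2 / M + d * (x - y) ^+ 2) =
  e + (N * c + M * d) * (x - y) ^+ 2.
  by field; rewrite !lt0r_neq0.
by [].
Qed.

Lemma ucontZ (c : R) f : ucont f -> ucont (fun t => c * f t).
Proof.
by apply: (@ucontM (fun=> c)); apply: (@ucont_lipschitz _ 0) => x y; rewrite subrr normr0 mul0r.
Qed.

(** The expectation of g(S) for S binomial with n trials of success probability 'X, computed by
    conditioning on one trial. This makes the moment estimate an induction without binomial
    coefficients. *)
Fixpoint bernstein (n : nat) (g : nat -> R) : {poly R} :=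
  if n is m.+1 then (1 - 'X) * bernstein m g + 'X * bernstein m (fun k => g k.+1)
  else (g 0%N)%:P.

(* A binomial variable has mean [n x] and variance [n x (1 - x)]. *)
Lemma bernstein_dist n (g : nat -> R) (c d e a x : R) : 0 <= x <= 1 ->
  (forall k, (k <= n)%N -> `|g k - c| <= e + d * (k%:R - a) ^+ 2) ->
  `|(bernstein n g).[x] - c| <= e + d * (n%:R * x * (1 - x) + (n%:R * x - a) ^+ 2).
Proof.
move=> /andP[x0 x1]; elim: n g a => [|n IH] g a gc.
  by rewrite hornerC !mul0r add0r; exact: gc.
rewrite /= !hornerE.
have h1 := IH g a (fun k kn => gc k (leqW kn)).
have h2 : `|(bernstein n (fun k => g k.+1)).[x] - c| <=
    e + d * (n%:R * x * (1 - x) + (n%:R * x - (a - 1)) ^+ 2).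
  apply: IH => k kn; apply: le_trans (gc k.+1 kn) _.
  by rewrite -natr1 le_eqVlt; apply/orP; left; apply/eqP; ring.
set u := _.[x] in h1 *; set v := _.[x] in h2 *.
have -> : (1 - x) * u + x * v - c = (1 - x) * (u - c) + x * (v - c) by ring.
have y0 : 0 <= 1 - x by rewrite subr_ge0.
apply: le_trans (ler_normD _ _) _; rewrite !normrM (ger0_norm x0) (ger0_norm y0).
apply: le_trans (lerD (ler_wpM2l y0 h1) (ler_wpM2l x0 h2)) _.
rewrite -natr1 le_eqVlt; apply/orP; left; apply/eqP; ring.
Qed.

Lemma weierstrass f e : ucont f -> 0 < e ->
  exists p : {poly R}, forall t, -1 <= t <= 1 -> `|f t - p.[t]| <= e.
Proof.
move=> fu e0; have e2 : 0 < e / 2 by rewrite divr_gt0.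
have [c c0 fc] := ucont_ge0 fu e2.
(* The variance contributes 4 c x (1 - x) / n <= c / n, which must stay below e / 2. *)
have [n n0 nP] : exists2 n : nat, 0 < n%:R :> R & 2 * c / e < n%:R.
  exists (Num.bound (2 * c / e)).+1; first by rewrite ltr0n.
  apply: lt_trans (_ : _ < (Num.bound (2 * c / e))%:R) _; last by rewrite ltr_nat.
  by apply: archi_boundP; rewrite divr_ge0 ?mulr_ge0// ltW.
pose g k := f (2 * k%:R / n%:R - 1).
exists (bernstein n g \Po (2^-1 *: ('X + 1))) => t /andP[t0 t1].
have xE : (2^-1 *: ('X + 1)).[t] = 2^-1 * (t + 1) by rewrite !hornerE.
rewrite horner_comp xE; set x := 2^-1 * (t + 1).
have x01 : 0 <= x <= 1 by rewrite /x; apply/andP; split; lra.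
rewrite distrC.
have gf k : (k <= n)%N ->
    `|g k - f t| <= e / 2 + 4 * c / n%:R ^+ 2 * (k%:R - n%:R * x) ^+ 2.
  move=> kn; have kn' : k%:R <= n%:R :> R by rewrite ler_nat.
  have k0 : 0 <= k%:R :> R by rewrite ler0n.
  apply: le_trans (fc _ _ _ _) _.
  - rewrite ler_norml; apply/andP; split.
      by rewrite lerBrDr addNr divr_ge0// ?mulr_ge0// ltW.
    by rewrite lerBlDr ler_pdivrMr// ; lra.
  - by rewrite ler_norml t0 t1.
  - rewrite le_eqVlt; apply/orP; left; apply/eqP; rewrite /x; field.
    by rewrite lt0r_neq0.
apply: le_trans (bernstein_dist x01 gf) _.
rewrite subrr expr0n addr0 {2}(splitr e) lerD2l.
have -> : 4 * c / n%:R ^+ 2 * (n%:R * x * (1 - x)) = 4 * c * (x * (1 - x)) / n%:R.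
  by field; rewrite lt0r_neq0.
rewrite ler_pdivrMr//.
have : x * (1 - x) <= 4^-1 by have := sqr_ge0 (2 * x - 1); rewrite expr2; lra.
move: nP; rewrite ltr_pdivrMr// => nP x4.
have : 4 * c * (x * (1 - x)) <= 4 * c * 4^-1 by rewrite ler_wpM2l// mulr_ge0.
by lra.
Qed.

End Weierstrass.

Section FunctionalCalculus.
Variables (R : realType) (A : cstarAlgType R) (h : A).
Hypotheses (h_sa : self_adjoint h) (h_small : rnorm h <= 2^-1).
Implicit Types (f g : R -> R) (q : {poly R}) (e M t : R).

(** Vanishing at 0 keeps f(h) inside [A], where there may be no identity. *)
Definition ucont0 f := ucont f /\ f 0 = 0.

(** This is h q(h): polynomials without constant term are written t q(t) throughout. *)
Let ev q : A := pact h q h.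

(** The bound on x p(h) is used with x = y = h q(h) itself: |y|^2 = |y y| <= M |y| because y is
    self-adjoint. *)
Let rnorm_ev q M : (forall t, -1 <= t <= 1 -> `|t * q.[t]| <= M) -> rnorm (ev q) <= M.
Proof.
move=> qM; have M0 : 0 <= M.
  by apply: le_trans (qM 0 _); rewrite ?normr_ge0// lerN10 ler01.
have [->|y0] := eqVneq (ev q) 0; first by rewrite rnorm0.
have y_sa : self_adjoint (ev q) by exact: star_pact.
have := @rnorm_pact_le R A h h_sa h_small (q * 'X) (ev q) M.
rewrite pactM pactX -[pact h q _]nmul_pact -/(ev q) rnorm_sqr// expr2 ler_pM2r ?rnorm_gt0//.
by apply => t /qM; rewrite !hornerE mulrC.
Qed.

Let evB q r : ev (q - r) = ev q - ev r.
Proof. exact: pactB. Qed.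

Lemma ucont0_approx f e : ucont0 f -> 0 < e ->
  exists q, forall t, -1 <= t <= 1 -> `|f t - t * q.[t]| <= e.
Proof.
move=> [fu f0] e0; have [p pf] := weierstrass fu (divr_gt0 e0 (ltr0n _ 2)).
elim/poly_ind: p pf => [|q c _] pf.
  exists 0 => t /pf; rewrite !hornerE => /le_trans; apply.
  by rewrite ler_pdivrMr// ler_peMr// ?ler1n// ltW.
exists q => t t1; have := pf 0; rewrite f0 lerN10 ler01 => /(_ isT).
have := pf t t1; rewrite !hornerMXaddC mulr0 !add0r normrN => h1 h2.
have -> : f t - t * q.[t] = (f t - (q.[t] * t + c)) + c by ring.
by apply: le_trans (ler_normD _ _) _; rewrite [e]splitr lerD.
Qed.

(** Quantifying over all approximating polynomials, with their error, makes the element independent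
    of any chosen sequence and turns each later identity into one polynomial estimate. *)
Let is_cfc f (a : A) := forall e q,
  (forall t, -1 <= t <= 1 -> `|f t - t * q.[t]| <= e) -> rnorm (a - ev q) <= e.

Let cfc_exists f : ucont0 f -> exists a, is_cfc f a.
Proof.
move=> fu.
have H n : exists q, forall t, -1 <= t <= 1 -> `|f t - t * q.[t]| <= 2^-1 ^+ n.
  by apply: ucont0_approx; rewrite ?exprn_gt0 ?invr_gt0.
have {H}[q qP] := choice H.
have dist (e d : R) r s : (forall t, -1 <= t <= 1 -> `|f t - t * r.[t]| <= e) ->
    (forall t, -1 <= t <= 1 -> `|f t - t * s.[t]| <= d) ->
    rnorm (ev r - ev s) <= e + d.
  move=> re sd; rewrite -evB; apply: rnorm_ev => t t1.
  have -> : t * (r - s).[t] = (f t - t * s.[t]) - (f t - t * r.[t]) by rewrite !hornerE; ring.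
  by apply: le_trans (ler_normB _ _) _; rewrite addrC lerD ?re ?sd.
have [|a qa] := @complete_rnorm R A (fun n => ev (q n)).
  apply: (@geometric_cauchy _ _ _ 2) => n.
  apply: le_trans (dist _ _ _ _ (qP _) (qP _)) _.
  rewrite exprS; have := exprn_ge0 n (_ : 0 <= 2^-1 :> R).
  by rewrite invr_ge0 ler0n => /(_ isT); lra.
exists a => e r re; apply/ler_addgt0Pr => d d0.
have d2 : 0 < d / 2 by rewrite divr_gt0.
have [N HN] := qa _ d2.
have [m Nm md] : exists2 m : nat, (N <= m)%N & 2^-1 ^+ m <= d / 2 :> R.
  pose k := Num.bound (d / 2)^-1; exists (maxn N k); first exact: leq_maxl.
  rewrite exprVn -[leRHS]invrK lef_pV2 ?posrE ?exprn_gt0 ?invr_gt0//.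
  apply: le_trans (ltW (archi_boundP _)) _; first by rewrite invr_ge0 ltW.
  rewrite -/k -natrX ler_nat (leq_trans (leq_maxr N k))// ltnW// ltn_expl//.
apply: le_trans (rnorm_dist_triangle (ev (q m)) _ _) _.
apply: le_trans (lerD (_ : _ <= d / 2) (dist _ _ _ _ (qP m) re)) _.
  by rewrite rnorm_distC HN.
by move: md; set w := _ ^+ _; lra.
Qed.

(* [cfc f] is [f(h)] when [ucont0 f], and is otherwise unspecified. *)
Definition cfc f : A := xget 0 (is_cfc f).

Let cfcP f e q : ucont0 f -> (forall t, -1 <= t <= 1 -> `|f t - t * q.[t]| <= e) ->
  rnorm (cfc f - ev q) <= e.
Proof.
by move=> /cfc_exists /(xgetPex 0); exact.
Qed.

Lemma ucont0_poly q : ucont0 (fun t => t * q.[t]).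
Proof.
split; last by rewrite mul0r.
apply: ucontM; first exact: ucont_id.
elim/poly_ind: q => [|q c IH].
  by apply: (@ucont_lipschitz _ _ 0) => x y; rewrite !horner0 subrr normr0 mul0r.
have -> : horner (q * 'X + c%:P) = (fun t => q.[t] * t + c).
  by apply/funext => t; rewrite !hornerE.
apply: ucontD; first by apply: ucontM => //; exact: ucont_id.
by apply: (@ucont_lipschitz _ _ 0) => x y; rewrite subrr normr0 mul0r.
Qed.

Lemma cfc_poly q : cfc (fun t => t * q.[t]) = pact h q h.
Proof.
apply/eqP; rewrite -subr_eq0; apply/eqP/rnorm_le0 => e e0.
by apply: cfcP (ucont0_poly q) _ => t _; rewrite subrr normr0 ltW.
Qed.

Lemma ucont0_id : ucont0 id.
Proof. by split => //; exact: ucont_id. Qed.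

Lemma cfc_id : cfc id = h.
Proof.
have := cfc_poly 1; rewrite pact1 => <-; congr cfc.
by apply/funext => t; rewrite hornerC mulr1.
Qed.

Lemma cfc_closed f (S : set A) : ucont0 f -> closed S ->
  (forall q, S (pact h q h)) -> S (cfc f).
Proof.
move=> fu Sc Sq; apply: (closed_rnormP Sc) => e e0.
have [q qf] := ucont0_approx fu e0; exists (ev q); first exact: Sq.
exact: cfcP.
Qed.

Lemma rnorm_cfc_le f M : ucont0 f -> (forall t, -1 <= t <= 1 -> `|f t| <= M) ->
  rnorm (cfc f) <= M.
Proof.
move=> fu fM; apply/ler_addgt0Pr => e e0; have e2 : 0 < e / 2 by rewrite divr_gt0.
have [q qf] := ucont0_approx fu e2.
have : rnorm (ev q) <= M + e / 2.
  apply: rnorm_ev => t t1; have -> : t * q.[t] = f t - (f t - t * q.[t]) by ring.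
  by apply: le_trans (ler_normB _ _) _; rewrite lerD ?fM ?qf.
have := rnormD (cfc f - ev q) (ev q); rewrite subrK.
by have := cfcP fu qf; lra.
Qed.

Lemma cfc_self_adjoint f : ucont0 f -> self_adjoint (cfc f).
Proof.
move=> fu; apply/eqP; rewrite -subr_eq0; apply/eqP/rnorm_le0 => e e0.
have [q qf] := ucont0_approx fu (divr_gt0 e0 (ltr0n _ 2)).
apply: le_trans (rnorm_dist_triangle (ev q) _ _) _.
rewrite [e]splitr lerD//; last by rewrite rnorm_distC; exact: cfcP.
have ev_sa : star (ev q) = ev q by exact: star_pact.
by rewrite -{1}ev_sa -starB rnorm_star; exact: cfcP.
Qed.

Lemma ucont0D f g : ucont0 f -> ucont0 g -> ucont0 (fun t => f t + g t).
Proof. by move=> [fu f0] [gu g0]; split; [exact: ucontD|rewrite f0 g0 addr0]. Qed.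

Lemma ucont0Z (c : R) f : ucont0 f -> ucont0 (fun t => c * f t).
Proof. by move=> [fu f0]; split; [exact: ucontZ|rewrite f0 mulr0]. Qed.

Lemma ucont0Ml f g : ucont f -> ucont0 g -> ucont0 (fun t => f t * g t).
Proof. by move=> fu [gu g0]; split; [exact: ucontM|rewrite g0 mulr0]. Qed.

Lemma cfcD f g : ucont0 f -> ucont0 g -> cfc (fun t => f t + g t) = cfc f + cfc g.
Proof.
move=> fu gu; apply/eqP; rewrite -subr_eq0; apply/eqP/rnorm_le0 => e e0.
have e4 : 0 < e / 4 by rewrite divr_gt0.
have [q qf] := ucont0_approx fu e4; have [r rg] := ucont0_approx gu e4.
have : rnorm (cfc (fun t => f t + g t) - ev (q + r)) <= e / 4 + e / 4.
  apply: cfcP (ucont0D fu gu) _ => t t1.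
  have -> : f t + g t - t * (q + r).[t] = (f t - t * q.[t]) + (g t - t * r.[t]).
    by rewrite hornerD; ring.
  by apply: le_trans (ler_normD _ _) _; rewrite lerD ?qf ?rg.
have := cfcP fu qf; have := cfcP gu rg.
have := rnormD (cfc f - ev q) (cfc g - ev r).
have := rnorm_dist_triangle (ev (q + r)) (cfc (fun t => f t + g t)) (cfc f + cfc g).
rewrite [rnorm (ev _ - _)]rnorm_distC.
have -> : cfc f + cfc g - ev (q + r) = cfc f - ev q + (cfc g - ev r).
  by rewrite /ev pactD opprD addrACA.
by lra.
Qed.

Lemma cfcZ (c : R) f : ucont0 f -> cfc (fun t => c * f t) = c%:C *: cfc f.
Proof.
move=> fu; apply/eqP; rewrite -subr_eq0; apply/eqP/rnorm_le0 => e e0.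
have c1 : 0 < `|c| + 1 by rewrite ltr_wpDl.
have e2 : 0 < e / 2 / (`|c| + 1) by rewrite !divr_gt0.
have [q qf] := ucont0_approx fu e2.
have ce : `|c| * (e / 2 / (`|c| + 1)) <= e / 2.
  by rewrite mulrCA ler_piMr ?(divr_ge0 (ltW e0))// ler_pdivrMr// mul1r lerDl.
have h1 : rnorm (cfc (fun t => c * f t) - ev (c *: q)) <= e / 2.
  apply: cfcP (ucont0Z c fu) _ => t t1.
  have -> : c * f t - t * (c *: q).[t] = c * (f t - t * q.[t]).
    by rewrite hornerZ; ring.
  by rewrite normrM (le_trans _ ce)// ler_wpM2l// qf.
have h2 : rnorm (c%:C *: (cfc f - ev q)) <= e / 2.
  by rewrite rnormZr (le_trans _ ce)// ler_wpM2l// cfcP.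
apply: le_trans (rnorm_dist_triangle (ev (c *: q)) _ _) _.
rewrite [e]splitr lerD// rnorm_distC /ev pactZ -scalerBr; exact: h2.
Qed.

Lemma cfcB f g : ucont0 f -> ucont0 g -> cfc (fun t => f t - g t) = cfc f - cfc g.
Proof.
move=> fu gu; rewrite -[- cfc g]scaleN1r -(rmorphN1 (real_complex R)) /= -cfcZ//.
rewrite -cfcD//; last exact: ucont0Z.
by congr cfc; apply/funext => t; rewrite mulN1r.
Qed.

Lemma ucont0B f g : ucont0 f -> ucont0 g -> ucont0 (fun t => f t - g t).
Proof.
move=> fu gu; have -> : (fun t => f t - g t) = (fun t => f t + (-1) * g t).
  by apply/funext => t; rewrite mulN1r.
by apply: ucont0D => //; exact: ucont0Z.
Qed.

Lemma cfc_dist f g M : ucont0 f -> ucont0 g ->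
  (forall t, -1 <= t <= 1 -> `|f t - g t| <= M) -> rnorm (cfc f - cfc g) <= M.
Proof.
by move=> fu gu fg; rewrite -cfcB//; apply: rnorm_cfc_le => //; exact: ucont0B.
Qed.

Lemma ucont0M f g : ucont0 f -> ucont0 g -> ucont0 (fun t => f t * g t).
Proof. by move=> [fu _]; exact: ucont0Ml. Qed.

Lemma cfcM f g : ucont0 f -> ucont0 g -> cfc (fun t => f t * g t) = cfc f ** cfc g.
Proof.
move=> fu gu; apply/eqP; rewrite -subr_eq0; apply/eqP/rnorm_le0 => e e0.
have [M M0 fM] := ucont_bounded (proj1 fu); have [N N0 gN] := ucont_bounded (proj1 gu).
have fM' t : -1 <= t <= 1 -> `|f t| <= M by rewrite -ler_norml; exact: fM.
have gN' t : -1 <= t <= 1 -> `|g t| <= N by rewrite -ler_norml; exact: gN.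
(* The product error M d + d (N + 1) occurs twice, once for functions and once for elements; the
   total is k d. *)
pose k := 2 * (M + N + 1).
have k0 : 0 < k by rewrite /k; lra.
pose d := Num.min 1 (e / k).
have d0 : 0 < d by rewrite lt_min ltr01 divr_gt0.
have d1 : d <= 1 by rewrite ge_min lexx.
have de : k * d <= e by rewrite mulrC -ler_pdivlMr// ge_min lexx orbT.
have [q qf] := ucont0_approx fu d0; have [r rg] := ucont0_approx gu d0.
have rN t : -1 <= t <= 1 -> `|t * r.[t]| <= N + 1.
  move=> t1; have -> : t * r.[t] = g t - (g t - t * r.[t]) by ring.
  apply: le_trans (ler_normB _ _) _; rewrite lerD ?gN'//.
  by apply: le_trans (rg t t1) _.
have h1 : rnorm (cfc (fun t => f t * g t) - ev (q * (r * 'X))) <= M * d + d * (N + 1).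
  apply: cfcP (ucont0M fu gu) _ => t t1.
  have -> : f t * g t - t * (q * (r * 'X)).[t] =
      f t * (g t - t * r.[t]) + (f t - t * q.[t]) * (t * r.[t]).
    by rewrite !hornerM hornerX; ring.
  apply: le_trans (ler_normD _ _) _.
  rewrite [leLHS](_ : _ =
    `|f t| * `|g t - t * r.[t]| + `|f t - t * q.[t]| * `|t * r.[t]|) ?normrM//.
  by rewrite -(normrM t); apply: lerD; apply: ler_pM; rewrite ?normr_ge0 ?fM' ?qf ?rg ?rN.
have eqr : ev (q * (r * 'X)) = ev q ** ev r.
  by rewrite /ev nmul_pact mulrCA -!pactX -!pactM mulrA; congr pact; ring.
have h2 : rnorm (cfc f ** cfc g - ev q ** ev r) <= M * d + d * (N + 1).
  have -> : cfc f ** cfc g - ev q ** ev r =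
      cfc f ** (cfc g - ev r) + (cfc f - ev q) ** ev r by nring.
  apply: le_trans (rnormD _ _) _; apply: lerD.
    apply: le_trans (rnormM _ _) _; rewrite ler_pM ?rnorm_ge0 ?rnorm_cfc_le//.
    exact: cfcP.
  apply: le_trans (rnormM _ _) _; rewrite ler_pM ?rnorm_ge0//; first exact: cfcP.
  exact: rnorm_ev.
apply: le_trans (rnorm_dist_triangle (ev (q * (r * 'X))) _ _) _.
apply: le_trans (lerD h1 (_ : _ <= M * d + d * (N + 1))) _.
  by rewrite rnorm_distC eqr.
by move: de; rewrite /k; lra.
Qed.

End FunctionalCalculus.

(** * Moving h across a product of images *)

Section Ramps.
Variable R : realType.
Implicit Types (s t x y : R) (J k : nat).

Definition clamp x : R := Num.max 0 (Num.min 1 x).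

Lemma clamp_ge0 x : 0 <= clamp x.
Proof. by rewrite le_max lexx. Qed.

Lemma clamp_le1 x : clamp x <= 1.
Proof. by rewrite ge_max ler01 ge_min lexx. Qed.

Lemma clamp_eq0 x : x <= 0 -> clamp x = 0.
Proof. by move=> x0; apply/eqP; rewrite eq_le clamp_ge0 andbT ge_max lexx ge_min x0 orbT. Qed.

Lemma clamp_eq1 x : 1 <= x -> clamp x = 1.
Proof. by move=> x1; apply/eqP; rewrite eq_le clamp_le1 le_max le_min lexx x1 orbT. Qed.

Lemma clampE x : clamp x = if x <= 0 then 0 else if 1 <= x then 1 else x.
Proof.
have [x0|x0] := leP x 0; first exact: clamp_eq0.
have [x1|x1] := leP 1 x; first exact: clamp_eq1.
by rewrite /clamp (min_idPr (ltW x1)) (max_idPr (ltW x0)).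
Qed.

Lemma clamp_lipschitz x y : `|clamp x - clamp y| <= `|x - y|.
Proof.
wlog xy : x y / x <= y => [H|].
  by case/orP: (le_total x y) => /H//; rewrite distrC [leRHS]distrC.
rewrite distrC [leRHS]distrC !ger0_norm ?subr_ge0// !clampE;
  by case: (leP x 0) => ?; case: (leP y 0) => ?; case: (leP 1 x) => ?;
    case: (leP 1 y) => ?; lra.
Qed.

(* With [s] in [[0, 4J]]: [stair] climbs by 4 across each [[4k, 4k + 1]], while [comb]
   vanishes on these intervals and is 1 on each [[4k + 2, 4k + 3]]. *)
Definition stair J s : R := \sum_(k < J) 4 * clamp (s - 4 * k%:R).

Definition comb J s : R :=
  \sum_(k < J) (clamp (s - 4 * k%:R - 1) - clamp (s - 4 * k%:R - 3)).

Lemma stairS J s : stair J.+1 s = stair J s + 4 * clamp (s - 4 * J%:R).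
Proof. by rewrite /stair big_ord_recr. Qed.

Lemma combS J s :
  comb J.+1 s = comb J s + (clamp (s - 4 * J%:R - 1) - clamp (s - 4 * J%:R - 3)).
Proof. by rewrite /comb big_ord_recr. Qed.

(** The range begins at -2 because the second staircase is evaluated at s - 2. *)
Lemma stair_dist J s : - 2 <= s <= 4 * J%:R -> `|stair J s - s| <= 4.
Proof.
suff : (4 * J%:R <= s -> stair J s = 4 * J%:R) /\
       (-2 <= s <= 4 * J%:R -> `|stair J s - s| <= 4) by case.
elim: J => [|J [IH1 IH2]]; rewrite ?stairS.
  rewrite /stair big_ord0 mulr0; split=> // /andP[h1 h2].
  by rewrite sub0r normrN ler_norml; apply/andP; split; lra.
have JS : J.+1%:R = J%:R + 1 :> R by rewrite natr1.
split=> [h|/andP[h1 h2]].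
  by rewrite JS in h *; rewrite IH1 ?clamp_eq1; lra.
have [sJ|Js] := leP s (4 * J%:R).
  by rewrite clamp_eq0 ?mulr0 ?addr0 ?IH2 ?h1 ?sJ//; lra.
rewrite IH1; last exact: ltW.
have := clamp_ge0 (s - 4 * J%:R); have := clamp_le1 (s - 4 * J%:R).
rewrite JS in h2; rewrite ler_norml => c1 c0.
by apply/andP; split; lra.
Qed.

Lemma comb_out J s : 4 * J%:R <= s -> comb J s = 0.
Proof.
elim: J => [|J IH]; rewrite ?combS; first by rewrite /comb big_ord0.
rewrite -natr1 => h; rewrite IH; last by lra.
by rewrite !clamp_eq1 ?subrr ?addr0//; lra.
Qed.

Lemma comb_itv J s : 0 <= comb J s <= 1.
Proof.
elim: J => [|J /andP[IH0 IH1]]; rewrite ?combS; first by rewrite /comb big_ord0 lexx ler01.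
have [sJ|Js] := leP s (4 * J%:R).
  by rewrite !clamp_eq0 ?subrr ?addr0 ?IH0 ?IH1//; lra.
rewrite comb_out ?add0r; last exact: ltW.
have [s3|s3] := leP (s - 4 * J%:R - 3) 0.
  by rewrite [clamp (_ - 3)]clamp_eq0// subr0 clamp_ge0 clamp_le1.
rewrite [clamp (_ - 1)]clamp_eq1; last by lra.
by rewrite subr_ge0 clamp_le1 lerBlDr lerDl clamp_ge0.
Qed.

Lemma comb0 J k s : 4 * k%:R <= s <= 4 * k%:R + 1 -> comb J s = 0.
Proof.
move=> /andP[h0 h1]; elim: J => [|J IH]; rewrite ?combS; first by rewrite /comb big_ord0.
rewrite IH add0r; have [kJ|Jk] := leqP k J.
  have : k%:R <= J%:R :> R by rewrite ler_nat.
  by move=> ?; rewrite !clamp_eq0 ?subrr//; lra.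
have : J.+1%:R <= k%:R :> R by rewrite ler_nat.
by rewrite -natr1 => ?; rewrite !clamp_eq1 ?subrr//; lra.
Qed.

Lemma comb1 J k s : (k < J)%N -> 4 * k%:R + 2 <= s <= 4 * k%:R + 3 -> comb J s = 1.
Proof.
move=> + /andP[h0 h1]; elim: J => [//|J IH]; rewrite combS ltnS leq_eqVlt => /orP[/eqP kJ|kJ].
  rewrite comb_out -?kJ; last by lra.
  by rewrite clamp_eq1 ?clamp_eq0 ?subr0 ?add0r//; lra.
rewrite IH//; have : k.+1%:R <= J%:R :> R by rewrite ler_nat.
by rewrite -natr1 => ?; rewrite !clamp_eq0 ?subrr ?addr0//; lra.
Qed.

(** A ramp differs from 0 and 1 only while it climbs, on [4k, 4k + 1], and there [comb] vanishes. *)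
Lemma ramp_comb J k s :
  clamp (s - 4 * k%:R) * (1 - clamp (s - 4 * k%:R)) * comb J s = 0.
Proof.
have [h|h] := leP (s - 4 * k%:R) 0; first by rewrite clamp_eq0// !mul0r.
have [h1|h1] := leP 1 (s - 4 * k%:R); first by rewrite clamp_eq1// subrr mulr0 mul0r.
by rewrite (@comb0 J k) ?mulr0//; apply/andP; split; lra.
Qed.

(** Shifted by 2, the ramps climb on [4k + 2, 4k + 3], which are plateaus of height 1 of [comb]. *)
Lemma ramp_cocomb J k s : (k < J)%N ->
  clamp (s - 2 - 4 * k%:R) * (1 - clamp (s - 2 - 4 * k%:R)) * (1 - comb J s) = 0.
Proof.
move=> kJ; have [h|h] := leP (s - 2 - 4 * k%:R) 0; first by rewrite clamp_eq0// !mul0r.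
have [h1|h1] := leP 1 (s - 2 - 4 * k%:R).
  by rewrite clamp_eq1// subrr mulr0 mul0r.
by rewrite (comb1 kJ) ?subrr ?mulr0//; apply/andP; split; lra.
Qed.

Lemma ucont_const (c : R) : ucont (fun=> c).
Proof. by apply: (@ucont_lipschitz _ _ 0) => x y; rewrite subrr normr0 mul0r. Qed.

Lemma ucont_clamp (a b : R) : ucont (fun t => clamp (a * t - b)).
Proof.
apply: (@ucont_lipschitz _ _ `|a|) => x y; apply: le_trans (clamp_lipschitz _ _) _.
by rewrite -normrM le_eqVlt; apply/orP; left; apply/eqP; congr `|_|; ring.
Qed.

Lemma ucont_sum J (F : nat -> R -> R) : (forall k, ucont (F k)) ->
  ucont (fun t => \sum_(k < J) F k t).
Proof.
move=> Fu; elim: J => [|J IH].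
  by under eq_fun do rewrite big_ord0; exact: ucont_const.
by under eq_fun do rewrite big_ord_recr /=; exact: ucontD.
Qed.

End Ramps.

Section Balanced.
Variables (R : realType) (A B : cstarAlgType R) (theta : {linear A -> B}) (K : R).
Hypotheses (theta_le : forall x, rnorm (theta x) <= K * rnorm x)
  (theta_zpp : zero_product_preserving_sa theta).
Variable h : A.
Hypotheses (h_sa : self_adjoint h) (h_small : rnorm h <= 2^-1).
Implicit Types (f g c rho : R -> R) (t : R).

Let E f g := theta (cfc h f) ** theta (cfc h g).

Let K0 : 0 <= `|K|. Proof. exact: normr_ge0. Qed.

Let E_le f g (M N : R) : ucont0 f -> ucont0 g ->
  (forall t, -1 <= t <= 1 -> `|f t| <= M) ->
  (forall t, -1 <= t <= 1 -> `|g t| <= N) -> rnorm (E f g) <= `|K| ^+ 2 * (M * N).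
Proof.
move=> fu gu fM gN.
have H u x : ucont0 u -> (forall t, -1 <= t <= 1 -> `|u t| <= x) ->
    rnorm (theta (cfc h u)) <= `|K| * x.
  move=> uu ux; apply: le_trans (theta_le _) _.
  apply: le_trans (ler_wpM2r (rnorm_ge0 _) (ler_norm K)) _.
  by rewrite ler_wpM2l// rnorm_cfc_le.
apply: le_trans (rnormM _ _) _.
rewrite expr2 mulrACA; apply: ler_pM; rewrite ?rnorm_ge0 ?H//.
Qed.

Let EBl f f' g : ucont0 f -> ucont0 f' -> E (fun t => f t - f' t) g = E f g - E f' g.
Proof. by move=> fu fu'; rewrite /E cfcB// linearB nmulBl. Qed.

Let EBr f g g' : ucont0 g -> ucont0 g' -> E f (fun t => g t - g' t) = E f g - E f g'.
Proof. by move=> gu gu'; rewrite /E cfcB// linearB nmulBr. Qed.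

Let EDl f f' g : ucont0 f -> ucont0 f' -> E (fun t => f t + f' t) g = E f g + E f' g.
Proof. by move=> fu fu'; rewrite /E cfcD// linearD nmulDl. Qed.

Let EDr f g g' : ucont0 g -> ucont0 g' -> E f (fun t => g t + g' t) = E f g + E f g'.
Proof. by move=> gu gu'; rewrite /E cfcD// linearD nmulDr. Qed.

Let EZl (k : R) f g : ucont0 f -> E (fun t => k * f t) g = k%:C *: E f g.
Proof. by move=> fu; rewrite /E cfcZ// linearZ -nscaleAl. Qed.

Let EZr (k : R) f g : ucont0 g -> E f (fun t => k * g t) = k%:C *: E f g.
Proof. by move=> fu; rewrite /E cfcZ// linearZ -nscaleAr. Qed.

Let E_eq0 f g : ucont0 f -> ucont0 g -> (forall t, f t * g t = 0) -> E f g = 0.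
Proof.
move=> fu gu fg; apply: theta_zpp; try exact: cfc_self_adjoint.
rewrite -cfcM//; have := cfc_poly h_sa h_small 0; rewrite pact0 => <-.
by congr cfc; apply/funext => t; rewrite fg horner0 mulr0.
Qed.

(** [rho] passes from one factor to the other once the first factor is localized by [c]. For fixed
    [c] such [rho] form a vector space, so ramps can be summed to staircases. *)
Let multiplier c rho := ucont rho /\ forall f g, ucont0 f -> ucont0 g ->
  E (fun t => rho t * (c t * f t)) g = E (fun t => c t * f t) (fun t => rho t * g t).

(** The difference of the two sides is E(rho c f, (1 - rho) g) + E((rho - 1) c f, rho g); in both
    terms the product of the two functions contains rho (1 - rho) c = 0. *)
Let multiplier_ramp c rho : ucont c -> ucont rho ->
  (forall t, rho t * (1 - rho t) * c t = 0) -> multiplier c rho.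
Proof.
move=> cu ru rc; split=> // f g fu gu.
have cfu := ucont0Ml cu fu; have rcfu := ucont0Ml ru cfu; have rgu := ucont0Ml ru gu.
apply/eqP; rewrite -subr_eq0 -(subrKA (E (fun t => rho t * (c t * f t)) (fun t => rho t * g t))).
rewrite -EBr// -EBl//.
have H1 t : rho t * (c t * f t) * (g t - rho t * g t) = 0.
  have -> : rho t * (c t * f t) * (g t - rho t * g t) =
    rho t * (1 - rho t) * c t * (f t * g t) by ring.
  by rewrite rc mul0r.
have H2 t : (rho t * (c t * f t) - c t * f t) * (rho t * g t) = 0.
  have -> : (rho t * (c t * f t) - c t * f t) * (rho t * g t) =
    - (rho t * (1 - rho t) * c t * (f t * g t)) by ring.
  by rewrite rc mul0r oppr0.
by rewrite !E_eq0 ?addr0//; exact: ucont0B.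
Qed.

Let multiplierD c rho rho' : ucont c -> multiplier c rho -> multiplier c rho' ->
  multiplier c (fun t => rho t + rho' t).
Proof.
move=> cu [ru rE] [ru' rE']; split; first exact: ucontD.
move=> f g fu gu; have cfu := ucont0Ml cu fu.
under eq_fun do rewrite mulrDl.
have -> : (fun t => (rho t + rho' t) * g t) = (fun t => rho t * g t + rho' t * g t).
  by apply/funext => t; rewrite mulrDl.
by rewrite EDl ?EDr ?rE ?rE'//; exact: ucont0Ml.
Qed.

Let multiplierZ c (k : R) rho : ucont c -> multiplier c rho ->
  multiplier c (fun t => k * rho t).
Proof.
move=> cu [ru rE]; split; first exact: ucontZ.
move=> f g fu gu; have cfu := ucont0Ml cu fu.
under eq_fun do rewrite -mulrA.
have -> : (fun t => k * rho t * g t) = (fun t => k * (rho t * g t)).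
  by apply/funext => t; rewrite mulrA.
by rewrite EZl ?EZr ?rE//; exact: ucont0Ml.
Qed.

Let multiplier_const c (k : R) : ucont c -> multiplier c (fun=> k).
Proof.
move=> cu; split=> [|f g fu gu]; first exact: ucont_const.
by rewrite EZl ?EZr//; exact: ucont0Ml.
Qed.

Let multiplier_sum c J (F : nat -> R -> R) : ucont c ->
  (forall k, (k < J)%N -> multiplier c (F k)) -> multiplier c (fun t => \sum_(k < J) F k t).
Proof.
move=> cu; elim: J => [|J IH] H.
  by under eq_fun do rewrite big_ord0; exact: multiplier_const.
under eq_fun do rewrite big_ord_recr /=.
by apply: multiplierD => //; [apply: IH => k /ltnW; exact: H|exact: H].
Qed.

(** [tau] moves across exactly, so only t - tau contributes, once in each factor; this is the factor
    2 in the bound. *)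
Let color_dist c tau (d M N : R) f g : ucont c -> multiplier c tau ->
  (forall t, -1 <= t <= 1 -> `|c t| <= 1) ->
  (forall t, -1 <= t <= 1 -> `|t - tau t| <= d) ->
  ucont0 f -> ucont0 g ->
  (forall t, -1 <= t <= 1 -> `|f t| <= M) ->
  (forall t, -1 <= t <= 1 -> `|g t| <= N) ->
  rnorm (E (fun t => t * (c t * f t)) g - E (fun t => c t * f t) (fun t => t * g t))
    <= `|K| ^+ 2 * (2 * d * M * N).
Proof.
move=> cu [tu tE] c1 td fu gu fM gN.
have cfu := ucont0Ml cu fu; have gtu := ucont0Ml tu gu; have cftu := ucont0Ml tu cfu.
have idu := @ucont_id R; have gt := ucont0Ml idu gu; have cft := ucont0Ml idu cfu.
have -> : E (fun t => t * (c t * f t)) g - E (fun t => c t * f t) (fun t => t * g t) =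
    E (fun t => t * (c t * f t) - tau t * (c t * f t)) g -
    E (fun t => c t * f t) (fun t => t * g t - tau t * g t).
  by rewrite EBl// EBr// tE// opprB addrA subrK.
have cfM t : -1 <= t <= 1 -> `|c t * f t| <= M.
  move=> t1; rewrite normrM -[M]mul1r; apply: ler_pM; rewrite ?normr_ge0 ?c1 ?fM//.
apply: le_trans (rnormB _ _) _.
have -> : `|K| ^+ 2 * (2 * d * M * N) = `|K| ^+ 2 * (d * M * N) + `|K| ^+ 2 * (M * (d * N)).
  by ring.
apply: lerD; apply: E_le; rewrite ?normr_ge0//; try exact: ucont0B.
- move=> t t1; rewrite -mulrBl normrM; apply: ler_pM; rewrite ?normr_ge0 ?td ?cfM//.
- move=> t t1; rewrite -mulrBl normrM; apply: ler_pM; rewrite ?normr_ge0 ?td ?gN//.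
Qed.

(** f = c f + (1 - c) f with c a comb. Each piece has a staircase that is a multiplier for it and
    lies within 3 / J of t, and J is arbitrary. *)
Lemma zpp_balanced f g : ucont0 f -> ucont0 g ->
  theta (cfc h (fun t => t * f t)) ** theta (cfc h g) =
  theta (cfc h f) ** theta (cfc h (fun t => t * g t)).
Proof.
move=> fu gu; apply/eqP; rewrite -subr_eq0; apply/eqP/rnorm_le0 => e e0.
have [M M0 fM] := ucont_bounded (proj1 fu); have [N N0 gN] := ucont_bounded (proj1 gu).
have fM' t : -1 <= t <= 1 -> `|f t| <= M by rewrite -ler_norml; exact: fM.
have gN' t : -1 <= t <= 1 -> `|g t| <= N by rewrite -ler_norml; exact: gN.
(* Two pieces, each with error 2 (3 / J) M N |K|^2. *)
pose k := `|K| ^+ 2 * (12 * M * N).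
have k0 : 0 <= k by rewrite /k !mulr_ge0 ?sqr_ge0// ltW.
have [J J0 Je] : exists2 J : nat, 0 < J%:R :> R & k / e <= J%:R.
  exists (Num.bound (k / e)).+1; first by rewrite ltr0n.
  apply: le_trans (ltW (archi_boundP _)) _; first by rewrite divr_ge0// ltW.
  by rewrite ler_nat.
(* The affine bijection from [-1, 1] onto [0, 4 J], inverted by [lin] below. *)
pose s t : R := 2 * J%:R * (t + 1).
have sE (b t : R) : s t - b = 2 * J%:R * t - (b - 2 * J%:R) by rewrite /s; ring.
have s_itv t : -1 <= t <= 1 -> 0 <= s t <= 4 * J%:R.
  move=> /andP[h1 h2]; have : 0 <= J%:R * (t + 1) by rewrite mulr_ge0 ?(ltW J0)//; lra.
  have : 0 <= J%:R * (1 - t) by rewrite mulr_ge0 ?(ltW J0)//; lra.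
  by rewrite /s => ? ?; apply/andP; split; lra.
have ramp_u b : ucont (fun t => clamp (s t - b)).
  by under eq_fun do rewrite sE; exact: ucont_clamp.
pose c t := comb J (s t).
have cu : ucont c.
  apply: (@ucont_sum _ J (fun k t => clamp (s t - 4 * k%:R - 1) - clamp (s t - 4 * k%:R - 3))).
  move=> l; under eq_fun do rewrite -!addrA -!opprD -[- clamp _]mulN1r.
  by apply: ucontD; rewrite //; apply: ucontZ.
have c1 t : -1 <= t <= 1 -> `|c t| <= 1.
  by move=> _; have /andP[c0 ?] := comb_itv J (s t); rewrite /c ger0_norm.
pose c' t := 1 - c t.
have cu' : ucont c'.
  rewrite /c'; under eq_fun do rewrite -[- c _]mulN1r.
  by apply: ucontD; [exact: ucont_const|exact: ucontZ].
have c1' t : -1 <= t <= 1 -> `|c' t| <= 1.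
  move=> _; have /andP[c0 ?] := comb_itv J (s t); rewrite /c' /c ger0_norm.
    by rewrite lerBlDr lerDl.
  by rewrite subr_ge0.
pose lin (u : R) := (2 * J%:R)^-1 * u + (-1).
have J2 : 0 < 2 * J%:R :> R by rewrite mulr_gt0.
(* 6 is the staircase error 4 plus the shift 2; [lin] divides it by 2 J. *)
have lin_dist t u : `|u - s t| <= 6 -> `|t - lin u| <= 3 / J%:R.
  move=> us; have -> : t - lin u = - ((2 * J%:R)^-1 * (u - s t)).
    by rewrite /lin /s; field; rewrite lt0r_neq0.
  rewrite normrN normrM gtr0_norm ?invr_gt0// mulrC ler_pdivrMr//.
  by have -> : 3 / J%:R * (2 * J%:R) = 6 :> R by field; rewrite lt0r_neq0.
have m1 : multiplier c (fun t => lin (stair J (s t))).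
  apply: multiplierD => //; last exact: multiplier_const.
  apply: multiplierZ => //.
  apply: (@multiplier_sum _ _ (fun k t => 4 * clamp (s t - 4 * k%:R))) => // l lJ.
  apply: multiplierZ => //; apply: multiplier_ramp => // t; exact: ramp_comb.
have m2 : multiplier c' (fun t => lin (stair J (s t - 2))).
  apply: multiplierD => //; last exact: multiplier_const.
  apply: multiplierZ => //.
  apply: (@multiplier_sum _ _ (fun k t => 4 * clamp (s t - 2 - 4 * k%:R))) => // l lJ.
  apply: multiplierZ => //; apply: multiplier_ramp => //.
    by under eq_fun do rewrite -addrA -opprD; exact: ramp_u.
  by move=> t; exact: ramp_cocomb.
have d1 t : -1 <= t <= 1 -> `|t - lin (stair J (s t))| <= 3 / J%:R.
  move=> /s_itv /andP[h1 h2]; apply: lin_dist; apply: le_trans (stair_dist _) _; last by lra.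
  by apply/andP; split; lra.
have d2 t : -1 <= t <= 1 -> `|t - lin (stair J (s t - 2))| <= 3 / J%:R.
  move=> /s_itv /andP[h1 h2]; apply: lin_dist.
  have -> : stair J (s t - 2) - s t = (stair J (s t - 2) - (s t - 2)) - 2 by ring.
  apply: le_trans (ler_normB _ _) _; rewrite (ger0_norm (ler0n _ 2)).
  have : `|stair J (s t - 2) - (s t - 2)| <= 4.
    by apply: stair_dist; apply/andP; split; lra.
  by lra.
have h1 := color_dist cu m1 c1 d1 fu gu fM' gN'.
have h2 := color_dist cu' m2 c1' d2 fu gu fM' gN'.
have idu := @ucont_id R.
have cfu := ucont0Ml cu fu; have cfu' := ucont0Ml cu' fu.
have split1 : f = (fun t => c t * f t + c' t * f t).
  by apply/funext => t; rewrite -mulrDl /c' addrC subrK mul1r.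
have split2 : (fun t => t * f t) = (fun t => t * (c t * f t) + t * (c' t * f t)).
  by apply/funext => t; rewrite -mulrDr {1}split1.
rewrite -/(E _ _) -/(E _ _) {2}split1 split2.
rewrite EDl ?EDl//; try exact: ucont0Ml.
rewrite opprD addrACA; apply: le_trans (rnormD _ _) _.
apply: le_trans (lerD h1 h2) _.
have -> : `|K| ^+ 2 * (2 * (3 / J%:R) * M * N) + `|K| ^+ 2 * (2 * (3 / J%:R) * M * N) =
  k / J%:R by rewrite /k; field; rewrite lt0r_neq0.
by rewrite ler_pdivrMr// mulrC -ler_pdivrMr.
Qed.

End Balanced.

(** * Powers and cube roots *)

Section Powers.
Variables (R : realType) (A : cstarAlgType R).
Implicit Types (a h x y : A).

(* [npow a n] is the power with exponent [n + 1]. *)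
Definition npow a n : A := iter n (rmul a) a.

Lemma npowZ (c : R[i]) a n : npow (c *: a) n = c ^+ n.+1 *: npow a n.
Proof.
elim: n => [|n IH]; first by rewrite expr1.
by rewrite /npow iterS -/(npow _ n) IH /rmul -nscaleAl -nscaleAr scalerA -exprSr.
Qed.

Lemma npow_pact h n : npow h n = pact h 'X^n h.
Proof. by rewrite /pact map_polyXn pop_Xn. Qed.

Lemma small_scale a : exists2 c : R, 0 < c & rnorm (c%:C *: a) <= 2^-1.
Proof.
have a1 : 0 < rnorm a + 1 by rewrite ltr_wpDl// rnorm_ge0.
exists (2 * (rnorm a + 1))^-1; first by rewrite invr_gt0 mulr_gt0.
rewrite rnormZr gtr0_norm ?invr_gt0 ?mulr_gt0// invfM -mulrA ler_piMr ?invr_ge0//.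
by rewrite mulrC ler_pdivrMr// mul1r lerDl.
Qed.

Lemma real_cube_root (t : R) : exists c : R, c ^+ 3 = t.
Proof.
have [||c _ /rootP] := @poly_ivt R ('X^3 - t%:P) (- (`|t| + 1)) (`|t| + 1).
- by rewrite ge0_cp// addr_ge0.
- have t0 := normr_ge0 t; have := ler_norm t; have := ler_norm (- t); rewrite normrN.
  move: `|t| t0 => u u0 h1 h2; rewrite !hornerE.
  have : 0 <= u ^+ 2 by rewrite sqr_ge0.
  have : 0 <= u ^+ 3 by rewrite exprn_ge0.
  by rewrite !expr2 !exprS !expr0; move=> h3 h4; apply/andP; split; lra.
by rewrite !hornerE => /eqP; rewrite subr_eq0 => /eqP ct; exists c.
Qed.

Lemma ucont_cube_root (f : R -> R) : (forall t, f t ^+ 3 = t) -> ucont f.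
Proof.
move=> f3 e e0; exists (16 / e ^+ 5) => x y _ _.
rewrite -{2}(f3 x) -{2}(f3 y); move: (f x) (f y) => u v {x y}.
set w := u - v; have [we|we] := leP `|w| e.
  by rewrite (le_trans we)// lerDl mulr_ge0 ?sqr_ge0// divr_ge0// exprn_ge0// ltW.
have key : `|w| ^+ 3 <= 4 * `|u ^+ 3 - v ^+ 3|.
  have -> : u ^+ 3 - v ^+ 3 = w * (u ^+ 2 + u * v + v ^+ 2) by rewrite /w; ring.
  have q0 : 4^-1 * w ^+ 2 <= u ^+ 2 + u * v + v ^+ 2.
    by have := sqr_ge0 (u + v); rewrite /w !expr2; lra.
  rewrite normrM exprS [leRHS]mulrCA ler_wpM2l// real_normK ?num_real//.
  have := ler_norm (u ^+ 2 + u * v + v ^+ 2); lra.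
have e5 : 0 < e ^+ 5 by rewrite exprn_gt0.
apply: (@le_trans _ _ (16 / e ^+ 5 * (u ^+ 3 - v ^+ 3) ^+ 2)); last by rewrite lerDr ltW.
rewrite mulrAC ler_pdivlMr// -[(u ^+ 3 - _) ^+ 2]real_normK ?num_real//.
have h1 : `|w| ^+ 3 * `|w| ^+ 3 <= (4 * `|u ^+ 3 - v ^+ 3|) * (4 * `|u ^+ 3 - v ^+ 3|).
  by rewrite ler_pM// exprn_ge0.
have h2 : `|w| * e ^+ 5 <= `|w| * `|w| ^+ 5.
  by rewrite ler_wpM2l// lerXn2r// ?nnegrE ltW.
apply: (le_trans h2); rewrite -exprS (_ : 6 = 3 + 3)%N// exprD.
by apply: le_trans h1 _; rewrite le_eqVlt; apply/orP; left; apply/eqP; ring.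
Qed.

(** The linearized identities below speak of cubes of self-adjoint elements only; this extends them
    to everything. *)
Lemma cube_root a : self_adjoint a -> exists2 c, self_adjoint c & c ** c ** c = a.
Proof.
move=> aa; have [k k0 kh] := small_scale a; set h := k%:C *: a in kh.
have h_sa : self_adjoint h by exact: self_adjointZr.
have [f f3] := choice real_cube_root.
have fu : ucont0 f.
  split; first exact: ucont_cube_root.
  by apply/eqP; have /eqP := f3 0; rewrite expf_eq0.
(* The cube of f(k a) is k a, and m^3 = 1 / k undoes the rescaling. *)
have [m mk] := real_cube_root k^-1.
exists (m%:C *: cfc h f); first by apply/self_adjointZr/cfc_self_adjoint.
rewrite -!nscaleAr -!nscaleAl !scalerA -!cfcM//; last exact: ucont0M.
have -> : (fun t => f t * f t * f t) = id.
  by apply/funext => t; rewrite -[RHS]f3 !exprS expr0 mulr1 mulrA.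
rewrite cfc_id// /h scalerA -!rmorphM /=.
have -> : m * m * m = k^-1 by rewrite -mk; ring.
by rewrite mulVf ?lt0r_neq0// scale1r.
Qed.

End Powers.

Section ZeroProductPowers.
Variables (R : realType) (A B : cstarAlgType R) (theta : {linear A -> B}).
Hypotheses (theta_bnd : bounded_op theta) (theta_zpp : zero_product_preserving_sa theta).

Lemma bounded_op_rnorm : exists K : R, forall x, rnorm (theta x) <= K * rnorm x.
Proof.
have [K KP] := theta_bnd; exists K => x.
by rewrite -lecR rnormE real_complexM rnormE; exact: KP.
Qed.

(** The balanced identity for monomials. Both sides have the same degree in [a], so the scalar used
    to make [a] small cancels. *)
Lemma zpp_npow (a : A) i j : self_adjoint a ->
  theta (npow a i.+1) ** theta (npow a j) = theta (npow a i) ** theta (npow a j.+1).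
Proof.
move=> aa; have [K KP] := bounded_op_rnorm.
have [k k0 kh] := small_scale a; have k_n0 : k%:C != 0 :> R[i].
  by rewrite (inj_eq (@complexI R) k 0) lt0r_neq0.
have h_sa : self_adjoint (k%:C *: a) by exact: self_adjointZr.
have H n : ucont0 (fun t : R => t * ('X^n).[t]) by exact: ucont0_poly.
have := zpp_balanced KP theta_zpp h_sa kh (H i) (H j).
have E n : cfc (k%:C *: a) (fun t : R => t * ('X^n).[t]) = npow (k%:C *: a) n.
  by rewrite cfc_poly// npow_pact.
have E' n : cfc (k%:C *: a) (fun t : R => t * (t * ('X^n).[t])) = npow (k%:C *: a) n.+1.
  rewrite -E; congr cfc; apply/funext => t.
  by rewrite !hornerXn exprS.
rewrite !E' !E !npowZ !linearZ -!nscaleAr -!nscaleAl !scalerA -!exprD.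
have -> : (j.+2 + i.+1 = j.+1 + i.+2)%N by lia.
by apply: scalerI; rewrite expf_neq0.
Qed.

End ZeroProductPowers.

(** * Approximate units and limits along them *)

Section ApproximateUnits.
Variables (R : realType) (A : cstarAlgType R).
Implicit Types (x y e : A).

(** Multiply 1 + m s <= (1 + s)^m by (1 - s)^m and use (1 - s^2)^m <= 1, with m = n + 1. *)
Lemma bernoulli_decay (s : R) n : 0 <= s <= 1 -> s * (1 - s) ^+ n.+1 <= n.+1%:R^-1.
Proof.
move=> /andP[s0 s1]; have u0 : 0 <= 1 - s by rewrite subr_ge0.
have bern m : 1 + m%:R * s <= (1 + s) ^+ m.
  elim: m => [|m IH]; first by rewrite mul0r addr0 expr0.
  have s1' : 0 <= 1 + s by lra.
  have := ler_wpM2l s1' IH; rewrite -exprS -natr1.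
  have : 0 <= m%:R * s * s by rewrite !mulr_ge0.
  by lra.
have n0 : 0 < n.+1%:R :> R by rewrite ltr0n.
rewrite -[leRHS]mul1r ler_pdivlMr//.
have /(ler_wpM2l (exprn_ge0 n.+1 u0)) := bern n.+1; rewrite -exprMn.
have -> : (1 - s) * (1 + s) = 1 - s ^+ 2 by ring.
have : (1 - s ^+ 2) ^+ n.+1 <= 1.
  have := exprn_ile1 2 s0 s1; have := sqr_ge0 s => ? ?.
  by rewrite exprn_ile1//; lra.
have := exprn_ge0 n.+1 u0; set v := (1 - s) ^+ _ => v0.
by move: (_ ^+ n.+1) => w; lra.
Qed.

(* The unit [e = 1 - (1 - h^2)^N] is [h^2 r(h)]. *)
Lemma right_unit x (d : R) : 0 < d -> exists (k : R) (r : {poly R}),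
  let h := k%:C *: (star x ** x) in let e := pact h r (h ** h) in
  [/\ self_adjoint e, forall y, rnorm (y - y ** e) <= rnorm y,
      forall y, rnorm (y - e ** y) <= rnorm y & rnorm (x - x ** e) <= d].
Proof.
move=> d0; have [k k0 kh] := small_scale (star x ** x); exists k.
set h := k%:C *: _ in kh *.
have h_sa : self_adjoint h by apply/self_adjointZr/self_adjoint_starM.
have eta0 : 0 < k * d ^+ 2 by rewrite mulr_gt0// exprn_gt0.
have [n nP] : exists n, n.+1%:R^-1 <= (k * d ^+ 2) ^+ 2.
  exists (Num.bound ((k * d ^+ 2) ^+ 2)^-1).
  rewrite -[leRHS]invrK lef_pV2 ?posrE ?invr_gt0 ?exprn_gt0//.
  apply: le_trans (ltW (archi_boundP _)) _; first by rewrite invr_ge0 sqr_ge0.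
  by rewrite ler_nat.
pose u : {poly R} := 1 - 'X * 'X.
pose r := \sum_(i < n.+1) u ^+ i; exists r => /=.
have urE : 1 - r * ('X * 'X) = u ^+ n.+1.
  have : u ^+ n.+1 - 1 = - (r * ('X * 'X)).
    by rewrite subrX1 -/r /u; ring.
  by move=> <-; rewrite addrC subrK.
set e := pact h r (h ** h).
have yeE y : y - y ** e = pact h (u ^+ n.+1) y.
  by rewrite -urE pactB pact1 !pactM !pactX /e nmul_pact nmulA.
have u01 (t : R) : -1 <= t <= 1 -> 0 <= t ^+ 2 <= 1.
  move=> /andP[h1 h2]; rewrite sqr_ge0 -ler_sqrt ?sqrtr1 ?sqrtr_sqr ?ler_norml ?h1//.
have uE (t : R) : (u ^+ n.+1).[t] = (1 - t ^+ 2) ^+ n.+1.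
  by rewrite horner_exp !hornerE expr2.
have ule (t : R) : -1 <= t <= 1 -> `|(u ^+ n.+1).[t]| <= 1.
  move=> /u01 /andP[t0 t1]; rewrite uE ger0_norm ?exprn_ge0 ?subr_ge0//.
  by rewrite exprn_ile1 ?subr_ge0// lerBlDr lerDl.
have e_sa : self_adjoint e.
  rewrite /e; have -> : pact h r (h ** h) = pact h (r * 'X) h by rewrite pactM pactX.
  exact: star_pact.
have yr y : rnorm (y - y ** e) <= rnorm y.
  by rewrite yeE -[leRHS]mul1r; exact: rnorm_pact_le.
split=> // [y|].
  by rewrite -rnorm_star starB starM e_sa -[leRHS]rnorm_star yr.
(* |x - x e|^2 is the norm of (1 - e) [star x] x (1 - e) = h u(h)^(2 (n + 1)) / k, a function of h
   alone. *)
rewrite -(@ler_pXn2r _ 2)// ?nnegrE ?rnorm_ge0 ?(ltW d0)// -rnorm_starM yeE nmul_pact.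
set z := pact h _ x.
have -> : star z ** x = k^-1%:C *: pact h (u ^+ n.+1) h.
  rewrite -[LHS]starK starM starK /z nmul_pact.
  have -> : star x ** x = k^-1%:C *: h.
    by rewrite /h scalerA -rmorphM mulVf ?lt0r_neq0// scale1r.
  by rewrite pactZr starZr star_pact.
rewrite pactZr rnormZr gtr0_norm ?invr_gt0// -pactM mulrC ler_pdivrMr// [d ^+ 2 * k]mulrC.
rewrite -cfc_poly//; apply: rnorm_cfc_le (ucont0_poly _) _ => // t t1.
rewrite -(@ler_pXn2r _ 2)// ?nnegrE ?(ltW eta0)// real_normK ?num_real//.
apply: le_trans nP; apply: le_trans (bernoulli_decay n (u01 _ t1)).
rewrite hornerM uE; move: (u01 _ t1) => /andP[t0 tle].
set v := (1 - _) ^+ _; have v0 : 0 <= v by rewrite exprn_ge0// subr_ge0.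
have v1 : v <= 1 by rewrite exprn_ile1 ?subr_ge0// lerBlDr lerDl.
(* Squaring produces t^2 v, to which the decay estimate at s = t^2 applies; the factor v^3 is at
   most 1. *)
have -> : (t * (v * v)) ^+ 2 = t ^+ 2 * v * v ^+ 3 by ring.
by apply: ler_piMr; [exact: mulr_ge0|exact: exprn_ile1].
Qed.

(** Units for single elements are combined by multiplying the formal complements 1 - e. Each
    complement is a contraction, so later factors do not spoil earlier estimates. Adding the
    adjoints of [s] makes right estimates yield left ones. *)
Lemma approximate_unit (s : seq A) (d : R) : 0 < d -> exists e,
  self_adjoint e /\ forall x, x \in s -> rnorm (x - x ** e) <= d /\ rnorm (x - e ** x) <= d.
Proof.
move=> d0.
have [e [er el es]] : exists e, [/\ forall y, rnorm (y - y ** e) <= rnorm y,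
    forall y, rnorm (y - e ** y) <= rnorm y &
    forall x, x \in s ++ map star s -> rnorm (x - x ** e) <= d].
  elim: (s ++ _) => [|x s' [e [er el es]]].
    by exists 0; split=> // y; rewrite ?nmul0r ?nmulr0 subr0.
  have [k [r /= [f_sa fr fl fx]]] := right_unit (x - x ** e) d0.
  (* Formally 1 - (e + f - e f) = (1 - e)(1 - f), and f was chosen as a unit for x (1 - e). *)
  move: (pact _ _ _) f_sa fr fl fx => f f_sa fr fl fx; exists (e + f - e ** f).
  have E y : y - y ** (e + f - e ** f) = (y - y ** e) - (y - y ** e) ** f by nring.
  split=> [y|y|y].
  - by rewrite E (le_trans (fr _)).
  - have -> : y - (e + f - e ** f) ** y = (y - f ** y) - e ** (y - f ** y) by nring.
    by rewrite (le_trans (el _)).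
  - by rewrite in_cons E => /orP[/eqP->//|/es]; exact: le_trans.
(* Self-adjointness is restored by replacing 1 - e with (1 - e)(1 - [star e]). *)
have e_sa : self_adjoint (e + star e - e ** star e).
  by rewrite /self_adjoint /= starB starD starM !starK [star e + e]addrC.
exists (e + star e - e ** star e); split=> //.
have H x : x \in s ++ map star s -> rnorm (x - x ** (e + star e - e ** star e)) <= d.
  have -> : x - x ** (e + star e - e ** star e) = (x - x ** e) - (x - x ** e) ** star e by nring.
  move=> /es; apply: le_trans.
  by rewrite -rnorm_star starB starM starK -[leRHS]rnorm_star el.
move=> x xs; split; first by rewrite H// mem_cat xs.
rewrite -rnorm_star starB starM e_sa H// mem_cat map_f ?orbT//.
Qed.

End ApproximateUnits.

Section ApproximateUnitLimits.
Variables (R : realType) (A B : cstarAlgType R).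
Implicit Types (f g : A -> B) (l b : B) (e : A).

Definition near_unit (s : seq A) (d : R) e := self_adjoint e /\
  forall x, x \in s -> rnorm (x - x ** e) <= d /\ rnorm (x - e ** x) <= d.

(* Convergence of [f e] as the self-adjoint element [e] runs through approximate units. *)
Definition aulim f l := forall d : R, 0 < d -> exists s r, 0 < r /\
  forall e, near_unit s r e -> rnorm (f e - l) <= d.

Lemma aulim_eq f g l : (forall e, self_adjoint e -> f e = g e) -> aulim f l -> aulim g l.
Proof.
move=> fg fl d /fl[s [r [r0 H]]]; exists s, r; split=> // e [es ex].
by rewrite -fg//; apply: H.
Qed.

Lemma aulimD f g l k : aulim f l -> aulim g k -> aulim (fun e => f e + g e) (l + k).
Proof.
move=> fl gk d d0; have d2 : 0 < d / 2 by rewrite divr_gt0.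
have [s [r [r0 H]]] := fl _ d2; have [s' [r' [r0' H']]] := gk _ d2.
exists (s ++ s'), (Num.min r r'); split; first by rewrite lt_min r0.
move=> e [es ex]; rewrite opprD addrACA [d]splitr; apply: le_trans (rnormD _ _) _.
apply: lerD; [apply: H|apply: H']; split=> // x xs; have [|h1 h2] := ex x.
- by rewrite mem_cat xs.
- by move: h1 h2; rewrite !le_min => /andP[-> _] /andP[-> _].
- by rewrite mem_cat xs orbT.
- by move: h1 h2; rewrite !le_min => /andP[_ ->] /andP[_ ->].
Qed.

Lemma aulim_le f g l k (K : R) : (forall e, rnorm (g e - k) <= K * rnorm (f e - l)) ->
  aulim f l -> aulim g k.
Proof.
move=> fg fl d d0; have K1 : 0 < `|K| + 1 by rewrite ltr_wpDl.
have [|s [r [r0 H]]] := fl (d / (`|K| + 1)); first by rewrite divr_gt0.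
exists s, r; split=> // e /H H'; apply: le_trans (fg e) _.
rewrite -(divfK (lt0r_neq0 K1) d).
apply: (@le_trans _ _ ((`|K| + 1) * rnorm (f e - l))).
  by rewrite ler_wpM2r ?rnorm_ge0// (le_trans (ler_norm K))// lerDl.
by rewrite mulrC ler_wpM2r// ltW.
Qed.

Lemma aulimMl b f l : aulim f l -> aulim (fun e => b ** f e) (b ** l).
Proof. by apply: (@aulim_le _ _ _ _ (rnorm b)) => e; rewrite -nmulBr rnormM. Qed.

Lemma aulimMr b f l : aulim f l -> aulim (fun e => f e ** b) (l ** b).
Proof. by apply: (@aulim_le _ _ _ _ (rnorm b)) => e; rewrite -nmulBl mulrC rnormM. Qed.

Lemma aulimZ (c : R[i]) f l : aulim f l -> aulim (fun e => c *: f e) (c *: l).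
Proof.
by apply: (@aulim_le _ _ _ _ (complex.Re `|c|)) => e; rewrite -scalerBr rnormZ.
Qed.

Lemma aulimB f g l k : aulim f l -> aulim g k -> aulim (fun e => f e - g e) (l - k).
Proof.
move=> fl /(aulimZ (-1)) gk; rewrite -scaleN1r.
by apply: aulim_eq (aulimD fl gk) => e _; rewrite scaleN1r.
Qed.

(** Near units exist for every finite list and tolerance, so the limit is taken along a proper
    filter. *)
Lemma aulim_uniq f l k : aulim f l -> aulim f k -> l = k.
Proof.
move=> fl fk; have H := aulimB fl fk; apply/esym/eqP.
rewrite -subr_eq0; apply/eqP/rnorm_le0 => d d0.
have [s [r [r0 {}H]]] := H _ d0; have [e [es ex]] := approximate_unit s r0.
by have := H e (conj es ex); rewrite subrr sub0r opprB.
Qed.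

End ApproximateUnitLimits.

(** The five-point formula 12 p'(0) = 8 p(1) - 8 p(-1) - p(2) + p(-2) is exact up to degree 4. The
    parameter is real so that a + t e stays self-adjoint. *)
Lemma linear_coef_eq0 (R : rcfType) (V : lmodType R[i]) (c0 c1 c2 c3 c4 : V) :
  (forall t : R[i], t \is Num.real ->
    c0 + t *: c1 + t ^+ 2 *: c2 + t ^+ 3 *: c3 + t ^+ 4 *: c4 = 0) -> c1 = 0.
Proof.
move=> H; pose f (x0 x1 x2 x3 x4 : R[i]) :=
  x0 *: c0 + x1 *: c1 + x2 *: c2 + x3 *: c3 + x4 *: c4.
have fD (k x0 x1 x2 x3 x4 y0 y1 y2 y3 y4 : R[i]) :
    f (k * x0 + y0) (k * x1 + y1) (k * x2 + y2) (k * x3 + y3) (k * x4 + y4) =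
    k *: f x0 x1 x2 x3 x4 + f y0 y1 y2 y3 y4.
  rewrite /f !scalerDl !scalerDr !scalerA.
  by do 3?[rewrite [RHS]addrACA; congr (_ + _)]; rewrite [RHS]addrACA.
have f0 t : t \is Num.real -> f 1 t (t ^+ 2) (t ^+ 3) (t ^+ 4) = 0.
  by move=> /H; rewrite /f scale1r.
have : f 0 12 0 0 0 = 0.
  have -> : f 0 12 0 0 0 = 8 *: f 1 1 (1 ^+ 2) (1 ^+ 3) (1 ^+ 4) +
    ((-8) *: f 1 (-1) ((-1) ^+ 2) ((-1) ^+ 3) ((-1) ^+ 4) +
    ((-1) *: f 1 2 (2 ^+ 2) (2 ^+ 3) (2 ^+ 4) +
    f 1 (-2) ((-2) ^+ 2) ((-2) ^+ 3) ((-2) ^+ 4))).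
    by rewrite -!fD; congr f; ring.
  by rewrite !f0 ?realE ?ler01 ?ler0n ?oppr_le0 ?ler01 ?ler0n ?orbT// !scaler0 !addr0.
rewrite /f !scale0r !addr0 add0r => /eqP; rewrite scaler_eq0 pnatr_eq0 /= => /eqP //.
Qed.

(** * Linearization, the centralizer and the Jordan factor *)

Section JordanFromZeroProducts.
Variables (R : realType) (A B : cstarAlgType R) (theta : {linear A -> B}).
Hypotheses (theta_bnd : bounded_op theta) (theta_zpp : zero_product_preserving_sa theta)
  (theta_surj : forall b, exists a, theta a = b).
Implicit Types (a e x y : A) (b : B).

Let aulim_theta (f : A -> A) x : aulim f x -> aulim (fun e => theta (f e)) (theta x).
Proof.
have [K KP] := bounded_op_rnorm theta_bnd => fx d d0.
have K1 : 0 < `|K| + 1 by rewrite ltr_wpDl.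
have [|s [r [r0 H]]] := fx (d / (`|K| + 1)); first by rewrite divr_gt0.
exists s, r; split=> // e /H; rewrite ler_pdivlMr// => fd.
rewrite -linearB (le_trans (KP _))// (le_trans _ fd)// mulrC ler_wpM2l ?rnorm_ge0//.
by rewrite (le_trans (ler_norm K))// lerDl.
Qed.

Let aulim_unitr x : aulim (fun e => x ** e) x.
Proof.
move=> d d0; exists [:: x], d; split=> // e [_ /(_ x)]; rewrite inE eqxx => /(_ isT)[+ _].
by rewrite rnorm_distC.
Qed.

Let aulim_unitl x : aulim (fun e => e ** x) x.
Proof.
move=> d d0; exists [:: x], d; split=> // e [_ /(_ x)]; rewrite inE eqxx => /(_ isT)[_ +].
by rewrite rnorm_distC.
Qed.

Section Linearization.
Variables (a e : A).
Hypotheses (a_sa : self_adjoint a) (e_sa : self_adjoint e).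
(** [m1] and [m2] are the coefficients of t and t^2 in (a + t e)^3, and [n1] is that of t in (a + t
    e)^2. *)
Let m1 := a ** a ** e + a ** e ** a + e ** a ** a.
Let m2 := a ** e ** e + e ** a ** e + e ** e ** a.
Let n1 := a ** e + e ** a.

Let sa_t (t : R[i]) : t \is Num.real -> self_adjoint (a + t *: e).
Proof.
move=> tr; apply: self_adjointD => //.
by rewrite /self_adjoint /= starZ conj_Creal// e_sa.
Qed.

Let npow1 t : npow (a + t *: e) 1 = a ** a + t *: n1 + t ^+ 2 *: (e ** e).
Proof.
have -> : npow (a + t *: e) 1 = a ** a + (a ** (t *: e) + t *: e ** a) + t *: e ** (t *: e).
  by rewrite /npow /= /rmul; nring.
by rewrite -!nscaleAr -!nscaleAl -scalerDr scalerA -expr2.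
Qed.

Let npow2 t : npow (a + t *: e) 2 =
  a ** a ** a + t *: m1 + t ^+ 2 *: m2 + t ^+ 3 *: (e ** e ** e).
Proof.
pose u := t *: e.
have -> : npow (a + t *: e) 2 = a ** a ** a + (a ** a ** u + a ** u ** a + u ** a ** a)
    + (a ** u ** u + u ** a ** u + u ** u ** a) + u ** u ** u.
  by rewrite /npow /= /rmul -/u; nring.
rewrite /u -!(nscaleAr, nscaleAl) -!scalerDr !scalerA.
by have -> : t * t * t = t ^+ 3 by ring.
Qed.

Let theta3 (t : R[i]) x y z w : theta (x + t *: y + t ^+ 2 *: z + t ^+ 3 *: w) =
  theta x + t *: theta y + t ^+ 2 *: theta z + t ^+ 3 *: theta w.
Proof. by rewrite !linearD !linearZ. Qed.

Let theta2 (t : R[i]) x y z : theta (x + t *: y + t ^+ 2 *: z) =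
  theta x + t *: theta y + t ^+ 2 *: theta z.
Proof. by rewrite !linearD !linearZ. Qed.

Let theta1 (t : R[i]) x y : theta (x + t *: y) = theta x + t *: theta y.
Proof. by rewrite linearD linearZ. Qed.

(** The coefficient of t in the relation that theta(h^3) and theta(h) commute, at h = a + t e. *)
Lemma zpp_linear1 : theta (a ** a ** a) ** theta e + theta m1 ** theta a =
  theta e ** theta (a ** a ** a) + theta a ** theta m1.
Proof.
apply/eqP; rewrite -subr_eq0; apply/eqP.
set A3 := theta (a ** a ** a); set M1 := theta m1; set A1 := theta a; set E1 := theta e.
pose M2 := theta m2; pose E3 := theta (e ** e ** e).
apply: (@linear_coef_eq0 _ _ (A3 ** A1 - A1 ** A3) _ (M1 ** E1 + M2 ** A1 - (E1 ** M1 + A1 ** M2))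
  (M2 ** E1 + E3 ** A1 - (E1 ** M2 + A1 ** E3)) (E3 ** E1 - E1 ** E3)) => t tr.
have : theta (npow (a + t *: e) 2) ** theta (npow (a + t *: e) 0) -
    theta (npow (a + t *: e) 0) ** theta (npow (a + t *: e) 2) = 0.
  by rewrite (zpp_npow theta_bnd theta_zpp 1 0 (sa_t tr))
    (zpp_npow theta_bnd theta_zpp 0 1 (sa_t tr)) subrr.
rewrite npow2 -[npow _ 0]/(a + t *: e) theta3 theta1 -/A3 -/M1 -/M2 -/E3 -/A1 -/E1.
move=> H; rewrite -[RHS]H.
pose U := t *: E1; pose X1 := t *: M1; pose X2 := t ^+ 2 *: M2; pose X3 := t ^+ 3 *: E3.
rewrite -/U -/X1 -/X2 -/X3.
have -> : t *: (A3 ** E1 + M1 ** A1 - (E1 ** A3 + A1 ** M1)) =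
    A3 ** U + X1 ** A1 - (U ** A3 + A1 ** X1).
  by rewrite /U /X1 -!nscaleAr -!nscaleAl -!scalerDr -scalerBr.
have -> : t ^+ 2 *: (M1 ** E1 + M2 ** A1 - (E1 ** M1 + A1 ** M2)) =
    X1 ** U + X2 ** A1 - (U ** X1 + A1 ** X2).
  by rewrite /U /X1 /X2 -!nscaleAr -!nscaleAl !scalerA -expr2 -!scalerDr -scalerBr.
have -> : t ^+ 3 *: (M2 ** E1 + E3 ** A1 - (E1 ** M2 + A1 ** E3)) =
    X2 ** U + X3 ** A1 - (U ** X2 + A1 ** X3).
  by rewrite /U /X2 /X3 -!nscaleAr -!nscaleAl !scalerA -exprS -exprSr -!scalerDr -scalerBr.
have -> : t ^+ 4 *: (E3 ** E1 - E1 ** E3) = X3 ** U - U ** X3.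
  by rewrite /U /X3 -!nscaleAr -!nscaleAl !scalerA -exprS -exprSr -scalerBr.
by nring.
Qed.

(** The coefficient of t in theta(h^3) theta(h) = theta(h^2)^2, at h = a + t e. *)
Lemma zpp_linear2 : theta (a ** a ** a) ** theta e + theta m1 ** theta a =
  theta (a ** a) ** theta n1 + theta n1 ** theta (a ** a).
Proof.
apply/eqP; rewrite -subr_eq0; apply/eqP.
set A3 := theta (a ** a ** a); set M1 := theta m1; set A1 := theta a; set E1 := theta e.
pose M2 := theta m2; pose E3 := theta (e ** e ** e).
set A2 := theta (a ** a); set N1 := theta n1; pose E2 := theta (e ** e).
apply: (@linear_coef_eq0 _ _ (A3 ** A1 - A2 ** A2) _
  (M1 ** E1 + M2 ** A1 - (A2 ** E2 + E2 ** A2 + N1 ** N1))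
  (M2 ** E1 + E3 ** A1 - (N1 ** E2 + E2 ** N1)) (E3 ** E1 - E2 ** E2)) => t tr.
have : theta (npow (a + t *: e) 2) ** theta (npow (a + t *: e) 0) -
    theta (npow (a + t *: e) 1) ** theta (npow (a + t *: e) 1) = 0.
  by rewrite (zpp_npow theta_bnd theta_zpp 1 0 (sa_t tr)) subrr.
rewrite npow2 npow1 -[npow _ 0]/(a + t *: e) theta3 theta2 theta1.
rewrite -/A3 -/M1 -/M2 -/E3 -/A1 -/E1 -/A2 -/N1 -/E2.
move=> H; rewrite -[RHS]H.
pose U := t *: E1; pose X1 := t *: M1; pose X2 := t ^+ 2 *: M2; pose X3 := t ^+ 3 *: E3.
pose Y1 := t *: N1; pose Y2 := t ^+ 2 *: E2.
rewrite -/U -/X1 -/X2 -/X3 -/Y1 -/Y2.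
have -> : t *: (A3 ** E1 + M1 ** A1 - (A2 ** N1 + N1 ** A2)) =
    A3 ** U + X1 ** A1 - (A2 ** Y1 + Y1 ** A2).
  by rewrite /U /X1 /Y1 -!nscaleAr -!nscaleAl -!scalerDr -scalerBr.
have -> : t ^+ 2 *: (M1 ** E1 + M2 ** A1 - (A2 ** E2 + E2 ** A2 + N1 ** N1)) =
    X1 ** U + X2 ** A1 - (A2 ** Y2 + Y2 ** A2 + Y1 ** Y1).
  by rewrite /U /X1 /X2 /Y1 /Y2 -!nscaleAr -!nscaleAl !scalerA -expr2 -!scalerDr -scalerBr.
have -> : t ^+ 3 *: (M2 ** E1 + E3 ** A1 - (N1 ** E2 + E2 ** N1)) =
    X2 ** U + X3 ** A1 - (Y1 ** Y2 + Y2 ** Y1).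
  by rewrite /U /X2 /X3 /Y1 /Y2 -!nscaleAr -!nscaleAl !scalerA -exprS -exprSr -!scalerDr -scalerBr.
have -> : t ^+ 4 *: (E3 ** E1 - E2 ** E2) = X3 ** U - Y2 ** Y2.
  by rewrite /U /X3 /Y2 -!nscaleAr -!nscaleAl !scalerA -exprS -exprD -scalerBr.
by nring.
Qed.

End Linearization.

Let theta_npow a : self_adjoint a ->
  [/\ theta (a ** a) ** theta a = theta a ** theta (a ** a),
      theta (a ** a ** a) ** theta a = theta (a ** a) ** theta (a ** a) &
      theta a ** theta (a ** a ** a) = theta (a ** a) ** theta (a ** a)].
Proof.
move=> aa; have H := zpp_npow theta_bnd theta_zpp _ _ aa.
by split; [exact: (H 0%N 0%N)|exact: (H 1%N 0%N)|exact/esym/(H 0%N 1%N)].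
Qed.

Let aulim_m1 a : aulim (fun e => theta (a ** a ** e + a ** e ** a + e ** a ** a))
  (theta (a ** a) + theta (a ** a) + theta (a ** a)).
Proof.
rewrite -!linearD; apply: aulim_theta; apply: aulimD; first apply: aulimD.
- exact: aulim_unitr.
- exact/aulimMr/aulim_unitr.
- by apply: aulim_eq (aulim_unitl (a ** a)) => e _; rewrite nmulA.
Qed.

Let aulim_n1 a : aulim (fun e => theta (a ** e + e ** a)) (theta a + theta a).
Proof.
rewrite -!linearD; apply: aulim_theta; apply: aulimD; [exact: aulim_unitr|exact: aulim_unitl].
Qed.

(** As e tends to 1, [m1] tends to 3 a^2 and [n1] to 2 a, so [zpp_linear2] leaves 4 - 3 = 1 copy of
    theta(a^2) theta(a), these two images commuting. *)
Let aulim_cube_right a : self_adjoint a ->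
  aulim (fun e => theta (a ** a ** a) ** theta e) (theta (a ** a) ** theta a).
Proof.
move=> aa; have [c21 _ _] := theta_npow aa.
have := aulimB (aulimD (aulimMl (theta (a ** a)) (aulim_n1 a))
  (aulimMr (theta (a ** a)) (aulim_n1 a))) (aulimMr (theta a) (aulim_m1 a)).
have -> : theta (a ** a) ** (theta a + theta a) + (theta a + theta a) ** theta (a ** a) -
  (theta (a ** a) + theta (a ** a) + theta (a ** a)) ** theta a = theta (a ** a) ** theta a.
  by rewrite nmulDl -c21; nring.
by apply: aulim_eq => e ee; rewrite -zpp_linear2// addrK.
Qed.

(** [zpp_linear1] expresses the left product by the right one; the [m1] terms cancel in the limit,
    so both limits agree. *)
Let aulim_cube_left a : self_adjoint a ->
  aulim (fun e => theta e ** theta (a ** a ** a)) (theta (a ** a) ** theta a).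
Proof.
move=> aa; have [c21 _ _] := theta_npow aa.
have := aulimB (aulimD (aulim_cube_right aa) (aulimMr (theta a) (aulim_m1 a)))
  (aulimMl (theta a) (aulim_m1 a)).
have -> : theta (a ** a) ** theta a +
  (theta (a ** a) + theta (a ** a) + theta (a ** a)) ** theta a -
  theta a ** (theta (a ** a) + theta (a ** a) + theta (a ** a)) = theta (a ** a) ** theta a.
  by rewrite !nmulDr -c21; nring.
by apply: aulim_eq => e ee; rewrite zpp_linear1// addrK.
Qed.

Let is_L b l := aulim (fun e => b ** theta e) l /\ aulim (fun e => theta e ** b) l.

(** b is the image of c^3 + i d^3 with c and d self-adjoint, and both one-sided limits are known for
    cubes. *)
Let L_exists b : exists l, is_L b l.
Proof.
have [x <-] := theta_surj b; have [u [v [us vs ->]]] := cartesian_decomposition x.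
have [c cs <-] := cube_root us; have [d ds <-] := cube_root vs.
exists (theta (c ** c) ** theta c + 'i *: (theta (d ** d) ** theta d)); split.
  have := aulimD (aulim_cube_right cs) (aulimZ 'i (aulim_cube_right ds)).
  by apply: aulim_eq => e _; rewrite linearD linearZ nmulDl -nscaleAl.
have := aulimD (aulim_cube_left cs) (aulimZ 'i (aulim_cube_left ds)).
by apply: aulim_eq => e _; rewrite linearD linearZ nmulDr -nscaleAr.
Qed.

(* [L b] is the limit of [b theta(e)] along the approximate units [e]. *)
Lemma zpp_centralizer : exists L : B -> B,
  [/\ linear L, forall b c, L (b ** c) = b ** L c, forall b c, L (b ** c) = L b ** c &
      forall a, self_adjoint a -> L (theta (a ** a ** a)) = theta (a ** a) ** theta a].
Proof.
have [L LP] := choice L_exists; exists L; split.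
- move=> k x y; have [H _] := LP (k *: x + y); have [Hx _] := LP x; have [Hy _] := LP y.
  apply: aulim_uniq H _; apply: aulim_eq (aulimD (aulimZ k Hx) Hy) => e _.
  by rewrite nmulDl nscaleAl.
- move=> x y; have [H _] := LP (x ** y); have [Hy _] := LP y.
  by apply: aulim_uniq H _; apply: aulim_eq (aulimMl x Hy) => e _; rewrite nmulA.
- move=> x y; have [_ H] := LP (x ** y); have [_ Hx] := LP x.
  by apply: aulim_uniq H _; apply: aulim_eq (aulimMr y Hx) => e _; rewrite nmulA.
- move=> a aa; have [H _] := LP (theta (a ** a ** a)).
  exact: aulim_uniq H (aulim_cube_right aa).
Qed.

End JordanFromZeroProducts.

Lemma linear_map_of (K : pzRingType) (U V : lmodType K) (f : U -> V) : linear f ->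
  exists g : {linear U -> V}, forall x, g x = f x.
Proof.
move=> fl; pose g : {linear U -> V} := HB.pack f (GRing.isLinear.Build K U V *:%R f fl).
by exists g.
Qed.

Lemma jordan_product_linear (K : pzRingType) (A : nonUnitalAlgType K) (k : K) (u v y : A) :
  (k *: u + v) ** y + y ** (k *: u + v) = k *: (u ** y + y ** u) + (v ** y + y ** v).
Proof. by rewrite nmulDl nmulDr -nscaleAl -nscaleAr addrACA -scalerDr. Qed.

Section JordanFactor.
Variables (R : realType) (A B : cstarAlgType R) (theta : {linear A -> B}).
Hypotheses (theta_bnd : bounded_op theta) (theta_zpp : zero_product_preserving_sa theta)
  (theta_surj : forall b, exists a, theta a = b).

Theorem zpp_jordan_factor : exists J : {linear A -> B},
  [/\ jordan_hom J, forall b, exists a, J a = b & forall x, J x = 0 <-> theta x = 0].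
Proof.
have [L0 [L0l Ll Lr L3]] := zpp_centralizer theta_bnd theta_zpp theta_surj.
have [L LE] := linear_map_of L0l.
have {L0 L0l LE Ll Lr L3} [Ll Lr L3] : [/\ forall x y : B, L (x ** y) = x ** L y,
    forall x y : B, L (x ** y) = L x ** y &
    forall a, self_adjoint a -> L (theta (a ** a ** a)) = theta (a ** a) ** theta a].
  by split=> *; rewrite !LE; [exact: Ll|exact: Lr|exact: L3].
(* For a = c^3 the square is the cube of c^2, so L sends its image to theta(c^4) theta(c^2), which
   is theta(c^3)^2 by balance. *)
have L2 a : self_adjoint a -> L (theta (a ** a)) = theta a ** theta a.
  move=> /cube_root[c cs <-]; have cc : self_adjoint (c ** c) by exact: self_adjoint_comm.
  have -> : c ** c ** c ** (c ** c ** c) = c ** c ** (c ** c) ** (c ** c) by nring.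
  rewrite L3//; have H := zpp_npow theta_bnd theta_zpp 2 1 cs.
  have -> : c ** c ** (c ** c) = npow c 3 by rewrite /npow /= /rmul; nring.
  exact: H.
(* Polarization: [G] is symmetric and complex bilinear and vanishes on the diagonal of the
   self-adjoint part, hence everywhere. *)
pose G x y := L (theta (x ** y + y ** x)) - (theta x ** theta y + theta y ** theta x).
have GC x y : G x y = G y x.
  rewrite /G addrC [X in _ - X]addrC addrC.
  by congr (L (theta _) - _); rewrite addrC.
have Gl y : linear (G^~ y).
  move=> k u v; rewrite /G linearP !jordan_product_linear !linearP.
  by rewrite addrACA -scalerDr.
have Gsa a b : self_adjoint a -> self_adjoint b -> G a b = 0.
  move=> aa bb; apply/eqP; rewrite subr_eq0; apply/eqP.
  have E : a ** b + b ** a = (a + b) ** (a + b) - a ** a - b ** b by nring.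
  by rewrite E !linearB !L2//; [rewrite linearD; nring|exact: self_adjointD].
have G0 x y : G x y = 0.
  have [u [v [us vs ->]]] := cartesian_decomposition x.
  have [w [z [ws zs ->]]] := cartesian_decomposition y.
  have H a : self_adjoint a -> G a (w + 'i *: z) = 0.
    by move=> aa; rewrite GC addrC Gl !Gsa// scaler0 addr0.
  by rewrite addrC Gl !H// scaler0 addr0.
have {}G0 x y : L (theta (x ** y + y ** x)) = theta x ** theta y + theta y ** theta x.
  by apply/eqP; rewrite -subr_eq0; apply/eqP; exact: G0.
(* A self-adjoint d = c^3 is half the Jordan product of c^2 and c in [B]; choosing preimages of
   these under theta exhibits d as a value of [L]. *)
have Lsurj b : exists c, L c = b.
  have Lsa d : self_adjoint d -> exists c, L c = d.
    move=> /cube_root[c cs <-].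
    have [x xE] := theta_surj (c ** c); have [y yE] := theta_surj c.
    exists (2^-1 *: theta (x ** y + y ** x)); rewrite linearZ G0 xE yE -nmulA.
    by rewrite /= -mulr2n -scalerMnr scalerMnl -mulr_natr mulVf ?scale1r// pnatr_eq0.
  have [u [v [us vs ->]]] := cartesian_decomposition b.
  have [c <-] := Lsa _ us; have [d <-] := Lsa _ vs.
  by exists (c + 'i *: d); rewrite linearD linearZ.
(* Writing [star b] as L c gives b [star b] = b L(c) = L(b) c = 0. *)
have Linj b : L b = 0 -> b = 0.
  move=> Lb; have [c cE] := Lsurj (star b).
  have : b ** star b = 0 by rewrite -cE -Ll Lr Lb nmul0r.
  by rewrite -{1}(starK b) => /nmul_eq0_star b0; rewrite -(starK b) b0 star0.
have [J0 J0E] := choice (fun x => Lsurj (theta x)).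
have Leq b c : L b = L c -> b = c.
  by move=> bc; apply/eqP; rewrite -subr_eq0; apply/eqP/Linj; rewrite linearB bc subrr.
have [|J JE] := @linear_map_of _ A B J0.
  by move=> k x y; apply: Leq; rewrite linearP !J0E linearP.
have LJ x : L (J x) = theta x by rewrite JE.
exists J; split=> [x y|b|x].
(* After two applications of the injective [L], the centralizer rule L(L(u v)) = L(u) L(v) turns
   both sides into theta(x) theta(y) + theta(y) theta(x). *)
- apply/Leq/Leq; rewrite LJ G0 -!LJ !linearD.
  have E u v : L (L (u ** v)) = L u ** L v by rewrite Ll Lr.
  by rewrite !E.
- by have [x xE] := theta_surj (L b); exists x; apply: Leq; rewrite LJ.
- split=> [Jx|tx]; first by rewrite -LJ Jx linear0.
  by apply: Linj; rewrite LJ.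
Qed.

End JordanFactor.

(** * Closed Jordan ideals and quotients *)

Section ClosedJordanIdeals.
Variables (R : realType) (A : cstarAlgType R).
Implicit Types (K I : set A) (a b x y z : A).

(** The approximant is x e with e = h^2 r(h) and h a multiple of [star x] x. It arises from x h^2 by
    right multiplications and sums, so it lies in [I] as soon as x h^2 does. *)
Lemma right_unit_in I x (d : R) : 0 < d -> I 0 -> (forall x y, I x -> I y -> I (x + y)) ->
  (forall (k : R[i]) x, I x -> I (k *: x)) -> (forall a x, I x -> I (x ** a)) ->
  I (x ** (star x ** x) ** (star x ** x)) -> exists2 y, I y & rnorm (x - y) <= d.
Proof.
move=> d0 I0 ID IZ IM Ix; have [k [r /= [_ _ _ xe]]] := right_unit x d0.
exists (x ** pact (k%:C *: (star x ** x)) r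
  (k%:C *: (star x ** x) ** (k%:C *: (star x ** x)))) => //.
rewrite nmul_pact nmulA -!nscaleAr -!nscaleAl; set h := k%:C *: _.
have : I (k%:C *: (k%:C *: (x ** (star x ** x) ** (star x ** x)))) by apply/IZ/IZ.
elim/poly_ind: r (k%:C *: _) {xe} => [|r c IH] z Iz; first by rewrite pact0.
by rewrite pactD pact_mulX pactC; apply: ID; [exact/IM/IH|exact: IZ].
Qed.

Section JordanIdeal.
Variable K : set A.
Hypotheses (K0 : K 0) (KD : forall x y, K x -> K y -> K (x + y))
  (KZ : forall (k : R[i]) x, K x -> K (k *: x))
  (KJ : forall x a, K x -> K (x ** a + a ** x)) (Kc : closed K).

Let KB x y : K x -> K y -> K (x - y).
Proof. by move=> Kx Ky; apply: KD => //; rewrite -scaleN1r; exact: KZ. Qed.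

Let K2 x : K (x + x) -> K x.
Proof.
move=> /(KZ 2^-1); rewrite -mulr2n -scalerMnr scalerMnl -mulr_natr mulVf ?scale1r//.
Qed.

(** An associative ideal hidden in [K]; the aim is to show that it is all of [K]. *)
Let I x := [/\ K x, forall a, K (x ** a) & forall a, K (a ** x)].

(** x a x is a combination of iterated Jordan products with x, so it lies in [K]; x^2 a and a x^2
    differ from Jordan products with x only by x a x. *)
Let I_sqr x : K x -> I (x ** x).
Proof.
move=> Kx; have Kxx : K (x ** x) by apply/K2/KJ.
have Kxax a : K (x ** a ** x).
  apply: K2; have -> : x ** a ** x + x ** a ** x = (x ** (x ** a) + x ** a ** x) +
    (x ** (a ** x) + a ** x ** x) - (x ** x ** a + a ** (x ** x)) by nring.
  by apply: KB; [apply: KD; exact: KJ|exact: KJ].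
split=> // a.
- have -> : x ** x ** a = x ** (x ** a) + x ** a ** x - x ** a ** x by nring.
  by apply: KB => //; exact: KJ.
- have -> : a ** (x ** x) = x ** (a ** x) + a ** x ** x - x ** a ** x by nring.
  by apply: KB => //; exact: KJ.
Qed.

Let I0 : I 0.
Proof. by split=> // a; rewrite ?nmul0r ?nmulr0. Qed.

Let ID x y : I x -> I y -> I (x + y).
Proof.
move=> [x1 x2 x3] [y1 y2 y3]; split=> [|a|a]; rewrite ?nmulDl ?nmulDr; exact: KD.
Qed.

Let IZ (k : R[i]) x : I x -> I (k *: x).
Proof.
by move=> [x1 x2 x3]; split=> [|a|a]; rewrite -?nscaleAl -?nscaleAr; exact: KZ.
Qed.

Let IB x y : I x -> I y -> I (x - y).
Proof. by move=> Ix Iy; apply: ID => //; rewrite -scaleN1r; exact: IZ. Qed.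

Let K_aza x a b : I x -> K (a ** x ** b).
Proof.
move=> [x1 x2 x3]; have -> : a ** x ** b = a ** x ** b + b ** (a ** x) - b ** a ** x by nring.
by apply: KB => //; exact: KJ.
Qed.

Let IMr a x : I x -> I (x ** a).
Proof.
move=> Ix; have [x1 x2 x3] := Ix; split=> // b; first by rewrite -nmulA.
by rewrite nmulA; exact: K_aza.
Qed.

Let IMl a x : I x -> I (a ** x).
Proof.
move=> Ix; have [x1 x2 x3] := Ix; split=> // b; last by rewrite nmulA.
exact: K_aza.
Qed.

Let I_closed : closed I.
Proof.
apply: closed_rnorm => x H.
have clos (f : A -> A) (c : R) : 0 < c -> (forall y, I y -> K (f y)) ->
    (forall y, rnorm (f x - f y) <= c * rnorm (x - y)) -> K (f x).
  move=> c0 fK fc; apply: (closed_rnormP Kc) => e e0.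
  have [|y Iy xy] := H (e / c); first by rewrite divr_gt0.
  exists (f y); first exact: fK.
  by apply: le_trans (fc y) _; rewrite mulrC -ler_pdivlMr.
have a1 a : 0 < rnorm a + 1 by rewrite ltr_wpDl// rnorm_ge0.
split=> [|a|a].
- by apply: (clos id 1) => // y; [case|rewrite mul1r].
- apply: (clos (fun x => x ** a) (rnorm a + 1)) => // [y [] //|y].
  rewrite -nmulBl (le_trans (rnormM _ _))// mulrC ler_wpM2r ?rnorm_ge0// lerDl//.
- apply: (clos (fun x => a ** x) (rnorm a + 1)) => // [y [] //|y].
  rewrite -nmulBr (le_trans (rnormM _ _))// ler_wpM2r ?rnorm_ge0// lerDl//.
Qed.

(* Modulo [I], the square of [x o a] vanishes along with that of [x], hence so does
   [x a x a x]; take [a = x^*]. *)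
Let K_sub_I x : K x -> I x.
Proof.
move=> Kx; have Ixx := I_sqr Kx.
have Ixaxax a : I (x ** a ** x ** a ** x).
  have Iy := IMr x (I_sqr (KJ a Kx)).
  have -> : x ** a ** x ** a ** x = (x ** a + a ** x) ** (x ** a + a ** x) ** x -
    (x ** a ** a) ** (x ** x) - a ** ((x ** x) ** (a ** x)) - (a ** x ** a) ** (x ** x) by nring.
  by apply/IB/IMl/Ixx; apply/IB; [apply/IB/IMl/Ixx|apply/IMl/IMr/Ixx].
apply: (closed_rnormP I_closed) => d d0; apply: right_unit_in => //.
have -> : x ** (star x ** x) ** (star x ** x) = x ** star x ** x ** star x ** x by nring.
exact: Ixaxax.
Qed.

(** For the involution, [star x] is approximated by e [star x], where the unit e for x is built from
    [star x] x and so belongs to the two-sided ideal [K]. *)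
Theorem closed_jordan_ideal : exists J : closedIdeal A, ideal_set J = K.
Proof.
have KMl a x : K x -> K (a ** x) by move=> /K_sub_I[].
have KMr a x : K x -> K (x ** a) by move=> /K_sub_I[].
suff Ks x : K x -> K (star x) by exists (ClosedIdeal K0 KD KZ KMl KMr Ks Kc).
move=> Kx; apply: (closed_rnormP Kc) => d d0.
have [k [r /= [e_sa _ _ xe]]] := right_unit x d0.
exists (pact (k%:C *: (star x ** x)) r
  (k%:C *: (star x ** x) ** (k%:C *: (star x ** x))) ** star x).
  apply/KMr; have : K (k%:C *: (star x ** x) ** (k%:C *: (star x ** x))).
    by apply/KMr/KZ/KMl.
  move: (_ ** (_ *: _)) => z; elim/poly_ind: r {e_sa xe} => [|r c IH] Kz; first by rewrite pact0.
  by rewrite pactD pact_mulX pactC; apply: KD; [exact/KMr/IH|exact: KZ].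
by rewrite -rnorm_star starB starM !starK e_sa.
Qed.

End JordanIdeal.

Variable I : closedIdeal A.

Lemma quot_rnorm_star (q : quotientAlg I) : quot_rnorm (quot_star q) <= quot_rnorm q.
Proof.
apply: le_quot_rnorm => e e0; have [a <- ae] := quot_rnorm_adh q e0.
exists (star a); first by rewrite proj_star.
by rewrite rnorm_star ltW.
Qed.

(** Let c represent the class of [star x] x and let e in [I] be a unit for i = c - [star x] x. Then
    x - x e represents the class of x, and its squared norm is that of (1 - e)([star x] x)(1 - e),
    at most |c| + |i - i e|. *)
Lemma quot_rnorm_sqr_le x :
  quot_rnorm (Defs.proj I x) ^+ 2 <= quot_rnorm (Defs.proj I (star x ** x)).
Proof.
apply: lb_le_inf; first by have [] := coset_norms_has_inf (Defs.proj I (star x ** x)).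
move=> _ [c /= /projP Ii <-]; set i := c - _ in Ii.
apply/ler_addgt0Pr => d d0; have [k [r /= [e_sa er el ie]]] := right_unit i d0.
set e := pact _ r _ in e_sa er el ie.
have Ie : ideal_set I e.
  rewrite /e; have : ideal_set I (k%:C *: (star i ** i) ** (k%:C *: (star i ** i))).
    by apply/cidealMr/cidealZ/cidealMl.
  move: (_ ** (_ *: _)) => z; elim/poly_ind: r {e e_sa er el ie} => [|r a IH] Kz.
    by rewrite pact0; exact: cideal0.
  by rewrite pactD pact_mulX pactC; apply: cidealD; [exact/cidealMr/IH|exact: cidealZ].
have -> : Defs.proj I x = Defs.proj I (x - x ** e).
  by apply/projP; rewrite opprB addrC subrK; exact: cidealMl.
apply: (@le_trans _ _ (rnorm (x - x ** e) ^+ 2)).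
  by rewrite lerXn2r ?nnegrE ?quot_rnorm_ge0 ?rnorm_ge0 ?quot_rnorm_le.
rewrite -rnorm_starM starB starM e_sa.
pose w := star x ** x.
have -> : (star x - e ** star x) ** (x - x ** e) = (w - w ** e) - e ** (w - w ** e).
  by rewrite /w; nring.
apply: le_trans (el _) _.
have -> : w - w ** e = (c - c ** e) - (i - i ** e) by rewrite /i -/w; nring.
by apply: le_trans (rnormB _ _) _; rewrite lerD.
Qed.

Theorem quotient_cstar_identity : cstar_identity (quotientAlg I).
Proof.
move=> q; apply/eqP; rewrite eq_le; apply/andP; split.
  apply: le_trans (ler_norm_nmul _ _) _; rewrite expr2 ler_wpM2r//.
  by rewrite [leLHS]/(quot_norm _) [leRHS]/(quot_norm _) lecR quot_rnorm_star.
rewrite -(qreprK q) [X in _ <= X](_ : _ = quot_norm (Defs.proj I (star (qrepr q) ** qrepr q))).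
  by rewrite -[`|_|]/(quot_norm _) /quot_norm -rmorphXn /= lecR quot_rnorm_sqr_le.
rewrite -[LHS]/(quot_norm (quot_mul (quot_star _) _)).
by rewrite proj_star proj_mul.
Qed.

End ClosedJordanIdeals.

Section SurjectiveJordanMaps.
Variables (R : realType) (A B : cstarAlgType R) (J : {linear A -> B}).
Hypotheses (J_jordan : jordan_hom J) (J_surj : forall b, exists a, J a = b)
  (J_closed : closed [set a | J a = 0]).

Theorem jordan_quotient : exists I : closedIdeal A,
  [/\ ideal_set I = [set a | J a = 0], cstar_identity (quotientAlg I)
    & jordan_isomorphic B (quotientAlg I)].
Proof.
have [||||I IE] := @closed_jordan_ideal R A [set a | J a = 0] _ _ _ _ J_closed => /=.
- by rewrite linear0.
- by move=> x y; rewrite linearD => -> ->; rewrite addr0.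
- by move=> k x; rewrite linearZ /= => ->; rewrite scaler0.
- by move=> x a Jx; rewrite J_jordan Jx nmul0r nmulr0 addr0.
exists I; split=> //; first exact: quotient_cstar_identity.
have projE x y : J x = J y -> Defs.proj I x = Defs.proj I y.
  by move=> xy; apply/projP; rewrite IE /= linearB xy subrr.
have [s sE] := choice J_surj.
have [|T TE] := @linear_map_of _ B (quotientAlg I) (fun b => Defs.proj I (s b)).
  by move=> k b c; rewrite -projZ -projD; apply: projE; rewrite sE linearP !sE.
exists T; split.
  exists (fun q => J (qrepr q)) => [b|q]; rewrite TE.
    rewrite -[RHS](sE b); apply/eqP; rewrite -subr_eq0 -linearB.
    by have := qrepr_proj I (s b); rewrite IE /= => ->.
  by rewrite -[RHS]qreprK; apply: projE; rewrite sE.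
move=> b c; rewrite !TE.
rewrite [RHS](_ : _ = Defs.proj I (s b ** s c + s c ** s b)); last by rewrite projD -!proj_mul.
by apply: projE; rewrite sE J_jordan !sE.
Qed.

End SurjectiveJordanMaps.

(** * The closed graph theorem *)

Section ClosedGraph.
Variables (R : realType) (A B : cstarAlgType R) (J : {linear A -> B}).

(** The limits of J x as x tends to 0; the graph of [J] is closed exactly when 0 is the only one. *)
Definition separating : set B := [set y | forall e : R, 0 < e ->
  exists x, rnorm x <= e /\ rnorm (J x - y) <= e].

(** Baire's argument. If no set |J z| <= n is dense in a ball, nested balls with |J z| > n on the
    ball of index n + 1 shrink to a point l with |J l| > n for all n. *)
Let baire_step : exists (n : nat) (x : A) (r : R), 0 < r /\ forall y (s : R), 0 < s ->
  rnorm (y - x) <= r -> exists z, rnorm (z - y) <= s /\ rnorm (J z) <= n%:R.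
Proof.
apply: contrapT => H.
have step (np : nat * (A * R)) : exists q : A * R, 0 < np.2.2 ->
    [/\ 0 < q.2, q.2 <= np.2.2 / 2 & forall z, rnorm (z - q.1) <= q.2 ->
      rnorm (z - np.2.1) <= np.2.2 /\ np.1%:R < rnorm (J z)].
  case: np => n [x r] /=; have [r0|] := pselect (0 < r); last by move=> ?; exists (0, 0).
  apply: contrapT => nq; apply: H; exists n, x, (r / 2); rewrite divr_gt0//; split=> // y s s0 yx.
  apply: contrapT => nz; apply: nq; exists (y, Num.min s (r / 2)) => _ /=.
  rewrite lt_min s0 divr_gt0// ge_min lexx orbT; split=> // z.
  rewrite le_min => /andP[zs zr]; split.
    by apply: le_trans (rnorm_dist_triangle y _ _) _; rewrite [r]splitr lerD.
  by rewrite ltNge; apply/negP => Jz; apply: nz; exists z.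
have [f fP] := choice step.
pose p := fix p n : A * R := if n is m.+1 then f (m, p m) else (0, 1).
have p0 n : 0 < (p n).2 by elim: n => [|n IH] /=; [exact: ltr01|have [] := fP (n, p n) IH].
have pS n : [/\ (p n.+1).2 <= (p n).2 / 2 & forall z, rnorm (z - (p n.+1).1) <= (p n.+1).2 ->
    rnorm (z - (p n).1) <= (p n).2 /\ n%:R < rnorm (J z)].
  by have [] := fP (n, p n) (p0 n).
have nest n m z : rnorm (z - (p (n + m)%N).1) <= (p (n + m)%N).2 ->
    rnorm (z - (p n).1) <= (p n).2.
  elim: m => [|m IH]; first by rewrite addn0.
  by rewrite addnS => zp; apply: IH; have [_ /(_ z zp)[]] := pS (n + m)%N.
have center n m : rnorm ((p (n + m)%N).1 - (p n).1) <= (p n).2.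
  by apply: (@nest n m); rewrite subrr rnorm0 ltW.
have p2 n : (p n).2 <= 1 * 2^-1 ^+ n.
  elim: n => [|n IH]; first by rewrite mul1r expr0.
  have [h _] := pS n; apply: le_trans h _; rewrite exprSr mulrA ler_wpM2r ?invr_ge0//.
have [|l pl] := @complete_rnorm R A (fun n => (p n).1).
  apply: (@geometric_cauchy _ _ _ 1) => n.
  by apply: le_trans (p2 n); have := center n 1%N; rewrite addn1.
have lp n : rnorm (l - (p n).1) <= (p n).2.
  apply/ler_addgt0Pr => e e0; have [N HN] := pl _ e0.
  apply: le_trans (rnorm_dist_triangle (p (n + N)%N).1 _ _) _.
  by rewrite addrC lerD// rnorm_distC HN// leq_addl.
have Jl n : n%:R < rnorm (J l) by have [_ /(_ l (lp _))[]] := pS n.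
by have := archi_boundP (rnorm_ge0 (J l)); rewrite ltNge ltW.
Qed.

(** x is approximated repeatedly by elements with controlled image, the error halving each time. The
    images sum to some l, and J x - l is separating because it is the limit of the images of the
    errors. *)
Lemma closed_graph : (forall y, separating y -> y = 0) -> bounded_op J.
Proof.
move=> sep0; have [n [x0 [r [r0 H]]]] := baire_step.
(* A vector of norm at most c, scaled by r / c, is a difference of two points of the ball; each is
   approximated by an element with image of norm at most n. *)
pose C : R := 2 * n%:R / r.
have C0 : 0 <= C by rewrite /C divr_ge0 ?mulr_ge0// ltW.
have approx (x : A) (c e : R) : 0 < c -> 0 < e -> rnorm x <= c ->
    exists z, rnorm (x - z) <= e /\ rnorm (J z) <= C * c.
  move=> c0 e0 xc; pose k := r / c; have k0 : 0 < k by rewrite divr_gt0.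
  have e2 : 0 < k * e / 2 by rewrite divr_gt0// mulr_gt0.
  have kx : rnorm (x0 + k%:C *: x - x0) <= r.
    rewrite addrC addKr rnormZr gtr0_norm// mulrC -ler_pdivlMr//.
    rewrite /k invf_div mulrCA mulfV ?lt0r_neq0//.
    by rewrite mulr1.
  have [z1 [z1x Jz1]] := H _ _ e2 kx.
  have [|z2 [z2x Jz2]] := H x0 _ e2; first by rewrite subrr rnorm0 ltW.
  exists (k^-1%:C *: (z1 - z2)); split.
    have -> : x - k^-1%:C *: (z1 - z2) = k^-1%:C *: ((z2 - x0) - (z1 - (x0 + k%:C *: x))).
      have -> : z2 - x0 - (z1 - (x0 + k%:C *: x)) = k%:C *: x - (z1 - z2).
        by set u := k%:C *: x; nring.
      by rewrite [RHS]scalerBr scalerA -rmorphM /= mulVf ?lt0r_neq0// scale1r.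
    rewrite rnormZr gtr0_norm ?invr_gt0// ler_pdivrMl//.
    by apply: le_trans (rnormB _ _) _; rewrite [k * e]splitr lerD.
  rewrite linearZ rnormZr gtr0_norm ?invr_gt0// ler_pdivrMl// linearB.
  have -> : k * (C * c) = n%:R + n%:R by rewrite /k /C; field; rewrite !lt0r_neq0.
  by apply: le_trans (rnormB _ _) _; rewrite lerD.
suff JC x : rnorm x <= 1 -> rnorm (J x) <= C * 2.
  exists (C * 2 * 2) => x; rewrite -!rnormE -real_complexM lecR.
  have [->|x_n0] := eqVneq x 0; first by rewrite linear0 !rnorm0 mulr0.
  rewrite -rnorm_gt0 in x_n0.
  have := JC ((rnorm x)^-1%:C *: x); rewrite rnormZr gtr0_norm ?invr_gt0// mulVf ?lt0r_neq0//.
  move=> /(_ (lexx _)); rewrite linearZ rnormZr gtr0_norm ?invr_gt0// ler_pdivrMl// => h.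
  by apply: le_trans h _; rewrite mulrC ler_wpM2r ?rnorm_ge0//; lra.
move=> x1.
have step (ny : nat * A) : exists z, rnorm ny.2 <= 2^-1 ^+ ny.1 ->
    rnorm (ny.2 - z) <= 2^-1 ^+ ny.1.+1 /\ rnorm (J z) <= C * 2^-1 ^+ ny.1.
  case: ny => m y /=; have [ym|] := pselect (rnorm y <= 2^-1 ^+ m); last by exists 0.
  have [||z zP] := approx y (2^-1 ^+ m) (2^-1 ^+ m.+1) _ _ ym; rewrite ?exprn_gt0 ?invr_gt0//.
  by exists z.
have [f fP] := choice step.
pose y := fix y m : A := if m is k.+1 then y k - f (k, y k) else x.
have yP m : rnorm (y m) <= 2^-1 ^+ m.
  by elim: m => [|m IH]; [rewrite expr0|have [] := fP (m, y m) IH].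
have Jf m : rnorm (J (f (m, y m))) <= C * 2^-1 ^+ m by have [] := fP (m, y m) (yP m).
have JyS m : J (x - y m.+1) - J (x - y m) = J (f (m, y m)).
  rewrite -linearB; congr (J _).
  by have -> : y m.+1 = y m - f (m, y m) by []; set u := f _; set v := y m; nring.
have Jxy m : rnorm (J (x - y m)) <= C * 2 * (1 - 2^-1 ^+ m).
  elim: m => [|m IH]; first by rewrite /= subrr linear0 rnorm0 expr0 subrr mulr0.
  have -> : J (x - y m.+1) = J (f (m, y m)) + J (x - y m) by rewrite -JyS subrK.
  apply: le_trans (rnormD _ _) _; apply: le_trans (lerD (Jf m) IH) _.
  by rewrite exprS le_eqVlt; apply/orP; left; apply/eqP; field.
have [|l Jl] := @complete_rnorm R B (fun m => J (x - y m)).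
  by apply: (@geometric_cauchy _ _ _ C) => m; rewrite JyS.
have lC : rnorm l <= C * 2.
  apply/ler_addgt0Pr => e e0; have [N /(_ N (leqnn N)) HN] := Jl _ e0.
  have := rnorm_dist_triangle (J (x - y N)) l 0; rewrite !subr0 rnorm_distC => /le_trans; apply.
  have w0 : 0 <= 2^-1 ^+ N :> R by rewrite exprn_ge0// invr_ge0.
  have C2 : 0 <= C * 2 by apply: mulr_ge0.
  by have := mulr_ge0 C2 w0; have := Jxy N; move: HN; lra.
suff -> : J x = l by [].
apply/eqP; rewrite -subr_eq0; apply/eqP/sep0 => e e0.
have [N HN] := Jl _ e0.
have [k [kN ke]] : exists k, (N <= k)%N /\ 2^-1 ^+ k <= e.
  pose k := Num.bound e^-1; exists (maxn N k); rewrite leq_maxl; split=> //.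
  rewrite exprVn -[leRHS]invrK lef_pV2 ?posrE ?exprn_gt0 ?invr_gt0//.
  apply: le_trans (ltW (archi_boundP _)) _; first by rewrite invr_ge0 ltW.
  rewrite -/k -natrX ler_nat (leq_trans (leq_maxr N k))// ltnW// ltn_expl//.
exists (y k); split; first exact: le_trans (yP k) ke.
have -> : J (y k) - (J x - l) = - (J (x - y k) - l).
  have -> : J (x - y k) = J x - J (y k) by rewrite linearB.
  by set u := J x; set v := J (y k); rewrite !opprB addrCA addrA.
by rewrite rnormN HN.
Qed.

End ClosedGraph.

(** * Jordan homomorphisms and commutation *)

Section JordanHomomorphisms.
Variables (R : realType) (A B : cstarAlgType R) (J : {linear A -> B}).
Hypothesis J_jordan : jordan_hom J.
Implicit Types (u v w x y : A).

Lemma double_inj (V : lmodType R[i]) : injective (fun x : V => x + x).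
Proof.
move=> x y /= xy; have : 2%:R *: (x - y) = 0.
  by rewrite scalerBr !scaler_nat !mulr2n xy subrr.
by move=> /eqP; rewrite scaler_eq0 pnatr_eq0 /= subr_eq0 => /eqP.
Qed.

Lemma jordan_sqr x : J (x ** x) = J x ** J x.
Proof. by apply: double_inj; rewrite -linearD J_jordan. Qed.

(** 2 x y x is a combination of iterated Jordan products. *)
Lemma jordan_triple x y : J (x ** y ** x) = J x ** J y ** J x.
Proof.
apply: double_inj; rewrite -linearD.
have -> : x ** y ** x + x ** y ** x = (x ** (x ** y + y ** x) + (x ** y + y ** x) ** x) -
  (x ** x ** y + y ** (x ** x)) by nring.
by rewrite linearB !J_jordan jordan_sqr; nring.
Qed.

Hypothesis J_surj : forall b, exists a, J a = b.

(* The commutator of the images is central with square 0, since both [[u, v], w]] and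
   [[u, v]^2] are Jordan polynomials. *)
Lemma jordan_comm u v : u ** v = v ** u -> J u ** J v = J v ** J u.
Proof.
move=> uv; apply/eqP; rewrite -subr_eq0; set c := _ - _.
have cent b : c ** b = b ** c.
  have [w <-] := J_surj b; apply/eqP; rewrite -subr_eq0.
  have : J (u ** (v ** w + w ** v) + (v ** w + w ** v) ** u -
            (v ** (u ** w + w ** u) + (u ** w + w ** u) ** v)) = 0.
    have -> : u ** (v ** w + w ** v) + (v ** w + w ** v) ** u -
      (v ** (u ** w + w ** u) + (u ** w + w ** u) ** v) =
      (u ** v - v ** u) ** w - w ** (u ** v - v ** u) by nring.
    by rewrite uv subrr nmul0r nmulr0 subrr linear0.
  rewrite linearB !J_jordan => H.
  have -> : c ** J w - J w ** c = J u ** (J v ** J w + J w ** J v) +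
    (J v ** J w + J w ** J v) ** J u -
    (J v ** (J u ** J w + J w ** J u) + (J u ** J w + J w ** J u) ** J v).
    by rewrite /c; nring.
  by rewrite H.
have c2 : c ** c = 0.
  have : J (u ** (v ** u ** v) + v ** u ** v ** u - u ** (v ** v) ** u - v ** (u ** u) ** v) = 0.
    have -> : u ** (v ** u ** v) + v ** u ** v ** u - u ** (v ** v) ** u - v ** (u ** u) ** v =
      (u ** v - v ** u) ** (u ** v - v ** u) by nring.
    by rewrite uv subrr nmul0r linear0.
  rewrite !linearB J_jordan !jordan_triple !jordan_sqr => <-.
  by rewrite /c; nring.
(* Being central, c commutes with [star c], so the square of [star c] c contains c^2 = 0; the
   C*-identity is then used twice. *)
apply/eqP/nmul_eq0_star/nmul_eq0_star.
rewrite starM starK; have -> : star c ** c ** (star c ** c) = star c ** (c ** star c) ** c by nring.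
rewrite (cent (star c)).
have -> : star c ** (star c ** c) ** c = star c ** star c ** (c ** c) by nring.
by rewrite c2 nmulr0.
Qed.

(** For self-adjoint a and b, a b = 0 gives b a = 0 by taking adjoints, so the images commute and
    twice their product is J(a b + b a) = 0. *)
Lemma jordan_zpp : zero_product_preserving_sa J.
Proof.
move=> a b aa bb ab; have ba : b ** a = 0 by rewrite -aa -bb -starM ab star0.
apply: double_inj; rewrite {2}jordan_comm ?ab ?ba// -J_jordan ab ba addr0 linear0.
by rewrite addr0.
Qed.

End JordanHomomorphisms.

(** * Orthogonal sequences and minimal projections in a closed ideal *)

Section IndecomposableElements.
Variables (R : realType) (B : cstarAlgType R) (I : closedIdeal B).
Implicit Types (a d h k p q u : B).

(** For self-adjoint elements this replaces an inclusion of support projections, which need not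
    exist in [B]. *)
Definition under a h := forall k, k ** h = 0 -> k ** a = 0.

Definition ideal_sa h := [/\ ideal_set I h, self_adjoint h & h != 0].

Definition indecomposable h := ideal_sa h /\ forall a b, ideal_sa a -> ideal_sa b ->
  under a h -> under b h -> a ** b <> 0.

(** Each remainder splits into two orthogonal elements under it; one is kept and the other is split
    again. [under] carries orthogonality to all later remainders. *)
Lemma orthogonal_sequence h : ideal_sa h -> (forall h, ~ indecomposable h) ->
  exists u : nat -> B, (forall n, ideal_sa (u n)) /\ forall n m, n != m -> u n ** u m = 0.
Proof.
move=> hI nind.
have step r : exists f : B * B, ideal_sa r ->
    [/\ ideal_sa f.1, ideal_sa f.2, under f.1 r, under f.2 r & f.1 ** f.2 = 0].
  have [rI|] := pselect (ideal_sa r); last by move=> nr; exists (0, 0).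
  apply: contrapT => H; apply: (nind r); split=> // a b aI bI ar br ab.
  by apply: H; exists (a, b).
have [f fP] := choice step.
pose r := fix r n : B := if n is m.+1 then (f (r m)).2 else h.
have rI n : ideal_sa (r n) by elim: n => [//|n IH] /=; have [] := fP _ IH.
pose u n := (f (r n)).1; exists u; split=> [n|]; first by have [] := fP _ (rI n).
have ur (n k : nat) : u n ** r (n + k.+1)%N = 0.
  elim: k => [|k IH]; first by rewrite addn1; have [] := fP _ (rI n).
  by rewrite addnS; have [_ _ _ /(_ _ IH)] := fP _ (rI (n + k.+1)%N).
have uu (n k : nat) : u n ** u (n + k.+1)%N = 0.
  by have [_ _ /(_ _ (ur n k))] := fP _ (rI (n + k.+1)%N).
have u_sa n : star (u n) = u n by have [[]] := fP _ (rI n).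
move=> n m; rewrite neq_ltn => /orP[] lt.
  by rewrite -(subnKC lt) addSnnS uu.
by rewrite -(subnKC lt) addSnnS -u_sa -[X in _ ** X]u_sa -starM uu star0.
Qed.

Lemma pact_in_ideal h (q : {poly R}) x : ideal_set I x -> ideal_set I (pact h q x).
Proof.
move=> Ix; elim/poly_ind: q => [|q c IH]; first by rewrite pact0; exact: cideal0.
by rewrite pactD pact_mulX pactC; apply: cidealD; [exact: cidealMr|exact: cidealZ].
Qed.

Lemma self_adjoint_cube_eq0 a : self_adjoint a -> a ** a ** a = 0 -> a = 0.
Proof.
move=> aa a3; apply: nmul_eq0_star; apply: nmul_eq0_star; rewrite aa starM aa.
by rewrite nmulA a3 nmul0r.
Qed.

Lemma ucont_pos (f : R -> R) : ucont f -> ucont (fun t => Num.max 0 (f t)).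
Proof.
move=> fu e /fu[c fc]; exists c => x y x1 y1; apply: le_trans (fc x y x1 y1).
have H (s t : R) : s <= t -> `|Num.max 0 s - Num.max 0 t| <= `|s - t|.
  move=> st; rewrite distrC [leRHS]distrC ![`|_|]ger0_norm ?subr_ge0//;
    by case: (leP 0 s) => ?; case: (leP 0 t) => ?; lra.
by case/orP: (le_total (f x) (f y)) => /H//; rewrite distrC [leRHS]distrC.
Qed.

(** [f c] and [g c] have disjoint supports, and g_c(t) - t f_c(t) = c t - t^3, so a^3 = c a once
    both vanish at a. *)
Let f (c t : R) : R := Num.max 0 (t * t - c).
Let g (c t : R) : R := t * Num.max 0 (c - t * t).

Let usq : ucont (fun t : R => t * t).
Proof. by apply: ucontM; exact: ucont_id. Qed.

Let fu c : 0 <= c -> ucont0 (f c).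
Proof.
move=> c0; split; last by rewrite /f mul0r sub0r; apply/max_idPl; rewrite oppr_le0.
by apply: ucont_pos; apply: ucontD => //; exact: ucont_const.
Qed.

Let gu c : ucont0 (g c).
Proof.
split; last by rewrite /g mul0r.
apply: ucontM; first exact: ucont_id.
apply: ucont_pos; under eq_fun do rewrite -[- _]mulN1r.
by apply: ucontD; [exact: ucont_const|exact: ucontZ].
Qed.

Let max_dist (x y e : R) : x - y <= e -> y - x <= e -> `|Num.max 0 x - Num.max 0 y| <= e.
Proof.
move=> h1 h2; rewrite ler_norml; case: (leP 0 x) => ?; case: (leP 0 y) => ?;
  by apply/andP; split; lra.
Qed.

Let max_mulN (x : R) : Num.max 0 x * Num.max 0 (- x) = 0.
Proof.
have [x0|x0] := leP x 0; first by rewrite mul0r.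
by rewrite [Num.max 0 (- x)](max_idPl _) ?mulr0// oppr_le0 ltW.
Qed.

Let max_subN (x : R) : Num.max 0 (- x) - Num.max 0 x = - x.
Proof. by case: (leP 0 x) => ?; case: (leP 0 (- x)) => ?; lra. Qed.

(** For every c >= 0 one of f_c(a) and g_c(a) vanishes, as they are orthogonal and under h. At the
    supremum c of the parameters with g_c(a) = 0 both vanish, by continuity in c. *)
Let indecomposable_small h a : indecomposable h -> ideal_sa a -> under a h -> rnorm a <= 2^-1 ->
  exists2 c : R, 0 < c & a ** a ** a = c%:C *: a.
Proof.
move=> [hI hind] [Ia aa a0] ah small.
have cfcI (k : R -> R) : ucont0 k -> ideal_set I (cfc a k).
  move=> ku; apply: (@cfc_closed _ _ a aa small k [set x | ideal_set I x]) => //.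
    exact: cideal_closed.
  by move=> q; exact: pact_in_ideal.
have cfc_under (k : R -> R) : ucont0 k -> under (cfc a k) h.
  move=> ku z /ah za; apply: (@cfc_closed _ _ a aa small k [set x | z ** x = 0]) => //.
    apply: closed_rnorm => x H; apply/rnorm_le0 => e e0.
    have z1 : 0 < rnorm z + 1 by rewrite ltr_wpDl// rnorm_ge0.
    have [|y zy xy] := H (e / (rnorm z + 1)); first by rewrite divr_gt0.
    rewrite -[z ** x]subr0 -zy -nmulBr (le_trans (rnormM _ _))//.
    rewrite ler_pdivlMr// in xy; apply: le_trans xy.
    by rewrite mulrC ler_wpM2l ?rnorm_ge0// lerDl.
  by move=> q /=; rewrite nmul_pact za pactr0.
have alt c : 0 <= c -> cfc a (g c) <> 0 -> cfc a (f c) = 0.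
  move=> c0 gc; apply: contrapT => fc; apply: (hind (cfc a (f c)) (cfc a (g c))).
  - by split; [exact/cfcI/fu|apply: cfc_self_adjoint => //; exact: fu|exact/eqP].
  - by split; [exact: cfcI|exact: cfc_self_adjoint|exact/eqP].
  - by apply: cfc_under; exact: fu.
  - exact: cfc_under.
  - rewrite -cfcM//; last exact: fu.
    have := cfc_poly aa small 0; rewrite pact0 => <-.
    congr cfc; apply/funext => t; rewrite horner0 mulr0 /f /g.
    by rewrite -[c - t * t]opprB mulrCA max_mulN mulr0.
pose E := [set c : R | 0 <= c <= 1 /\ cfc a (g c) = 0].
have E0 : E 0.
  split; first by rewrite lexx ler01.
  have := cfc_poly aa small 0; rewrite pact0 => <-.
  congr cfc; apply/funext => t; rewrite horner0 mulr0 /g.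
  rewrite sub0r; have -> : Num.max 0 (- (t * t)) = 0 :> R; last by rewrite mulr0.
  by apply/max_idPl; rewrite oppr_le0 -expr2 sqr_ge0.
have Esup : has_sup E.
  by split; [exists 0|exists 1 => c [/andP[]]].
pose c := sup E.
have c0 : 0 <= c by apply: ub_le_sup => //; case: Esup.
have gc : cfc a (g c) = 0.
  apply/rnorm_le0 => e e0; have [d [d01 gd] dc] := sup_adherent e0 Esup.
  have dle : d <= c by apply: ub_le_sup => //; case: Esup.
  rewrite -[cfc _ _]subr0 -gd; apply: cfc_dist => // t /andP[t0 t1].
  rewrite /g -mulrBr normrM -[e]mul1r; apply: ler_pM; rewrite ?normr_ge0//.
    by rewrite ler_norml t0.
  by apply: max_dist; rewrite -/c in dc *; lra.
have fc : cfc a (f c) = 0.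
  apply/rnorm_le0 => e e0; have [ce|ce] := leP (c + e) 1.
    have ce0 : 0 <= c + e by rewrite addr_ge0// ltW.
    have -> : cfc a (f c) = cfc a (f c) - cfc a (f (c + e)).
      rewrite (alt (c + e)) ?subr0// => gce; have : c + e <= c.
        by apply: ub_le_sup; [case: Esup|split=> //; rewrite ce0].
      by rewrite gerDl leNgt e0.
    apply: cfc_dist; [by []|by []|exact: fu|exact: fu|].
    by move=> t _; apply: max_dist; lra.
  (* When c + e > 1, the function (t^2 - c)_+ is already at most e on [-1, 1]. *)
  apply: rnorm_cfc_le; [by []|by []|exact: fu|].
  move=> t /andP[t0 t1]; have tt : t * t <= 1 by nra.
  rewrite ger0_norm; last by rewrite le_max lexx.
  by rewrite ge_max ltW//= lerBlDr; lra.
have idu : ucont0 (id : R -> R) by exact: ucont0_id.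
have id2u := ucont0M idu idu; have id3u := ucont0M id2u idu.
have key : c%:C *: a - a ** a ** a = 0.
  have <- : cfc a (fun t => c * t - t * t * t) = c%:C *: a - a ** a ** a.
    rewrite cfcB ?cfcZ ?(cfcM aa small id2u idu) ?(cfcM aa small idu idu) ?cfc_id//.
    exact: ucont0Z.
  have -> : (fun t => c * t - t * t * t) = (fun t => g c t - t * f c t).
    apply/funext => t; rewrite /f /g -mulrBr -[c - t * t]opprB max_subN; ring.
  rewrite cfcB// ?(cfcM aa small idu (fu c0)) ?gc ?fc ?nmulr0 ?subrr//.
  exact: ucont0M idu (fu c0).
move/eqP : key; rewrite subr_eq0 => /eqP key.
exists c => //; rewrite lt_def c0 andbT; apply/eqP => cE; move: a0 => /eqP; apply.
by apply: self_adjoint_cube_eq0 => //; rewrite -key cE scale0r.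
Qed.

Lemma indecomposable_cube h a : indecomposable h -> ideal_sa a -> under a h ->
  exists2 c : R, 0 < c & a ** a ** a = c%:C *: a.
Proof.
move=> hind [Ia aa a0] ah; have [k k0 ka] := small_scale a.
have kn0 : k%:C != 0 :> R[i] by rewrite (inj_eq (@complexI R) k 0) lt0r_neq0.
have [|||c c0 cE] := @indecomposable_small h (k%:C *: a) hind.
- by split; [exact: cidealZ|exact: self_adjointZr|rewrite scaler_eq0 negb_or kn0].
- by move=> z /ah za; rewrite -nscaleAr za scaler0.
- exact: ka.
exists (c / k ^+ 2); first by rewrite divr_gt0// exprn_gt0.
move: cE; rewrite -!nscaleAr -!nscaleAl !scalerA => cE.
have : k%:C * k%:C * k%:C != 0 :> R[i] by rewrite !mulf_neq0.
move=> /scalerI; apply; rewrite cE scalerA -!rmorphM /=; congr (_%:C *: _).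
by field; rewrite lt0r_neq0.
Qed.

(** h^3 = c h makes p = h^2 / c a projection. A nonzero self-adjoint a = p d p likewise satisfies
    a^3 = e a, and its projection a^2 / e must equal p, since it is orthogonal to its complement in
    p. Then (a + s p)(a - s p) = 0 with s^2 = e, so a is p or -p up to the factor s. *)
Lemma minimal_projection h : indecomposable h -> exists p,
  [/\ ideal_sa p, p ** p = p & forall d, exists l : R[i], p ** d ** p = l *: p].
Proof.
move=> hind; have [[Ih hh h0] hortho] := hind.
have [c c0 h3] := indecomposable_cube hind (And3 Ih hh h0) (fun k kh => kh).
have cn0 : c%:C != 0 :> R[i] by rewrite (inj_eq (@complexI R) c 0) lt0r_neq0.
have projE a (e : R) : 0 < e -> a ** a ** a = e%:C *: a ->
    (e^-1%:C *: (a ** a)) ** (e^-1%:C *: (a ** a)) = e^-1%:C *: (a ** a).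
  move=> c1 a3; rewrite -nscaleAr -nscaleAl nmulA a3 -nscaleAl !scalerA -!rmorphM /=.
  by rewrite mulrAC -mulrA mulfV ?lt0r_neq0// mulr1.
have sqr_n0 a : self_adjoint a -> a != 0 -> a ** a != 0.
  by move=> aa; apply: contra => /eqP a2; apply/eqP; apply: nmul_eq0_star; rewrite aa.
pose p := c^-1%:C *: (h ** h).
have p_sa : self_adjoint p by apply/self_adjointZr/self_adjoint_comm.
have pp : p ** p = p by exact: projE.
have Ip : ideal_set I p by apply/cidealZ/cidealMr.
have p0 : p != 0.
  rewrite scaler_eq0 negb_or sqr_n0// andbT.
  by rewrite (inj_eq (@complexI R) c^-1 0) lt0r_neq0// invr_gt0.
have ph : under p h by move=> k kh; rewrite -nscaleAr nmulA kh nmul0r scaler0.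
clearbody p; have real_corner d : self_adjoint d -> exists l : R, p ** d ** p = l%:C *: p.
  move=> dd; set a := p ** d ** p.
  have [a0|a_n0] := eqVneq a 0; first by exists 0; rewrite a0 scale0r.
  have aa : self_adjoint a by rewrite /self_adjoint /= !starM p_sa dd nmulA.
  have Ia : ideal_set I a by apply/cidealMl.
  have pa : p ** a = a by rewrite /a !nmulA pp.
  have ap : a ** p = a by rewrite /a -nmulA pp.
  have ah : under a h by move=> k /ph kp; rewrite -pa nmulA kp nmul0r.
  have [e e0 a3] := indecomposable_cube hind (And3 Ia aa a_n0) ah.
  pose q := e^-1%:C *: (a ** a).
  have qq : q ** q = q by exact: projE.
  have q_sa : self_adjoint q by apply/self_adjointZr/self_adjoint_comm.
  have Iq : ideal_set I q by apply/cidealZ/cidealMr.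
  have q0 : q != 0.
    rewrite scaler_eq0 negb_or sqr_n0// andbT.
    by rewrite (inj_eq (@complexI R) e^-1 0) lt0r_neq0// invr_gt0.
  have qh : under q h by move=> k /ah ka; rewrite -nscaleAr nmulA ka nmul0r scaler0.
  have IB x y : ideal_set I x -> ideal_set I y -> ideal_set I (x - y).
    by move=> Ix Iy; apply: cidealD => //; rewrite -scaleN1r; exact: cidealZ.
  have ID := @cidealD _ _ I.
  have underB x y : under x h -> under y h -> under (x - y) h.
    by move=> xh yh k kh; rewrite nmulBr xh// yh// subrr.
  have underD x y : under x h -> under y h -> under (x + y) h.
    by move=> xh yh k kh; rewrite nmulDr xh// yh// addr0.
  have pq : p = q.
    apply/eqP; rewrite -subr_eq0; apply: contrapT => /negP pq0.
    apply: (hortho (p - q) q).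
    - by split; [exact: IB|exact: self_adjointB|].
    - by split.
    - exact: underB.
    - by [].
    - by rewrite nmulBl qq -nscaleAr nmulA pa subrr.
  have a2 : a ** a = e%:C *: p.
    by rewrite pq scalerA -rmorphM /= mulfV ?lt0r_neq0// scale1r.
  pose s := Num.sqrt e; have ss : s * s = e by rewrite -expr2 sqr_sqrtr// ltW.
  have sp_sa : self_adjoint (s%:C *: p) by exact: self_adjointZr.
  have Isp : ideal_set I (s%:C *: p) by exact: cidealZ.
  have sph : under (s%:C *: p) h by move=> k /ph kp; rewrite -nscaleAr kp scaler0.
  have [as0|as0] := eqVneq (a + s%:C *: p) 0.
    by exists (- s); apply/eqP; rewrite rmorphN scaleNr -addr_eq0 as0.
  have [as1|as1] := eqVneq (a - s%:C *: p) 0.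
    by exists s; apply/eqP; rewrite -subr_eq0 as1.
  exfalso; apply: (hortho (a + s%:C *: p) (a - s%:C *: p)).
  - by split; [exact: ID|exact: self_adjointD|].
  - by split; [exact: IB|exact: self_adjointB|].
  - exact: underD.
  - exact: underB.
  - rewrite nmulDl !nmulBr -!nscaleAr -!nscaleAl pa ap pp a2 !scalerA -rmorphM /= ss.
    by set u := s%:C *: a; set v := e%:C *: p; nring.
exists p; split=> // d; have [u [v [us vs ->]]] := cartesian_decomposition d.
have [l lE] := real_corner _ us; have [m mE] := real_corner _ vs.
exists (l%:C + 'i * m%:C); rewrite nmulDr nmulDl -nscaleAr -nscaleAl lE mE.
by rewrite scalerA scalerDl.
Qed.

End IndecomposableElements.

(** * Automatic continuity of Jordan isomorphisms *)

Section AutomaticContinuity.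
Variables (R : realType) (A B : cstarAlgType R) (J : {linear A -> B}) (K : {linear B -> A}).
Hypotheses (J_jordan : jordan_hom J) (JK : cancel K J) (KJ : cancel J K).
Implicit Types (x : A) (b h y : B).

Let J_surj b : exists a, J a = b. Proof. by exists (K b). Qed.

Let K_jordan : jordan_hom K.
Proof. by move=> b c; apply: (can_inj KJ); rewrite J_jordan !JK. Qed.

(** [J] is onto, so a Jordan product with an element of [B] is one with some J y for a fixed y, and
    x y + y x tends to 0 with x. *)
Lemma separating_ideal : exists I : closedIdeal B, ideal_set I = separating J.
Proof.
apply: closed_jordan_ideal.
- by move=> e e0; exists 0; rewrite linear0 subrr !rnorm0 ltW.
- move=> b c bs cs e e0; have e2 : 0 < e / 2 by rewrite divr_gt0.
  have [x [xe xb]] := bs _ e2; have [y [ye yc]] := cs _ e2.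
  exists (x + y); rewrite linearD opprD addrACA [e]splitr.
  by split; [apply: le_trans (rnormD x y) _|apply: le_trans (rnormD _ _) _]; rewrite lerD.
- move=> k b bs e e0; pose m := complex.Re `|k| + 1.
  have m0 : 0 <= complex.Re `|k| by rewrite -(lecR 0) ReK// normr_ge0.
  have m1 : 0 < m by rewrite ltr_wpDl.
  have [x [xe xb]] := bs _ (divr_gt0 e0 m1).
  have H (t : R) : 0 <= t -> t <= e / m -> complex.Re `|k| * t <= e.
    move=> t0; rewrite ler_pdivlMr// => te; apply: le_trans te.
    by rewrite mulrC ler_wpM2l// lerDl.
  exists (k *: x); rewrite linearZ -scalerBr !rnormZ.
  by split; apply: H => //; exact: rnorm_ge0.
- move=> b c bs e e0; have [y <-] := J_surj c.
  pose m := 2 * (rnorm y + rnorm (J y)) + 1.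
  have y0 := rnorm_ge0 y; have Jy0 := rnorm_ge0 (J y).
  have m1 : 0 < m by rewrite /m; lra.
  have [x [xe xb]] := bs _ (divr_gt0 e0 m1).
  rewrite ler_pdivlMr// in xe; rewrite ler_pdivlMr// in xb.
  exists (x ** y + y ** x); rewrite J_jordan; split.
    apply: le_trans (rnormD _ _) _; have := rnormM x y; have := rnormM y x.
    have := rnorm_ge0 x; move: xe; rewrite /m; nra.
  have -> : J x ** J y + J y ** J x - (b ** J y + J y ** b) =
    (J x - b) ** J y + J y ** (J x - b) by nring.
  apply: le_trans (rnormD _ _) _; have := rnormM (J x - b) (J y); have := rnormM (J y) (J x - b).
  have := rnorm_ge0 (J x - b); move: xb; rewrite /m; nra.
- apply: closed_rnorm => b H e e0; have e2 : 0 < e / 2 by rewrite divr_gt0.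
  have [c cs bc] := H _ e2; have [x [xe xc]] := cs _ e2; exists x; split.
    by apply: le_trans xe _; rewrite ler_pdivrMr// ler_peMr ?ler1n// ltW.
  by apply: le_trans (rnorm_dist_triangle c _ _) _; rewrite [e]splitr lerD// rnorm_distC.
Qed.

(** Some arbitrarily small x has J x close to h, so h J(x) h stays close to h^3, which is nonzero;
    rescaling x by M / d reaches the bound. *)
Lemma separating_unbounded h (M e : R) : separating J h -> self_adjoint h -> h != 0 ->
  0 < M -> 0 < e -> exists x, rnorm x <= e /\ M <= rnorm (h ** J x ** h).
Proof.
move=> hs hh h0 M0 e0; pose d := rnorm (h ** h ** h) / 2.
have h3 : 0 < rnorm (h ** h ** h).
  by rewrite rnorm_gt0; apply: contra h0 => /eqP h3; apply/eqP; exact: self_adjoint_cube_eq0.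
have d0 : 0 < d by rewrite divr_gt0.
pose m := rnorm h * rnorm h + 1; have hh0 := rnorm_ge0 h.
have m1 : 0 < m by rewrite ltr_wpDl// mulr_ge0.
have e1 : 0 < Num.min (e * d / M) (d / m) by rewrite lt_min !divr_gt0// mulr_gt0.
have [x []] := hs _ e1; rewrite !le_min => /andP[xe _] /andP[_ xh].
exists ((M / d)%:C *: x); rewrite linearZ -nscaleAr -nscaleAl !rnormZr gtr0_norm ?divr_gt0//; split.
  rewrite ler_pdivlMr// in xe.
  by rewrite mulrAC ler_pdivrMr// mulrC.
rewrite mulrAC ler_pdivlMr// ler_wpM2l ?(ltW M0)//.
have : rnorm (h ** h ** h) - rnorm (h ** J x ** h) <= d; last first.
  have : rnorm (h ** h ** h) = d + d by rewrite /d; field.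
  by lra.
have := rnormD (h ** h ** h - h ** J x ** h) (h ** J x ** h); rewrite subrK.
have -> : h ** h ** h - h ** J x ** h = - (h ** (J x - h) ** h) by nring.
rewrite rnormN; have := rnormM3 h (J x - h) h.
rewrite ler_pdivlMr// in xh; rewrite /m in xh; have := rnorm_ge0 (J x - h).
by move: xh; lra.
Qed.

(* Gliding hump: [J] would be unbounded on infinitely many orthogonal corners at once. *)
Lemma no_orthogonal_separating (u : nat -> B) : (forall n, separating J (u n)) ->
  (forall n, self_adjoint (u n)) -> (forall n, u n != 0) ->
  (forall n m, n != m -> u n ** u m = 0) -> False.
Proof.
move=> us uh u0 uu; have [I IE] := separating_ideal.
pose q n := K (u n).
have qq n m : n != m -> q n ** q m = 0.
  by move=> nm; apply: (jordan_zpp K_jordan (fun a => ex_intro _ (J a) (KJ a))) => //; exact: uu.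
(* The square of u_n is used because [J] sends q (q x q) q to u^2 J(x) u^2. The factor |u_n|^2 is
   cancelled later by |u_n J(z) u_n| <= |u_n|^2 |J z|. *)
have H n : exists x, rnorm (q n ** x ** q n) <= 1 * 2^-1 ^+ n /\
    n.+1%:R * (rnorm (u n) * rnorm (u n)) <= rnorm (u n ** u n ** J x ** (u n ** u n)).
  have u1 : 0 < rnorm (u n) by rewrite rnorm_gt0.
  have m0 : 0 < rnorm (q n) * rnorm (q n) + 1 by rewrite ltr_wpDl// mulr_ge0 ?rnorm_ge0.
  have [|||||x [x1 x2]] := @separating_unbounded (u n ** u n)
      (n.+1%:R * (rnorm (u n) * rnorm (u n))) (2^-1 ^+ n / (rnorm (q n) * rnorm (q n) + 1)).
  - by rewrite -IE; apply: cidealMl; rewrite IE.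
  - exact: self_adjoint_comm.
  - by rewrite -rnorm_eq0 rnorm_sqr// expf_eq0 rnorm_eq0 (negPf (u0 n)).
  - by rewrite !mulr_gt0 ?ltr0n.
  - by rewrite divr_gt0// exprn_gt0// invr_gt0.
  exists x; split=> //; rewrite mul1r; rewrite ler_pdivlMr// in x1; apply: le_trans x1.
  apply: le_trans (rnormM3 _ _ _) _; rewrite mulrAC mulrC ler_wpM2l ?rnorm_ge0// lerDl//.
have {H}[x xP] := choice H.
pose S n := \sum_(k < n) q k ** x k ** q k.
have [|z Sz] := @complete_rnorm R A S.
  apply: (@geometric_cauchy _ _ _ 1) => n.
  have -> : S n.+1 - S n = q n ** x n ** q n.
    by rewrite /S big_ord_recr /=; set s := \sum_(i < n) _; nring.
  by have [] := xP n.
(* Compression by q_n kills every hump but the one of index n, by orthogonality. *)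
have qSq n m : (n < m)%N -> q n ** S m ** q n = q n ** (q n ** x n ** q n) ** q n.
  move=> nm; rewrite /S nmul_sumr nmul_suml (bigD1 (Ordinal nm))//= big1 ?addr0// => k kn.
  have -> : q n ** (q k ** x k ** q k) ** q n = q n ** q k ** (x k ** q k ** q n) by nring.
  by rewrite qq ?nmul0r// eq_sym.
have qzq n : q n ** z ** q n = q n ** (q n ** x n ** q n) ** q n.
  apply/eqP; rewrite -subr_eq0; apply/eqP/rnorm_le0 => e e0.
  have m0 : 0 < rnorm (q n) * rnorm (q n) + 1 by rewrite ltr_wpDl// mulr_ge0 ?rnorm_ge0.
  have [N HN] := Sz _ (divr_gt0 e0 m0); have := HN (maxn N n.+1) (leq_maxl _ _).
  rewrite -(@qSq n (maxn N n.+1)) ?leq_maxr//; move: (S _) => s; rewrite ler_pdivlMr// => sz.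
  have -> : q n ** z ** q n - q n ** s ** q n = - (q n ** (s - z) ** q n) by nring.
  rewrite rnormN; apply: le_trans sz.
  apply: le_trans (rnormM3 _ _ _) _; rewrite mulrAC mulrC ler_wpM2l ?rnorm_ge0// lerDl//.
have Jz n : n.+1%:R <= rnorm (J z).
  have u1 : 0 < rnorm (u n) by rewrite rnorm_gt0.
  rewrite -(ler_pM2r (mulr_gt0 u1 u1)); have [_ h] := xP n; apply: le_trans h _.
  have -> : u n ** u n ** J (x n) ** (u n ** u n) = u n ** J z ** u n.
    have := congr1 J (qzq n); rewrite !(jordan_triple J_jordan) !JK => ->.
    by nring.
  by apply: le_trans (rnormM3 _ _ _) _; rewrite -mulrA mulrCA.
have := archi_boundP (rnorm_ge0 (J z)); rewrite ltNge.
move=> /negP; apply; apply: le_trans (Jz (Num.bound (rnorm (J z)))).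
by rewrite ler_nat.
Qed.

Theorem jordan_isomorphism_bounded : bounded_op J.
Proof.
apply: closed_graph; have [I IE] := separating_ideal.
(* A nonzero separating y would give the nonzero self-adjoint separating element [star y] y. *)
suff H h : ideal_sa I h -> False.
  have sa_eq0 c : self_adjoint c -> separating J c -> c = 0.
    move=> cc cs; apply/eqP; apply: contrapT => /negP c0.
    by apply: (H c); split=> //; rewrite IE.
  move=> y ys; apply: nmul_eq0_star; apply: sa_eq0; first exact: self_adjoint_starM.
  by rewrite -IE; apply: cidealMl; rewrite IE.
move=> hI; have [[g gind]|nind] := pselect (exists g, indecomposable I g); last first.
  have [|u [uI uu]] := orthogonal_sequence hI.
    by move=> g gi; apply: nind; exists g.
  by apply: (@no_orthogonal_separating u) => // n; have [] := uI n; rewrite IE.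
have [p [[Ip p_sa p0] pp pBp]] := minimal_projection gind.
pose q := K p; have q0 : 0 < rnorm q.
  rewrite rnorm_gt0; apply: contra p0 => /eqP q0.
  by rewrite -(JK p) -/q q0 linear0.
have M0 : 0 < rnorm q * rnorm p + 1 by rewrite ltr_wpDl// mulr_ge0 ?rnorm_ge0.
have ps : separating J p by rewrite -IE.
have [x [x1]] := separating_unbounded ps p_sa p0 M0 ltr01.
have [l lE] := pBp (J x); rewrite lE leNgt => /negP; apply.
(* Pulling p J(x) p = l p back along [K] gives |l| |q| <= |q|^2, hence |p J(x) p| <= |q| |p|,
   against the choice of x. *)
have qxq : q ** x ** q = l *: q.
  apply: (can_inj KJ); rewrite (jordan_triple J_jordan) linearZ.
  by rewrite /q JK lE.
have : complex.Re `|l| * rnorm q <= rnorm q * rnorm q.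
  rewrite -rnormZ -qxq; apply: le_trans (rnormM3 _ _ _) _.
  by rewrite ler_wpM2r ?rnorm_ge0// ler_piMr// rnorm_ge0.
rewrite ler_pM2r// => lq; rewrite rnormZ.
by rewrite ltr_pwDr// ler_wpM2r ?rnorm_ge0.
Qed.

End AutomaticContinuity.

Lemma bounded_op_closed_kernel (R : realType) (A B : cstarAlgType R) (f : {linear A -> B}) :
  bounded_op f -> closed [set a | f a = 0].
Proof.
move=> /bounded_op_rnorm[K KP]; apply: closed_rnorm => x H; apply/rnorm_le0 => e e0.
have K1 : 0 < `|K| + 1 by rewrite ltr_wpDl.
have [y fy xy] := H _ (divr_gt0 e0 K1); rewrite ler_pdivlMr// in xy.
rewrite -[f x]subr0 -fy -linearB; apply: le_trans (KP _) (le_trans _ xy).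
by rewrite mulrC ler_wpM2l ?rnorm_ge0// (le_trans (ler_norm K))// lerDl.
Qed.

Theorem theorem2p4 (R : realType) (A B : cstarAlgType R) :
  (jordan_isomorphic A B <->
   exists theta : {linear A -> B},
     [/\ bounded_op theta, bijective theta & zero_product_preserving_sa theta])
  /\
  (forall theta : {linear A -> B},
     bounded_op theta -> zero_product_preserving_sa theta ->
     (forall b : B, exists a : A, theta a = b) ->
     exists I : closedIdeal A,
       [/\ ideal_set I = [set a : A | theta a = 0],
           cstar_identity (quotientAlg I)
         & jordan_isomorphic B (quotientAlg I)]).
Proof.
split=> [|theta theta_bnd theta_zpp theta_surj]; last first.
  have [J [J_jordan J_surj J0]] := zpp_jordan_factor theta_bnd theta_zpp theta_surj.
  have kerE : [set a | J a = 0] = [set a | theta a = 0].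
    by apply/seteqP; split=> a /J0.
  have [|I [IE Ic BI]] := jordan_quotient J_jordan J_surj.
    by rewrite kerE; exact: bounded_op_closed_kernel.
  by exists I; rewrite IE kerE.
split=> [[J [[K KJ JK] J_jordan]]|[theta [theta_bnd theta_bij theta_zpp]]].
  have [|K' KE] := @linear_map_of _ B A K.
    by move=> k b c; apply: (can_inj KJ); rewrite linearP !JK.
  exists J; split; last 1 first.
  - by apply: jordan_zpp J_jordan _ => b; exists (K b).
  - by apply: (@jordan_isomorphism_bounded _ _ _ J K' J_jordan) => x; rewrite KE.
  - by exists K.
have [s sK Ks] := theta_bij.
have [|J [J_jordan J_surj J0]] := zpp_jordan_factor theta_bnd theta_zpp.
  by move=> b; exists (s b).
(* The Jordan factor is onto and has the kernel of [theta], here zero, so a right inverse of it is a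
   two-sided one. *)
exists J; split=> //; have [r rE] := choice J_surj; exists r => // a.
apply: (can_inj sK); apply/eqP; rewrite -subr_eq0 -linearB; apply/eqP/J0.
by rewrite linearB rE subrr.
Qed.
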